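(* Let $\phi=\tilde p/p$ be a bidegree $(m,n)$ rational inner function on $\mathbb{D}^2$ and let $\alpha\in\mathbb{T}$ be an exceptional value for $\phi$. Then the Clark embedding $J_\alpha:K_\phi\to L^2(\sigma_\alpha)$ is not unitary.
   Context: $\mathbb{D}$ is the open unit disk and $\mathbb{T}$ the unit circle. A rational inner function (RIF) on $\mathbb{D}^2$ is a bounded holomorphic rational function on $\mathbb{D}^2$ whose non-tangential boundary values have modulus $1$ almost everywhere on $\mathbb{T}^2$. Here $\phi=\tilde p/p$ where $p\in\mathbb{C}[z_1,z_2]$ has no zeros in $\mathbb{D}^2$, has degree $m$ in $z_1$ and degree $n$ in $z_2$, $\tilde p(z)=z_1^m z_2^n\,\overline{p(1/\bar z_1,1/\bar z_2)}$, and $p,\tilde p$ have no common factor. Then $\phi$ has bidegree $(m,n)$. Standing assumption: $m>0$ and $n>0$. For $\alpha\in\mathbb{T}$, the Clark measure $\sigma_\alpha$ is the unique positive Borel measure on $\mathbb{T}^2$ with $\frac{1-|\phi(z)|^2}{|\alpha-\phi(z)|^2}=\int_{\mathbb{T}^2}P_{z}(\zeta)\,d\sigma_\alpha(\zeta)$ for $z\in\mathbb{D}^2$, where $P_z(\zeta)=\prod_{j=1}^2\frac{1-|z_j|^2}{|\zeta_j-z_j|^2}$. $\alpha\in\mathbb{T}$ is exceptional for $\phi$ if $\phi(\tau,z_2)\equiv\alpha$ or $\phi(z_1,\tau)\equiv\alpha$ for some $\tau\in\mathbb{T}$. The model space is $K_\phi=H^2(\mathbb{D}^2)\ominus\phi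 H^2(\mathbb{D}^2)$, where $H^2(\mathbb{D}^2)$ is the Hardy space of the bidisk; its reproducing kernel is $K_w(z)=(1-\overline{\phi(w)}\phi(z))C_w(z)$, where $C_w(z)=\prod_{j=1}^2\frac{1}{1-z_j\bar w_j}$. The Clark embedding $J_\alpha:K_\phi\to L^2(\sigma_\alpha)$ is the linear isometry determined by $J_\alpha[K_w](\zeta)=(1-\alpha\overline{\phi(w)})C_w(\zeta)$ for $w\in\mathbb{D}^2$, $\zeta\in\mathbb{T}^2$; it preserves inner products of reproducing kernels and extends to all of $K_\phi$ by density of their span. Being unitary means being an isometry onto $L^2(\sigma_\alpha)$. *)

(* Defs.v *)
From HB Require Import structures.
From mathcomp Require Import all_boot all_order all_algebra.
From mathcomp Require Import complex.
From mathcomp Require Import all_classical all_reals all_analysis.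
Set Implicit Arguments.
Unset Strict Implicit.
Unset Printing Implicit Defensive.
Import Order.TTheory GRing.Theory Num.Theory.
Import numFieldNormedType.Exports.
Export ComplexField.Normc.
Local Open Scope classical_set_scope.
Local Open Scope ring_scope.

#[non_forgetful_inheritance]
HB.instance Definition _ (R : realType) := NormedModule.copy R[i] R[i]^o.

(* The library norm on R[i] is R[i]-valued; [normc z] is the real modulus. *)
Definition bidisk (R : realType) : set (R[i] * R[i]) :=
  [set z | normc z.1 < 1 /\ normc z.2 < 1].

Definition circle (R : realType) : Type := {z : R[i] | normc z == 1}.

Definition circle_val (R : realType) (zeta : circle R) : R[i] := sval zeta.
Coercion circle_val : circle >-> complex.

Lemma circle1_subproof (R : realType) : normc (1 : R[i]) == 1.
Proof. exact/eqP/normc1. Qed.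

HB.instance Definition _ (R : realType) :=
  Choice.copy (circle R) {z : R[i] | normc z == 1}.
HB.instance Definition _ (R : realType) :=
  isPointed.Build (circle R) (exist _ 1 (circle1_subproof R)).

Definition circle_coord (R : realType) (zeta : circle R) : R * R :=
  (complex.Re (zeta : R[i]), complex.Im (zeta : R[i])).

(* The Borel sigma-algebra of the circle: the trace of that of C = R^2. *)
HB.instance Definition _ (R : realType) :=
  Measurable.copy (circle R)
    (g_sigma_algebra_preimageType (@circle_coord R)).

Notation torus R := (circle R * circle R)%type.

(* Elements of {poly {poly R[i]}} are polynomials in z1 with coefficients that *)
(* are polynomials in z2; [p.[z1, z2]], [size p] and [sizeY p] are as in polyXY *)
(* (sizes are degrees plus one). *)
Definition reflection (R : realType) (m n : nat) (p : {poly {poly R[i]}}) :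
    {poly {poly R[i]}} :=
  \poly_(j < m.+1) \poly_(k < n.+1) conjc (p`_(m - j)`_(n - k)).

Lemma reflectionE (R : realType) (m n : nat) (p : {poly {poly R[i]}})
    (z1 z2 : R[i]) :
  (size p <= m.+1)%N -> (sizeY p <= n.+1)%N -> z1 != 0 -> z2 != 0 ->
  (reflection m n p).[z1, z2] =
  z1 ^+ m * z2 ^+ n * conjc (p.[(conjc z1)^-1, (conjc z2)^-1]).
Proof.
move=> pm pn z10 z20; rewrite /reflection horner_poly horner_sum.
rewrite (horner_coef_wide _ pm) horner_sum rmorph_sum /= mulr_sumr.
rewrite (reindex_inj rev_ord_inj); apply: eq_bigr => j _ /=.
have jm : (j <= m)%N by rewrite -ltnS.
rewrite subSS subKn// !hornerM horner_poly -!rmorphXn !hornerC.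
rewrite (horner_coef_wide _ (leq_trans (max_size_coefXY _ _) pn)).
rewrite rmorphM rmorph_sum /= rmorphXn !fmorphV /= conjcK.
rewrite !mulr_suml mulr_sumr (reindex_inj rev_ord_inj).
apply: eq_bigr => k _ /=.
have kn : (k <= n)%N by rewrite -ltnS.
rewrite subSS subKn// rmorphM rmorphXn fmorphV /= conjcK.
have expB (z : R[i]) a b : (b <= a)%N -> z != 0 -> z ^+ (a - b) = z ^+ a / z ^+ b.
  by move=> ba z0; rewrite -[in RHS](subnK ba) exprD mulfK // expf_neq0.
rewrite !expB// !exprVn -!mulrA mulrCA [RHS]mulrCA; congr (_ * _).
by rewrite [RHS]mulrCA; congr (_ * _); exact: mulrCA.
Qed.

Definition no_common_factor (R : realType) (p q : {poly {poly R[i]}}) : Prop :=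
  forall d u v : {poly {poly R[i]}},
    p = d * u -> q = d * v -> d \is a GRing.unit.

Definition rif_denominator (R : realType) (m n : nat)
    (p : {poly {poly R[i]}}) : Prop :=
  [/\ forall z, bidisk z -> p.[z.1, z.2] != 0,
      size p = m.+1, sizeY p = n.+1 &
      no_common_factor p (reflection m n p)].

Definition rif (R : realType) (m n : nat) (p : {poly {poly R[i]}})
    (z : R[i] * R[i]) : R[i] :=
  (reflection m n p).[z.1, z.2] / p.[z.1, z.2].

(* Product of two Stolz angles with vertices the components of [zeta]. *)
Definition stolz (R : realType) (M : R) (zeta : R[i] * R[i]) :
    set (R[i] * R[i]) :=
  [set z | [/\ bidisk z,
    normc (z.1 - zeta.1) <= M * (1 - normc z.1) &
    normc (z.2 - zeta.2) <= M * (1 - normc z.2)]].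

Definition nontangential_limit (R : realType) (phi : R[i] * R[i] -> R[i])
    (zeta : R[i] * R[i]) (l : R[i]) : Prop :=
  forall M : R, 0 < M -> phi @ within (stolz M zeta) (nbhs zeta) --> l.

Definition expi (R : realType) (t : R) : R[i] := (cos t +i* sin t)%C.

(* Null sets of the torus are described in angular coordinates. *)
Definition inner_function (R : realType) (phi : R[i] * R[i] -> R[i]) : Prop :=
  [/\ exists M : R, forall z, bidisk z -> normc (phi z) <= M,
      forall z, bidisk z -> differentiable phi z &
      {ae (@lebesgue_measure R \x @lebesgue_measure R)%E, forall t : R * R,
        exists2 l, nontangential_limit phi (expi t.1, expi t.2) l &
                   normc l = 1}].

(* On the disk [phi (tau, _)] has no singularity: if p(tau, z2) = 0 with *)
(* |z2| < 1 then p(tau, _) = 0 identically, and z1 - tau divides both p and *)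
(* its reflection. *)
Definition exceptional (R : realType) (phi : R[i] * R[i] -> R[i])
    (alpha : circle R) : Prop :=
  exists tau : circle R,
    (forall w : R[i], normc w < 1 -> phi (tau : R[i], w) = alpha) \/
    (forall w : R[i], normc w < 1 -> phi (w, tau : R[i]) = alpha).

Definition poisson (R : realType) (z : R[i] * R[i]) (zeta : torus R) : R :=
  (1 - normc z.1 ^+ 2) / normc ((zeta.1 : R[i]) - z.1) ^+ 2 *
  ((1 - normc z.2 ^+ 2) / normc ((zeta.2 : R[i]) - z.2) ^+ 2).

Definition clark_measure (R : realType) (phi : R[i] * R[i] -> R[i])
    (alpha : circle R) (sigma : {measure set (torus R) -> \bar R}) : Prop :=
  forall z, bidisk z ->
    ((1 - normc (phi z) ^+ 2) / normc ((alpha : R[i]) - phi z) ^+ 2)%:E =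
    (\int[sigma]_zeta (poisson z zeta)%:E)%E.

(* Functions on the bidisk are total functions on C^2; only their values on *)
(* [bidisk] are ever used. A double array [a] holds Taylor coefficients. *)
Definition square_summable (R : realType) (a : nat -> nat -> R[i]) : Prop :=
  (\esum_(jk in [set: nat * nat]) (normc (a jk.1 jk.2) ^+ 2)%:E < +oo)%E.

Definition hardy_expansion (R : realType) (f : R[i] * R[i] -> R[i])
    (a : nat -> nat -> R[i]) : Prop :=
  square_summable a /\
  forall z, bidisk z ->
    (fun N => \sum_(j < N) \sum_(k < N) a j k * z.1 ^+ j * z.2 ^+ k : R[i])
      @ \oo --> f z.

Definition hardy (R : realType) (f : R[i] * R[i] -> R[i]) : Prop :=
  exists a, hardy_expansion f a.

Definition hardy_coef (R : realType) (f : R[i] * R[i] -> R[i]) :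
    nat -> nat -> R[i] :=
  get [set a | hardy_expansion f a].

Definition hardy_dot (R : realType) (f g : R[i] * R[i] -> R[i]) : R[i] :=
  limn (fun N => \sum_(j < N) \sum_(k < N)
    hardy_coef f j k * conjc (hardy_coef g j k) : R[i]).

Definition hardy_normsq (R : realType) (f : R[i] * R[i] -> R[i]) : \bar R :=
  (\esum_(jk in [set: nat * nat])
    (normc (hardy_coef f jk.1 jk.2) ^+ 2)%:E)%E.

Definition model_space (R : realType) (phi : R[i] * R[i] -> R[i]) :
    set (R[i] * R[i] -> R[i]) :=
  [set f | hardy f /\
    forall h, hardy h -> hardy_dot f (fun z => phi z * h z) = 0].

Definition szego (R : realType) (w z : R[i] * R[i]) : R[i] :=
  (1 - z.1 * conjc w.1)^-1 * (1 - z.2 * conjc w.2)^-1.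

Definition model_kernel (R : realType) (phi : R[i] * R[i] -> R[i])
    (w z : R[i] * R[i]) : R[i] :=
  (1 - conjc (phi w) * phi z) * szego w z.

(* Elements of L^2(sigma) are handled through representatives, with equality *)
(* sigma-almost everywhere. *)
Definition L2norm_sq (R : realType)
    (sigma : {measure set (torus R) -> \bar R}) (g : torus R -> R[i]) :
    \bar R :=
  (\int[sigma]_zeta (normc (g zeta) ^+ 2)%:E)%E.

Definition L2 (R : realType) (sigma : {measure set (torus R) -> \bar R}) :
    set (torus R -> R[i]) :=
  [set g | [/\ measurable_fun setT (fun zeta => complex.Re (g zeta)),
               measurable_fun setT (fun zeta => complex.Im (g zeta)) &
               (L2norm_sq sigma g < +oo)%E]].

Definition is_isometry (R : realType) (K : set (R[i] * R[i] -> R[i]))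
    (sigma : {measure set (torus R) -> \bar R})
    (J : (R[i] * R[i] -> R[i]) -> torus R -> R[i]) : Prop :=
  forall f, K f -> L2norm_sq sigma (J f) = hardy_normsq f.

Definition is_clark_embedding (R : realType) (phi : R[i] * R[i] -> R[i])
    (alpha : circle R) (sigma : {measure set (torus R) -> \bar R})
    (J : (R[i] * R[i] -> R[i]) -> torus R -> R[i]) : Prop :=
  [/\ forall f, model_space phi f -> L2 sigma (J f),
      forall (c : R[i]) f g, model_space phi f -> model_space phi g ->
        J (fun z => c * f z + g z) =
          (fun zeta => c * J f zeta + J g zeta) %[ae sigma],
      is_isometry (model_space phi) sigma J &
      forall w, bidisk w ->
        J (model_kernel phi w) =
          (fun zeta : torus R => (1 - (alpha : R[i]) * conjc (phi w)) *
             szego w (zeta.1 : R[i], zeta.2 : R[i])) %[ae sigma]].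

Definition unitary (R : realType) (K : set (R[i] * R[i] -> R[i]))
    (sigma : {measure set (torus R) -> \bar R})
    (J : (R[i] * R[i] -> R[i]) -> torus R -> R[i]) : Prop :=
  is_isometry K sigma J /\
  forall g, L2 sigma g -> exists2 f, K f & J f = g %[ae sigma].

(* Main.v *)
Require Import Defs.
From mathcomp Require Import all_boot all_order all_algebra.
From mathcomp Require Import complex ring lra zify.
From mathcomp Require Import separable cyclotomic cyclic polyXY.
From mathcomp Require Import all_classical all_reals all_analysis.
From mathcomp Require Import measurable_realfun.
Set Implicit Arguments.
Unset Strict Implicit.
Unset Printing Implicit Defensive.
Import Order.TTheory GRing.Theory Num.Theory.
Import numFieldNormedType.Exports.
Local Open Scope classical_set_scope.
Local Open Scope ring_scope.

(** Let L be the line {zeta_1 = tau} (or its mirror image) on which phi takes the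
    value alpha.  The function g = 1_L * conj(zeta_2) has positive norm in
    L^2(sigma), but it is orthogonal to the images of all reproducing kernels: if
    g = J f with f in the model space, then f(w) = <f, K_w> = <g, J K_w> = 0 for
    every w, hence f = 0, a contradiction.

    The orthogonality comes from the kernel identity
      int C_v conj(C_w) dsigma = (1 / A(w) + 1 / conj(A(v)) - 1) C_v(w),
    where A(w) = 1 - conj(alpha) phi(w).  Letting v, or both v and w, tend radially
    to L and using dominated convergence, V(y) = int_L dsigma / (1 - y conj(zeta_2))
    is the limit of (1 - u) / A(u tau, y) and satisfies
    V(y) = (V(y) + conj(V(0))) / 2, so that V is constant; this says that the
    moments of sigma on L vanish.  The constant is not 0 because A vanishes at
    (tau, 0).

    For K_w to lie in the model space, multiplication by phi must be isometric.
    The Taylor coefficients a of p~ / p have norm 1: |p~| = |p| on the torus gives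
    <p~ x, a> = 1 for polynomials x with x(0) p(0) = 1, and the truncations x of
    1 / p(r z) make p~ x bounded on the torus uniformly in r, since on each slice
    p(u z, v z) is a product of factors z - rho with |rho| >= 1. *)

(** The denominator [p] may vanish on the torus, so [phi] need not extend continuously to it. The
    function theory is therefore carried out on coefficient arrays and on tori of radius [r < 1],
    where sums over grids of roots of unity play the role of integrals: Parseval on a grid yields
    Cauchy estimates, uniqueness of expansions, and contractivity of multiplication by a function
    bounded by 1. The bound [|phi| <= 1] itself comes from the positivity of the Poisson integral of
    [sigma].

    Norm 1 of [a] suffices for an isometry because [|c|^2 - |a c|^2] is a nonnegative quadratic
    form: it vanishes on every monomial, and by Cauchy-Schwarz its zeros form a linear space, closed
    under limits.

    Since the embedding is given through norms, its inner products are recovered by polarization.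
    The kernel identity divides by [A], which has no zero [v] in the bidisk: otherwise [J K_v]
    vanishes almost everywhere, so [K_v = 0] and [phi] is constant, whereas [p] and [p~] have no
    common factor and [p] has positive degree. *)

Lemma eq_cvgn (T : topologicalType) (u v : nat -> T) (l : T) :
  (forall n, u n = v n) -> u @ \oo --> l -> v @ \oo --> l.
Proof. by move=> /funext ->. Qed.

Lemma cvgn_le (R : realType) (N : nat) (u : nat -> R) (l M : R) :
  (forall n, (N <= n)%N -> u n <= M) -> u @ \oo --> l -> l <= M.
Proof.
move=> uM ul; rewrite -(cvg_lim (@norm_hausdorff _ _) ul).
by apply: limr_le; [exact: cvgP ul|exists N].
Qed.

Lemma cvgn_ge (R : realType) (N : nat) (u : nat -> R) (l M : R) :
  (forall n, (N <= n)%N -> M <= u n) -> u @ \oo --> l -> M <= l.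
Proof.
move=> uM ul; rewrite -(cvg_lim (@norm_hausdorff _ _) ul).
by apply: limr_ge; [exact: cvgP ul|exists N].
Qed.

(** * The real modulus on [R[i]] and convergence of complex sequences *)

Section ComplexModulus.
Variable R : realType.
Implicit Types x y : R[i].

Lemma normcD x y : normc (x + y) <= normc x + normc y.
Proof. exact: le_normcD. Qed.

Lemma normc_opp x : normc (- x) = normc x.
Proof. exact: normcN. Qed.

Lemma normcBC x y : normc (x - y) = normc (y - x).
Proof. by rewrite -normc_opp opprB. Qed.

Lemma normc_ge0 x : 0 <= normc x.
Proof. by case: x => a b; exact: sqrtr_ge0. Qed.

Lemma normc_eq0 x : (normc x == 0) = (x == 0).
Proof. by apply/eqP/eqP => [/eq0_normc //|->]; exact: normc0. Qed.

Lemma normc_gt0 x : (0 < normc x) = (x != 0).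
Proof. by rewrite lt_def normc_ge0 andbT normc_eq0. Qed.

Lemma normcX x n : normc (x ^+ n) = normc x ^+ n.
Proof.
elim: n => [|n IH]; first exact: normc1.
by rewrite !exprS normcM IH.
Qed.

Lemma normc_conj x : normc (conjc x) = normc x.
Proof. by case: x => a b; rewrite /= sqrrN. Qed.

Lemma normc_real (r : R) : normc (r%:C)%C = `|r|.
Proof. by rewrite /= expr0n /= addr0 sqrtr_sqr. Qed.

Lemma normc_nat n : normc (n%:R : R[i]) = n%:R.
Proof. by rewrite -(rmorph_nat (real_complex R)) normc_real normr_nat. Qed.

Lemma normc_sum (I : Type) (r : seq I) (P : pred I) (F : I -> R[i]) :
  normc (\sum_(i <- r | P i) F i) <= \sum_(i <- r | P i) normc (F i).
Proof.
elim/big_rec2: _ => [|i a b _ ab]; first by rewrite normc0.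
by rewrite (le_trans (normcD _ _))// lerD2l.
Qed.

Lemma ler_normcB x y : normc x - normc y <= normc (x - y).
Proof. by rewrite lerBlDr -[in leLHS](subrK y x) normcD. Qed.

Lemma normc_sqrC x : ((normc x ^+ 2)%:C)%C = x * conjc x.
Proof.
case: x => a b /=; rewrite sqr_sqrtr ?addr_ge0 ?sqr_ge0//.
by apply/eqP; rewrite eq_complex /=; apply/andP; split; apply/eqP; ring.
Qed.

Lemma normc_sqr x : normc x ^+ 2 = complex.Re x ^+ 2 + complex.Im x ^+ 2.
Proof. by case: x => a b /=; rewrite sqr_sqrtr ?addr_ge0 ?sqr_ge0. Qed.

Lemma normc_geRe x : `|complex.Re x| <= normc x.
Proof.
by case: x => a b /=; rewrite -sqrtr_sqr ler_wsqrtr // lerDl sqr_ge0.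
Qed.

Lemma normc_geIm x : `|complex.Im x| <= normc x.
Proof.
by case: x => a b /=; rewrite -sqrtr_sqr ler_wsqrtr // lerDr sqr_ge0.
Qed.

Lemma normc_norm x : `|x| = ((normc x)%:C)%C.
Proof. by case: x => a b. Qed.

(** A positive element of [R[i]] has zero imaginary part, so the [R[i]]-valued norm of the library
    and the real modulus give the same convergence. *)
Lemma cvgcP (u : nat -> R[i]) (l : R[i]) :
  u @ \oo --> l <-> (fun n => normc (u n - l)) @ \oo --> (0 : R).
Proof.
split=> [/cvgrPdist_lt ul|/cvgrPdist_lt ul]; apply/cvgrPdist_lt => e e0.
  have e0' : 0 < (e%:C)%C :> R[i] by rewrite ltcR.
  have := ul _ e0'; apply: filterS => n.
  by rewrite normc_norm ltcR sub0r normrN ger0_norm ?normc_ge0 // normcBC.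
have [er e0'] : e = ((complex.Re e)%:C)%C /\ 0 < complex.Re e.
  by case: e e0 => a b /=; rewrite ltcE /= => /andP[/eqP -> ->].
have := ul _ e0'; apply: filterS => n.
rewrite sub0r normrN ger0_norm ?normc_ge0 // => h.
by rewrite normc_norm er ltcR normcBC.
Qed.

Lemma cvgc_dist (u : nat -> R[i]) (l : R[i]) (v : nat -> R) :
  (forall n, normc (u n - l) <= v n) -> v @ \oo --> (0 : R) -> u @ \oo --> l.
Proof.
move=> uv v0; apply/cvgcP; apply: (squeeze_cvgr _ _ v0); last exact: cvg_cst.
by apply: nearW => n; rewrite normc_ge0 uv.
Qed.

Lemma cvgc_conj (u : nat -> R[i]) (l : R[i]) :
  u @ \oo --> l -> (fun n => conjc (u n)) @ \oo --> conjc l.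
Proof.
move=> /cvgcP ul; apply/cvgcP.
by under eq_fun do rewrite -rmorphB normc_conj.
Qed.

Lemma cvgc_normc (u : nat -> R[i]) (l : R[i]) :
  u @ \oo --> l -> (fun n => normc (u n)) @ \oo --> normc l.
Proof.
move=> /cvgcP/cvgrPdist_lt ul; apply/cvgrPdist_lt => e e0.
have := ul _ e0; apply: filterS => n; rewrite sub0r normrN.
rewrite ger0_norm ?normc_ge0 //; apply: le_lt_trans.
by rewrite ler_norml lerNl opprB ler_normcB normcBC ler_normcB.
Qed.

Lemma cvgc_real (u : nat -> R) (l : R) :
  u @ \oo --> l -> (fun n => ((u n)%:C)%C) @ \oo --> (l%:C)%C.
Proof.
move=> /cvgrPdist_lt ul; apply/cvgcP/cvgrPdist_lt => e e0.
have := ul _ e0; apply: filterS => n.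
by rewrite -rmorphB normc_real sub0r normrN normr_id distrC.
Qed.

Lemma cvgc_Re (u : nat -> R[i]) (l : R[i]) :
  u @ \oo --> l -> (fun n => complex.Re (u n)) @ \oo --> complex.Re l.
Proof.
move=> /cvgcP/cvgrPdist_lt ul; apply/cvgrPdist_lt => e e0.
have := ul _ e0; apply: filterS => n; rewrite sub0r normrN.
rewrite ger0_norm ?normc_ge0 //; apply: le_lt_trans.
by rewrite -raddfB normcBC normc_geRe.
Qed.

Lemma cvgc_Im (u : nat -> R[i]) (l : R[i]) :
  u @ \oo --> l -> (fun n => complex.Im (u n)) @ \oo --> complex.Im l.
Proof.
move=> /cvgcP/cvgrPdist_lt ul; apply/cvgrPdist_lt => e e0.
have := ul _ e0; apply: filterS => n; rewrite sub0r normrN.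
rewrite ger0_norm ?normc_ge0 //; apply: le_lt_trans.
by rewrite -raddfB normcBC normc_geIm.
Qed.

Lemma cvgc_ReIm (u : nat -> R[i]) (l : R[i]) :
  (fun n => complex.Re (u n)) @ \oo --> complex.Re l ->
  (fun n => complex.Im (u n)) @ \oo --> complex.Im l -> u @ \oo --> l.
Proof.
move=> ur ui; have -> : u = (fun n => ((complex.Re (u n))%:C)%C +
   ((complex.Im (u n))%:C)%C * 'i%C).
  by apply/funext => n; rewrite mulrC; exact: complexE.
rewrite [l in _ --> l]complexE [_ * _]mulrC.
by apply: cvgD; [|apply: cvgMl]; exact: cvgc_real.
Qed.

Lemma cvgc_unique (u : nat -> R[i]) (l1 l2 : R[i]) :
  u @ \oo --> l1 -> u @ \oo --> l2 -> l1 = l2.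
Proof. by move=> /(@cvg_unique _ (@norm_hausdorff _ R[i])); apply. Qed.

Lemma cvgc_sum (I : Type) (r : seq I) (u : I -> nat -> R[i]) (l : I -> R[i]) :
  (forall i, u i @ \oo --> l i) ->
  (fun n => \sum_(i <- r) u i n) @ \oo --> \sum_(i <- r) l i.
Proof.
move=> ul; elim: r => [|i r IH].
  by rewrite big_nil; apply: eq_cvgn (cvg_cst 0) => n; rewrite big_nil.
rewrite big_cons; apply: eq_cvgn (cvgD (ul i) IH) => n.
by rewrite big_cons.
Qed.

End ComplexModulus.

Arguments normc : simpl never.

(** * Square partial sums of double arrays *)

Section DoubleSums.
Variable V : nmodType.
Implicit Types c d : nat -> nat -> V.

(** Summation over squares is the order in which the Hardy space expansions are stated. *)
Definition dsum N c : V := \sum_(j < N) \sum_(k < N) c j k.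

Lemma eq_dsum N c d :
  (forall j k, (j < N)%N -> (k < N)%N -> c j k = d j k) -> dsum N c = dsum N d.
Proof. by move=> cd; apply: eq_bigr => j _; apply: eq_bigr => k _; exact: cd. Qed.

Lemma dsumD N c d : dsum N (fun j k => c j k + d j k) = dsum N c + dsum N d.
Proof. by rewrite /dsum -big_split; apply: eq_bigr => j _; rewrite big_split. Qed.

Lemma dsum_nat N c :
  dsum N c = \sum_(0 <= j < N) \sum_(0 <= k < N) c j k.
Proof. by rewrite big_mkord; apply: eq_bigr => j _; rewrite big_mkord. Qed.

(** Padding by zeros lets sums over squares of different sides be compared term by term. *)
Definition dtrunc N c j k : V := if (j < N)%N && (k < N)%N then c j k else 0.

Lemma dsum_widen N M c :
  (N <= M)%N -> dsum N c = dsum M (dtrunc N c).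
Proof.
move=> NM; rewrite !dsum_nat [in RHS](big_cat_nat (leq0n _) NM) /=.
rewrite [X in _ = _ + X]big_nat_cond [X in _ = _ + X]big1 ?addr0; last first.
  move=> j; rewrite andbT => /andP[Nj _]; apply: big1 => k _.
  by rewrite /dtrunc ltnNge Nj.
rewrite big_nat_cond [RHS]big_nat_cond; apply: eq_bigr => j /andP[/andP[_ jN] _].
rewrite [in RHS](big_cat_nat (leq0n _) NM) /=.
rewrite [X in _ = _ + X]big_nat_cond [X in _ = _ + X]big1 ?addr0; last first.
  by move=> k; rewrite andbT => /andP[Nk _]; rewrite /dtrunc jN ltnNge Nk.
by apply: eq_big_nat => k /andP[_ kN]; rewrite /dtrunc jN kN.
Qed.

Lemma dsum_dtrunc N M c : (N <= M)%N -> dsum N (dtrunc M c) = dsum N c.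
Proof.
move=> NM; apply: eq_dsum => j k jN kN.
by rewrite /dtrunc !(leq_trans _ NM).
Qed.

Lemma dtrunc_id N M c : (N <= M)%N -> dtrunc M (dtrunc N c) = dtrunc N c.
Proof.
move=> NM; apply/funext => j; apply/funext => k; rewrite /dtrunc.
have [jN|] := ltnP j N; have [kN|] := ltnP k N; rewrite /= ?if_same //.
by rewrite !(leq_trans _ NM).
Qed.

End DoubleSums.

Section DoubleSumsRing.
Variable V : pzRingType.
Implicit Types c d : nat -> nat -> V.

Lemma dsumMl N (x : V) c : dsum N (fun j k => x * c j k) = x * dsum N c.
Proof. by rewrite /dsum mulr_sumr; apply: eq_bigr => j _; rewrite mulr_sumr. Qed.

Lemma dsumN N c : dsum N (fun j k => - c j k) = - dsum N c.
Proof. by rewrite /dsum -sumrN; apply: eq_bigr => j _; rewrite sumrN. Qed.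

Lemma dsumB N c d : dsum N (fun j k => c j k - d j k) = dsum N c - dsum N d.
Proof. by rewrite dsumD dsumN. Qed.

End DoubleSumsRing.

Section DoubleSumsNonneg.
Variable R : realType.
Implicit Types c d : nat -> nat -> R.

Lemma ler_dsum_in N c d :
  (forall j k, (j < N)%N -> (k < N)%N -> c j k <= d j k) -> dsum N c <= dsum N d.
Proof. by move=> cd; apply: ler_sum => j _; apply: ler_sum => k _; exact: cd. Qed.

Lemma ler_dsum N c d : (forall j k, c j k <= d j k) -> dsum N c <= dsum N d.
Proof. by move=> cd; apply: ler_dsum_in. Qed.

Lemma dsum_ge0 N c : (forall j k, 0 <= c j k) -> 0 <= dsum N c.
Proof. by move=> cd; apply: sumr_ge0 => j _; apply: sumr_ge0 => k _; exact: cd. Qed.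

Lemma dsum_le_widen N M c :
  (forall j k, 0 <= c j k) -> (N <= M)%N -> dsum N c <= dsum M c.
Proof.
move=> c0 NM; rewrite (dsum_widen _ NM); apply: ler_dsum => j k.
by rewrite /dtrunc; case: ifP.
Qed.

Lemma dsum_ge_term N c j k :
  (forall j k, 0 <= c j k) -> (j < N)%N -> (k < N)%N -> c j k <= dsum N c.
Proof.
move=> c0 jN kN; rewrite /dsum (bigD1 (Ordinal jN)) //= (bigD1 (Ordinal kN)) //=.
rewrite -addrA lerDl addr_ge0 //; first exact: sumr_ge0.
by apply: sumr_ge0 => i _; exact: sumr_ge0.
Qed.

Definition dsummable c := exists M, forall N, dsum N c <= M.

Definition dseries c := limn (fun N => dsum N c).

Lemma dsum_cvg c : (forall j k, 0 <= c j k) -> dsummable c ->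
  (fun N => dsum N c) @ \oo --> dseries c.
Proof.
move=> c0 [M cM]; apply: nondecreasing_is_cvgn.
  by move=> N K NK; exact: dsum_le_widen.
by exists M => _ [N _ <-].
Qed.

Lemma dsum_le_dseries N c : (forall j k, 0 <= c j k) -> dsummable c ->
  dsum N c <= dseries c.
Proof.
move=> c0 cs; apply: (@cvgn_ge _ N) (dsum_cvg c0 cs) => K NK.
exact: dsum_le_widen.
Qed.

Lemma dseries_le c M : (forall j k, 0 <= c j k) -> (forall N, dsum N c <= M) ->
  dseries c <= M.
Proof.
move=> c0 cM; have cs : dsummable c by exists M.
by apply: (@cvgn_le _ 0) (dsum_cvg c0 cs) => N _.
Qed.

Lemma dseries_ge0 c : (forall j k, 0 <= c j k) -> dsummable c -> 0 <= dseries c.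
Proof. by move=> c0 cs; apply: le_trans (dsum_le_dseries 0 c0 cs); exact: dsum_ge0. Qed.

Lemma dsum_esum N c : (forall j k, 0 <= c j k) ->
  ((dsum N c)%:E <= \esum_(x in [set: nat * nat]) (c x.1 x.2)%:E)%E.
Proof.
move=> c0; set s := [seq (j, k) | j <- iota 0 N, k <- iota 0 N].
have us : uniq s by rewrite allpairs_uniq ?iota_uniq // => -[? ?] [? ?].
apply: esum_ge; exists [set` s]; first by split=> //; exact: finite_seq.
rewrite -fsbig_seq // sumEFin lee_fin /s big_allpairs_dep dsum_nat.
by rewrite /index_iota !subn0.
Qed.

(** Every finite set of index pairs lies in a square, so the supremum over finite sets that defines
    [\esum] is controlled by square partial sums. *)
Lemma esum_dsum c M : (forall j k, 0 <= c j k) -> (forall N, dsum N c <= M) ->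
  (\esum_(x in [set: nat * nat]) (c x.1 x.2)%:E <= M%:E)%E.
Proof.
move=> c0 cM; apply: ge_ereal_sup => _ [X [fX _] <-].
rewrite fsbig_finite // sumEFin lee_fin.
set s := finmap.enum_fset _; have us : uniq s by exact: finmap.fset_uniq.
pose N := \max_(x <- s) (maxn x.1 x.2).+1.
apply: le_trans (cM N).
set b := [seq (j, k) | j <- iota 0 N, k <- iota 0 N].
have ub : uniq b by rewrite allpairs_uniq ?iota_uniq // => -[? ?] [? ?].
have sb : {subset s <= b}.
  move=> x xs; have xN : ((maxn x.1 x.2).+1 <= N)%N by exact: leq_bigmax_seq.
  move: xN; rewrite gtn_max => /andP[x1 x2].
  by apply/allpairsP; exists x; split; [rewrite mem_iota|rewrite mem_iota|case: x {xs x1 x2}].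
rewrite (perm_big [seq x <- b | x \in s]) /=; last first.
  apply: uniq_perm => // [|x]; first exact: filter_uniq.
  by rewrite mem_filter; case: (boolP (x \in s)) => // /sb ->.
rewrite big_filter big_mkcond /= dsum_nat /index_iota !subn0.
rewrite /b big_allpairs_dep; apply: ler_sum => j _; apply: ler_sum => k _.
by case: ifP.
Qed.

Lemma esum_dseries c : (forall j k, 0 <= c j k) -> dsummable c ->
  (\esum_(x in [set: nat * nat]) (c x.1 x.2)%:E = (dseries c)%:E)%E.
Proof.
move=> c0 cs; apply/eqP; rewrite eq_le; apply/andP; split.
  by apply: esum_dsum => // N; exact: dsum_le_dseries.
have fin : (\esum_(x in [set: nat * nat]) (c x.1 x.2)%:E \is a fin_num)%E.
  have [M cM] := cs; rewrite ge0_fin_numE; last by apply: esum_ge0 => x _; rewrite lee_fin.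
  by apply: le_lt_trans (esum_dsum c0 cM) _; rewrite ltry.
rewrite -(fineK fin) lee_fin; apply: dseries_le => // N.
by rewrite -lee_fin fineK //; exact: dsum_esum.
Qed.

Lemma esum_lty_dsummable c : (forall j k, 0 <= c j k) ->
  (\esum_(x in [set: nat * nat]) (c x.1 x.2)%:E < +oo)%E -> dsummable c.
Proof.
move=> c0 cs; exists (fine (\esum_(x in [set: nat * nat]) (c x.1 x.2)%:E)%E) => N.
rewrite -lee_fin fineK; first exact: dsum_esum.
by rewrite ge0_fin_numE //; apply: esum_ge0 => x _; rewrite lee_fin.
Qed.

End DoubleSumsNonneg.

(** * Roots of unity and the discrete Parseval identity *)

Section RootsOfUnity.
Variable R : realType.

(** In characteristic 0 the polynomial ['X^N - 1] is separable, so it has [N] distinct roots, and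
    the group they form is cyclic. *)
Lemma primitive_root_ex N : (0 < N)%N -> exists w : R[i], N.-primitive_root w.
Proof.
move=> N0; have [r defr] := closed_field_poly_normal ('X^N - 1 : {poly R[i]}).
rewrite (monicP _) ?scale1r ?monicXnsubC // in defr.
have Nn0 : N%:R != 0 :> R[i] by rewrite pnatr_eq0 -lt0n.
have ur : uniq r by rewrite -separable_prod_XsubC -defr separable_Xn_sub_1.
have sr : size r = N.
  by have := size_XnsubC (1 : R[i]) N0; rewrite defr size_prod_XsubC => -[].
have := @has_prim_root _ _ r N0 _ ur _.
rewrite sr leqnn => /(_ _ isT)/hasP []; last by move=> w _ pw; exists w.
apply/allP => z zr; rewrite unity_rootE -subr_eq0.
have : root ('X^N - 1) z by rewrite defr root_prod_XsubC.
by rewrite rootE hornerD hornerN hornerXn hornerC.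
Qed.

Variables (N : nat) (w : R[i]).
Hypotheses (N_gt0 : (0 < N)%N) (prim_w : N.-primitive_root w).

Lemma prim_root_normc : normc w = 1.
Proof.
apply/eqP; rewrite -(pexpr_eq1 N_gt0) ?normc_ge0 // -normcX (prim_expr_order prim_w).
by rewrite normc1.
Qed.

Lemma prim_root_mul_conj : w * conjc w = 1.
Proof. by rewrite -normc_sqrC prim_root_normc expr1n. Qed.

(** Orthogonality of characters: [z != 1] with [z ^+ N = 1] has a vanishing geometric sum, and
    exponents below [N] are determined by the corresponding power of [w]. *)
Lemma sum_prim_root j l : (j < N)%N -> (l < N)%N ->
  \sum_(s < N) (w ^+ s) ^+ j * conjc ((w ^+ s) ^+ l) = (N * (j == l))%:R :> R[i].
Proof.
move=> jN lN; set z := w ^+ j * conjc (w ^+ l).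
have zN : z ^+ N = 1.
  rewrite /z exprMn -rmorphXn -!exprM mulnC exprM [(l * N)%N]mulnC exprM.
  by rewrite (prim_expr_order prim_w) !expr1n rmorph1 mulr1.
have -> : \sum_(s < N) (w ^+ s) ^+ j * conjc ((w ^+ s) ^+ l) = \sum_(s < N) z ^+ s.
  apply: eq_bigr => s _; rewrite /z exprMn -rmorphXn -!exprM.
  by rewrite mulnC [(s * l)%N]mulnC.
have [jl|jl] := eqVneq j l; rewrite ?muln1 ?muln0.
  have z1 : z = 1 by rewrite /z jl -normc_sqrC normcX prim_root_normc !expr1n.
  under eq_bigr do rewrite z1 expr1n.
  by rewrite sumr_const card_ord.
have : (z - 1) * \sum_(s < N) z ^+ s = 0 by rewrite -subrX1 zN subrr.
move/eqP; rewrite mulf_eq0 subr_eq0 => /orP[/eqP z1|/eqP //].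
have : w ^+ j = w ^+ l.
  rewrite -[LHS]mulr1 -(expr1n R[i] l) -prim_root_mul_conj exprMn mulrCA.
  by rewrite -rmorphXn /= -/z z1 mulr1.
move/eqP; rewrite (eq_prim_root_expr prim_w) !modn_small // => /eqP jl'.
by rewrite jl' eqxx in jl.
Qed.

(** Discrete Parseval, exact for polynomials of degree below [N]; it stands in for integration over
    the circle. *)
Lemma parseval1 (x : nat -> R[i]) :
  \sum_(s < N) normc (\sum_(j < N) x j * (w ^+ s) ^+ j) ^+ 2 =
  N%:R * \sum_(j < N) normc (x j) ^+ 2.
Proof.
apply: (@complexI R); rewrite rmorphM rmorph_nat !rmorph_sum /=.
transitivity (\sum_(s < N) \sum_(j < N) \sum_(l < N)
   x j * conjc (x l) * ((w ^+ s) ^+ j * conjc ((w ^+ s) ^+ l))).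
  apply: eq_bigr => s _; rewrite normc_sqrC rmorph_sum /= mulr_suml.
  apply: eq_bigr => j _; rewrite mulr_sumr; apply: eq_bigr => l _.
  by rewrite rmorphM /=; ring.
rewrite exchange_big /= mulr_sumr; apply: eq_bigr => j _.
rewrite exchange_big /= normc_sqrC (bigD1 j) //= -mulr_sumr sum_prim_root //.
rewrite eqxx muln1 big1 ?addr0 1?mulrC // => l lj.
by rewrite -mulr_sumr sum_prim_root // eq_sym (negPf lj : (l == j :> nat) = false) muln0 mulr0.
Qed.

Lemma parseval2 (c : nat -> nat -> R[i]) :
  \sum_(t < N) \sum_(s < N)
    normc (dsum N (fun j k => c j k * (w ^+ s) ^+ j * (w ^+ t) ^+ k)) ^+ 2 =
  N%:R * (N%:R * dsum N (fun j k => normc (c j k) ^+ 2)).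
Proof.
transitivity (\sum_(t < N) (N%:R * \sum_(j < N)
    normc (\sum_(k < N) c j k * (w ^+ t) ^+ k) ^+ 2)).
  apply: eq_bigr => t _.
  rewrite -(parseval1 (fun j => \sum_(k < N) c j k * (w ^+ t) ^+ k)).
  apply: eq_bigr => s _; congr (normc _ ^+ 2); apply: eq_bigr => j _.
  by rewrite mulr_suml; apply: eq_bigr => k _; rewrite mulrAC.
rewrite -mulr_sumr exchange_big /=; congr (_ * _); rewrite mulr_sumr.
by apply: eq_bigr => j _; rewrite (parseval1 (c j)).
Qed.

End RootsOfUnity.

(** * Bivariate polynomials as double arrays *)

Section BivariatePolynomials.
Variable V : comNzRingType.
Implicit Types (P Q : {poly {poly V}}) (c d : nat -> nat -> V).

Definition coef2 P j k : V := P`_j`_k.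

Definition poly2 N c : {poly {poly V}} := \poly_(j < N) \poly_(k < N) c j k.

(** The Cauchy product, that is, the array of a product of power series. *)
Definition conv c d j k : V :=
  \sum_(s < j.+1) \sum_(t < k.+1) c s t * d (j - s)%N (k - t)%N.

Lemma coef_poly2 N c : coef2 (poly2 N c) = dtrunc N c.
Proof.
apply/funext => j; apply/funext => k; rewrite /coef2 /poly2 /dtrunc coef_poly.
by case: ltnP => //= _; rewrite ?coef_poly ?coef0.
Qed.

Lemma horner_poly2 N c (u v : V) :
  (poly2 N c).[u, v] = dsum N (fun j k => c j k * u ^+ j * v ^+ k).
Proof.
rewrite /poly2 horner_poly horner_sum; apply: eq_bigr => j _.
rewrite hornerM horner_poly -rmorphXn hornerC mulr_suml.
by apply: eq_bigr => k _; rewrite mulrAC.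
Qed.

Lemma poly2_coef2 N P : (size P <= N)%N -> (sizeY P <= N)%N ->
  poly2 N (coef2 P) = P.
Proof.
move=> sP sYP; apply/polyP => j; rewrite coef_poly; case: ltnP => [jN|Nj].
  apply/polyP => k; rewrite coef_poly; case: ltnP => // Nk.
  by rewrite nth_default // (leq_trans (max_size_coefXY _ _)) // (leq_trans sYP).
by rewrite nth_default // (leq_trans sP).
Qed.

Lemma coef2M P Q : coef2 (P * Q) = conv (coef2 P) (coef2 Q).
Proof.
apply/funext => j; apply/funext => k; rewrite /coef2 coefM coef_sum.
by apply: eq_bigr => s _; rewrite coefM.
Qed.

Lemma horner2M P Q (u v : V) : (P * Q).[u, v] = P.[u, v] * Q.[u, v].
Proof. by rewrite !hornerM. Qed.

Lemma horner2_coef2 N P (u v : V) : (size P <= N)%N -> (sizeY P <= N)%N ->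
  P.[u, v] = dsum N (fun j k => coef2 P j k * u ^+ j * v ^+ k).
Proof. by move=> sP sYP; rewrite -[in LHS](poly2_coef2 sP sYP) horner_poly2. Qed.

Lemma sizeYM P Q : (sizeY (P * Q) <= (sizeY P + sizeY Q).-1)%N.
Proof. by rewrite !sizeYE rmorphM; exact: size_polyMleq. Qed.

Lemma sizeY_poly2 N c : (sizeY (poly2 N c) <= N)%N.
Proof.
apply/bigmax_leqP => j _; rewrite /poly2 coef_poly.
by case: ifP => _; rewrite ?size_poly // size_poly0.
Qed.

Lemma eq_conv c c' d d' j k :
  (forall s t, (s <= j)%N -> (t <= k)%N -> c s t = c' s t) ->
  (forall s t, (s <= j)%N -> (t <= k)%N -> d s t = d' s t) ->
  conv c d j k = conv c' d' j k.
Proof.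
move=> cc' dd'; apply: eq_bigr => s _; apply: eq_bigr => t _.
have sj := ltn_ord s; have tk := ltn_ord t.
by rewrite cc' ?dd' ?leq_subr.
Qed.

Lemma conv_dtrunc N c d j k : (j < N)%N -> (k < N)%N ->
  conv (dtrunc N c) (dtrunc N d) j k = conv c d j k.
Proof.
move=> jN kN; apply: eq_bigr => s _; apply: eq_bigr => t _.
have sj := ltn_ord s; have tk := ltn_ord t.
by rewrite /dtrunc !ifT //; apply/andP; split; lia.
Qed.

(** A square sum is the value at (1, 1) of the truncated polynomial, so the product of two sums is
    the value of a product of polynomials. *)
Lemma dsum_mul N c d :
  dsum N c * dsum N d = dsum (N + N) (conv (dtrunc N c) (dtrunc N d)).
Proof.
have h e : dsum N e = (poly2 N e).[1, 1].
  by rewrite horner_poly2; apply: eq_dsum => j k _ _; rewrite !expr1n !mulr1.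
rewrite !h -horner2M (@horner2_coef2 (N + N)) ?coef2M ?coef_poly2.
- by apply: eq_dsum => j k _ _; rewrite !expr1n !mulr1.
- rewrite (leq_trans (size_polyMleq _ _)) // (leq_trans (leq_pred _)) //.
  by rewrite leq_add ?size_poly.
- rewrite (leq_trans (sizeYM _ _)) // (leq_trans (leq_pred _)) //.
  by rewrite leq_add ?sizeY_poly2.
Qed.

Lemma convC c d : conv c d = conv d c.
Proof.
apply/funext => j; apply/funext => k.
rewrite /conv (reindex_inj rev_ord_inj); apply: eq_bigr => s _ /=.
rewrite (reindex_inj rev_ord_inj); apply: eq_bigr => t _ /=.
by rewrite !subSS !subKn ?leq_ord // mulrC.
Qed.

(** Only entries with indices up to [j] and [k] matter, so the arrays can be truncated to
    polynomials, whose multiplication is associative. *)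
Lemma convA c d e : conv c (conv d e) = conv (conv c d) e.
Proof.
apply/funext => j; apply/funext => k; pose N := (j + k).+1.
have jN : (j < N)%N by rewrite /N; lia.
have kN : (k < N)%N by rewrite /N; lia.
have trE (f : nat -> nat -> V) s t : (s <= j)%N -> (t <= k)%N ->
    coef2 (poly2 N f) s t = f s t.
  by move=> sj tk; rewrite coef_poly2 /dtrunc ifT //; apply/andP; split; lia.
have trM (f g : nat -> nat -> V) s t : (s <= j)%N -> (t <= k)%N ->
    coef2 (poly2 N f * poly2 N g) s t = conv f g s t.
  by move=> sj tk; rewrite coef2M !coef_poly2 conv_dtrunc //; lia.
transitivity (coef2 (poly2 N c * poly2 N d * poly2 N e) j k).
  rewrite -mulrA coef2M; apply: eq_bigr => s _; apply: eq_bigr => t _.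
  by rewrite trE ?trM ?leq_subr // -ltnS.
rewrite coef2M; apply: eq_bigr => s _; apply: eq_bigr => t _.
by rewrite trE ?trM ?leq_subr // -ltnS.
Qed.

End BivariatePolynomials.

(** * Comparison of coefficient norms from moduli on the torus *)

Section TorusDomination.
Variable R : realType.
Implicit Types P Q : {poly {poly R[i]}}.

(* Parseval's identity on a grid of roots of unity finer than both degrees. *)
Lemma dsum_le_of_torus_le N M P Q :
  (size Q <= M)%N -> (sizeY Q <= M)%N ->
  (forall u v : R[i], normc u = 1 -> normc v = 1 ->
     normc P.[u, v] <= normc Q.[u, v]) ->
  dsum N (fun j k => normc (coef2 P j k) ^+ 2) <=
  dsum M (fun j k => normc (coef2 Q j k) ^+ 2).
Proof.
move=> sQ sYQ PQ; pose K := (N + M + size P + sizeY P).+1.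
have [w pw] := primitive_root_ex R (ltn0Sn _ : (0 < K)%N).
have sq0 (S : {poly {poly R[i]}}) j k : 0 <= normc (coef2 S j k) ^+ 2.
  by rewrite exprn_ge0 ?normc_ge0.
apply: (@le_trans _ _ (dsum K (fun j k => normc (coef2 P j k) ^+ 2))).
  by apply: dsum_le_widen => //; rewrite /K; lia.
have -> : dsum M (fun j k => normc (coef2 Q j k) ^+ 2) =
          dsum K (fun j k => normc (coef2 Q j k) ^+ 2).
  rewrite (@dsum_widen _ M K); last by rewrite /K; lia.
  apply: eq_dsum => j k _ _; rewrite -[in RHS](poly2_coef2 sQ sYQ) coef_poly2.
  by rewrite /dtrunc; case: ifP => // _; rewrite normc0 expr0n.
have K0 : 0 < K%:R :> R by rewrite ltr0n.
rewrite -(ler_pM2l K0) -(ler_pM2l K0) -!(parseval2 (ltn0Sn _) pw).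
apply: ler_sum => t _; apply: ler_sum => s _.
have nw i : normc (w ^+ i) = 1 by rewrite normcX (prim_root_normc _ pw) // expr1n.
have leK i : (i <= N + M + size P + sizeY P)%N -> (i <= K)%N by exact: leqW.
rewrite -!horner2_coef2; last first.
- by apply: leK; rewrite leq_addl.
- by apply: leK; rewrite -addnA addnCA leq_addr.
- by apply: leK; rewrite (leq_trans sYQ) // -!addnA addnCA leq_addr.
- by apply: leK; rewrite (leq_trans sQ) // -!addnA addnCA leq_addr.
by rewrite lerXn2r ?nnegrE ?normc_ge0 // PQ.
Qed.

End TorusDomination.

(** * Cauchy products of summable arrays *)

Section ConvolutionSums.
Variable R : realType.
Implicit Types (c d : nat -> nat -> R[i]) (x y : nat -> nat -> R).

Lemma ler_conv x x' y y' j k : (forall j k, 0 <= x j k <= x' j k) ->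
  (forall j k, 0 <= y j k <= y' j k) -> conv x y j k <= conv x' y' j k.
Proof.
move=> xx' yy'; apply: ler_sum => s _; apply: ler_sum => t _.
have /andP[? ?] := xx' s t; have /andP[? ?] := yy' (j - s)%N (k - t)%N.
exact: ler_pM.
Qed.

Lemma conv_ge0 x y j k : (forall j k, 0 <= x j k) -> (forall j k, 0 <= y j k) ->
  0 <= conv x y j k.
Proof.
by move=> x0 y0; apply: sumr_ge0 => s _; apply: sumr_ge0 => t _; exact: mulr_ge0.
Qed.

Lemma normc_dsum N c : normc (dsum N c) <= dsum N (fun j k => normc (c j k)).
Proof.
rewrite (le_trans (normc_sum _ _ _)) //; apply: ler_sum => j _.
exact: normc_sum.
Qed.

Lemma normc_conv c d j k : normc (conv c d j k) <=
  conv (fun j k => normc (c j k)) (fun j k => normc (d j k)) j k.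
Proof.
rewrite (le_trans (normc_sum _ _ _)) //; apply: ler_sum => s _.
rewrite (le_trans (normc_sum _ _ _)) //; apply: ler_sum => t _.
by rewrite normcM.
Qed.

Lemma ler_dsum_sub N M x y : (forall j k, x j k <= y j k) -> (N <= M)%N ->
  dsum M x - dsum N x <= dsum M y - dsum N y.
Proof.
move=> xy NM; rewrite !(dsum_widen _ NM) -!dsumB; apply: ler_dsum => j k.
by rewrite /dtrunc; case: ifP => _; rewrite ?subrr // !subr0.
Qed.

Lemma normc_dsum_sub N M c : (N <= M)%N -> normc (dsum M c - dsum N c) <=
  dsum M (fun j k => normc (c j k)) - dsum N (fun j k => normc (c j k)).
Proof.
move=> NM; rewrite !(dsum_widen _ NM) -!dsumB (le_trans (normc_dsum _ _)) //.
apply: ler_dsum => j k; rewrite /dtrunc; case: ifP => _.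
  by rewrite !subrr normc0.
by rewrite !subr0.
Qed.

(** Products of entries whose indices add up to a place in the square of side [N] all occur in the
    product of the two sums, and every product occurring there lands in the square of side
    [N + N]. *)
Lemma dsum_conv_le N x y : (forall j k, 0 <= x j k) -> (forall j k, 0 <= y j k) ->
  dsum N (conv x y) <= dsum N x * dsum N y <= dsum (N + N) (conv x y).
Proof.
move=> x0 y0; rewrite dsum_mul.
have tr0 (z : nat -> nat -> R) : (forall j k, 0 <= z j k) ->
    forall j k, 0 <= dtrunc N z j k <= z j k.
  by move=> z0 j k; rewrite /dtrunc; case: ifP => _; rewrite ?z0 ?lexx.
apply/andP; split; last by apply: ler_dsum => j k; apply: ler_conv; exact: tr0.
apply: (@le_trans _ _ (dsum N (conv (dtrunc N x) (dtrunc N y)))).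
  by rewrite le_eqVlt; apply/orP; left; apply/eqP/eq_dsum => j k jN kN; rewrite conv_dtrunc.
apply: dsum_le_widen (leq_addl _ _) => j k.
by apply: conv_ge0 => s t; [have /andP[] := tr0 _ x0 s t|have /andP[] := tr0 _ y0 s t].
Qed.

Lemma dsummable_conv x y : (forall j k, 0 <= x j k) -> (forall j k, 0 <= y j k) ->
  dsummable x -> dsummable y -> dsummable (conv x y).
Proof.
move=> x0 y0 xs ys; exists (dseries x * dseries y) => N.
have /andP[+ _] := dsum_conv_le N x0 y0; move/le_trans; apply.
by rewrite ler_pM ?dsum_ge0 ?dsum_le_dseries.
Qed.

Lemma normc_dsum_mul_sub N c d :
  normc (dsum N c * dsum N d - dsum N (conv c d)) <=
  dsum N (fun j k => normc (c j k)) * dsum N (fun j k => normc (d j k)) -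
  dsum N (conv (fun j k => normc (c j k)) (fun j k => normc (d j k))).
Proof.
rewrite !dsum_mul.
rewrite (eq_dsum (fun j k jN kN => esym (conv_dtrunc c d jN kN))).
rewrite (eq_dsum (fun j k jN kN => esym (conv_dtrunc (fun j k => normc (c j k))
  (fun j k => normc (d j k)) jN kN))).
have NN := leq_addl N N.
rewrite !(dsum_widen _ NN) -!dsumB (le_trans (normc_dsum _ _)) //.
apply: ler_dsum => j k; rewrite /dtrunc; case: ifP => _.
  by rewrite !subrr normc0.
rewrite !subr0 (le_trans (normc_conv _ _ _ _)) // /conv.
apply: ler_sum => s _; apply: ler_sum => t _.
by apply: ler_pM; rewrite ?normc_ge0 //; case: ifP => _; rewrite ?normc0.
Qed.

(** The discrepancy is dominated by the one for the moduli, and the latter lies between 0 and the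
    difference of two sequences with the same limit. *)
Lemma mertens c d : dsummable (fun j k => normc (c j k)) ->
  dsummable (fun j k => normc (d j k)) ->
  (fun N => dsum N c * dsum N d - dsum N (conv c d)) @ \oo --> (0 : R[i]).
Proof.
move=> cs ds; set x := fun j k => normc (c j k); set y := fun j k => normc (d j k).
have x0 j k : 0 <= x j k by exact: normc_ge0.
have y0 j k : 0 <= y j k by exact: normc_ge0.
have cv := dsum_cvg (fun j k => conv_ge0 j k x0 y0) (dsummable_conv x0 y0 cs ds).
have cv2 : (fun N => dsum (N + N) (conv x y)) @ \oo --> dseries (conv x y).
  apply: (squeeze_cvgr _ cv (cvg_cst (dseries (conv x y)))).
  have xy0 j k := conv_ge0 j k x0 y0.
  apply: nearW => N; rewrite dsum_le_widen ?leq_addr //= dsum_le_dseries //.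
  exact: dsummable_conv.
apply: (@cvgc_dist _ _ _ (fun N => dsum (N + N) (conv x y) - dsum N (conv x y))).
  move=> N; rewrite subr0 (le_trans (normc_dsum_mul_sub _ _ _)) // lerD2r.
  by have /andP[] := dsum_conv_le N x0 y0.
by rewrite -(subrr (dseries (conv x y))); exact: cvgB.
Qed.

End ConvolutionSums.

(** * Power series on the bidisk: truncation errors, Cauchy estimates, uniqueness *)

Section AbsolutelyConvergent.
Variable R : realType.
Implicit Types (a b c d : nat -> nat -> R[i]).

Definition monom c (u v : R[i]) j k : R[i] := c j k * u ^+ j * v ^+ k.

Definition rmonom c (r : R) j k : R := normc (c j k) * r ^+ j * r ^+ k.

(* The coefficient arrays of holomorphic functions on the bidisk. *)
Definition ac c := forall r : R, 0 <= r -> r < 1 -> dsummable (rmonom c r).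

Definition expands c (f : R[i] * R[i] -> R[i]) := forall z, bidisk z ->
  (fun N => dsum N (monom c z.1 z.2)) @ \oo --> f z.

Lemma rmonom_ge0 c r j k : 0 <= r -> 0 <= rmonom c r j k.
Proof. by move=> r0; rewrite !mulr_ge0 ?exprn_ge0 ?normc_ge0. Qed.

Lemma normc_monom_le c u v r j k : normc u <= r -> normc v <= r ->
  normc (monom c u v j k) <= rmonom c r j k.
Proof.
move=> ur vr; have r0 := le_trans (normc_ge0 u) ur.
rewrite /monom /rmonom !normcM !normcX.
by rewrite !ler_pM ?mulr_ge0 ?exprn_ge0 ?normc_ge0 // lerXn2r ?nnegrE ?normc_ge0.
Qed.

Lemma dsummable_le (x y : nat -> nat -> R) :
  (forall j k, x j k <= y j k) -> dsummable y -> dsummable x.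
Proof. by move=> xy [M yM]; exists M => N; rewrite (le_trans _ (yM N)) // ler_dsum. Qed.

Lemma bidisk_pair (u v : R[i]) : normc u < 1 -> normc v < 1 -> bidisk (u, v).
Proof. by split. Qed.

Lemma bidisk_max (z : R[i] * R[i]) : bidisk z ->
  exists r : R, [/\ 0 <= r, r < 1, normc z.1 <= r & normc z.2 <= r].
Proof.
move=> [z1 z2]; exists (Num.max (normc z.1) (normc z.2)); split.
- by rewrite le_max normc_ge0.
- by rewrite gt_max z1.
- by rewrite le_max lexx.
- by rewrite le_max lexx orbT.
Qed.

Lemma ac_summable c z : ac c -> bidisk z ->
  dsummable (fun j k => normc (monom c z.1 z.2 j k)).
Proof.
move=> cac /bidisk_max[r [r0 r1 z1 z2]].
by apply: dsummable_le (cac r r0 r1) => j k; exact: normc_monom_le.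
Qed.

Lemma conv_monom c d u v : conv (monom c u v) (monom d u v) = monom (conv c d) u v.
Proof.
apply/funext => j; apply/funext => k; rewrite /monom -mulrA mulr_suml.
apply: eq_bigr => s _; rewrite mulr_suml; apply: eq_bigr => t _.
have sj : (s <= j)%N by rewrite -ltnS.
have tk : (t <= k)%N by rewrite -ltnS.
have -> : u ^+ j = u ^+ s * u ^+ (j - s) by rewrite -exprD subnKC.
have -> : v ^+ k = v ^+ t * v ^+ (k - t) by rewrite -exprD subnKC.
by ring.
Qed.

Lemma expands_conv c d f g : ac c -> ac d -> expands c f -> expands d g ->
  expands (conv c d) (fun z => f z * g z).
Proof.
move=> ca da cf dg z zD; rewrite -conv_monom.
have h1 := mertens (ac_summable ca zD) (ac_summable da zD).
have h2 : (fun N => dsum N (monom c z.1 z.2) * dsum N (monom d z.1 z.2)) @ \oo -->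
    f z * g z by exact: cvgM (cf z zD) (dg z zD).
have -> : f z * g z = f z * g z - 0 by rewrite subr0.
apply: eq_cvgn (cvgB h2 h1) => N.
by rewrite -[LHS]/(_ - (_ - _)) subKr.
Qed.

Lemma ac_conv c d : ac c -> ac d -> ac (conv c d).
Proof.
move=> ca da r r0 r1.
apply: dsummable_le (dsummable_conv _ _ (ca r r0 r1) (da r r0 r1)).
- move=> j k; rewrite /rmonom -mulrA -(ger0_norm (exprn_ge0 j r0)).
  rewrite -(ger0_norm (exprn_ge0 k r0)) -!normc_real -!normcM.
  have -> : conv c d j k * ((r ^+ j)%:C%C * (r ^+ k)%:C%C) =
      conv (monom c r%:C%C r%:C%C) (monom d r%:C%C r%:C%C) j k.
    by rewrite conv_monom /monom !rmorphXn mulrA.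
  rewrite (le_trans (normc_conv _ _ _ _)) // ler_conv // => s t.
    by rewrite normc_ge0 normc_monom_le // normc_real ger0_norm.
  by rewrite normc_ge0 normc_monom_le // normc_real ger0_norm.
- by move=> j k; exact: rmonom_ge0.
- by move=> j k; exact: rmonom_ge0.
Qed.

Lemma sum_geom_le (r : R) N : 0 <= r -> r < 1 ->
  \sum_(j < N) r ^+ j <= (1 - r)^-1.
Proof.
move=> r0 r1; have r1' : 0 < 1 - r by rewrite subr_gt0.
rewrite -(ler_pM2l r1') mulfV ?gt_eqF // -opprB mulNr -subrX1 opprB.
by rewrite lerBlDr lerDl exprn_ge0.
Qed.

Lemma dsum_geom_le (r : R) N : 0 <= r -> r < 1 ->
  dsum N (fun j k => r ^+ j * r ^+ k) <= (1 - r)^-1 ^+ 2.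
Proof.
move=> r0 r1; rewrite /dsum; under eq_bigr do rewrite -mulr_sumr.
rewrite -mulr_suml expr2 ler_pM ?sum_geom_le //; apply: sumr_ge0 => j _;
  exact: exprn_ge0.
Qed.

Lemma bounded_ac c M : (forall j k, normc (c j k) <= M) -> ac c.
Proof.
move=> cM r r0 r1; exists (M * (1 - r)^-1 ^+ 2) => N.
have M0 : 0 <= M by apply: le_trans (cM 0 0)%N; exact: normc_ge0.
apply: (@le_trans _ _ (dsum N (fun j k => M * (r ^+ j * r ^+ k)))).
  by apply: ler_dsum => j k; rewrite /rmonom mulrA !ler_wpM2r ?exprn_ge0.
by rewrite dsumMl ler_wpM2l ?dsum_geom_le.
Qed.

Lemma dsum_sub_le c u v r N M : ac c -> 0 <= r -> r < 1 ->
  normc u <= r -> normc v <= r -> (N <= M)%N ->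
  normc (dsum N (monom c u v) - dsum M (monom c u v)) <=
  dseries (rmonom c r) - dsum N (rmonom c r).
Proof.
move=> ca r0 r1 ur vr NM.
apply: (@le_trans _ _ (dsum M (rmonom c r) - dsum N (rmonom c r))); last first.
  by rewrite lerD2r dsum_le_dseries // => [j k|]; [exact: rmonom_ge0|exact: ca].
rewrite !(dsum_widen _ NM) -!dsumB (le_trans (normc_dsum _ _)) //.
apply: ler_dsum => j k; rewrite /dtrunc; case: ifP => _.
  by rewrite !subrr normc0.
by rewrite sub0r subr0 normc_opp normc_monom_le.
Qed.

(** The Weierstrass test: the error bound is the same at all points of the closed polydisk of radius
    [r], so truncations are uniformly close to the function on the torus of radius [r]. *)
Lemma ac_tail c u v r N (l : R[i]) : ac c -> 0 <= r -> r < 1 ->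
  normc u <= r -> normc v <= r ->
  (fun M => dsum M (monom c u v)) @ \oo --> l ->
  normc (dsum N (monom c u v) - l) <= dseries (rmonom c r) - dsum N (rmonom c r).
Proof.
move=> ca r0 r1 ur vr cl.
apply: (@cvgn_le _ N); last first.
  exact: cvgc_normc (cvgB (cvg_cst (dsum N (monom c u v))) cl).
by move=> M NM; exact: dsum_sub_le.
Qed.

Lemma dsum_tail_cvg c r : ac c -> 0 <= r -> r < 1 ->
  (fun N => dseries (rmonom c r) - dsum N (rmonom c r)) @ \oo --> (0 : R).
Proof.
move=> ca r0 r1; rewrite -(subrr (dseries (rmonom c r))).
apply: cvgB; first exact: cvg_cst.
by apply: dsum_cvg (ca r r0 r1) => j k; exact: rmonom_ge0.
Qed.

Lemma coef2_polyC2 (x : R[i]) j k :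
  coef2 (x%:P%:P) j k = if (j == 0)%N && (k == 0)%N then x else 0.
Proof.
rewrite /coef2 coefC; case: (j == 0)%N => /=; last by rewrite coef0.
by rewrite coefC.
Qed.

Lemma sizeY_polyC2 (x : R[i]) : (sizeY (x%:P%:P : {poly {poly R[i]}}) <= 1)%N.
Proof.
apply/bigmax_leqP => i _; rewrite coefC; case: ifP => _.
  exact: size_polyC_leq1.
by rewrite size_poly0.
Qed.

Lemma dsum_sq_coef2_le N (P : {poly {poly R[i]}}) (e : R) :
  (forall u v : R[i], normc u = 1 -> normc v = 1 -> normc P.[u, v] <= e) ->
  dsum N (fun j k => normc (coef2 P j k) ^+ 2) <= e ^+ 2.
Proof.
move=> Pe; have e0 : 0 <= e.
  by apply: le_trans (Pe 1 1 _ _); rewrite ?normc_ge0 ?normc1.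
have := @dsum_le_of_torus_le R N 1 P (e%:C%C)%:P%:P
  (size_polyC_leq1 _) (sizeY_polyC2 _).
have -> : dsum 1 (fun s t => normc (coef2 (e%:C%C)%:P%:P s t) ^+ 2) = e ^+ 2.
  have c00 : coef2 (e%:C%C)%:P%:P 0 0 = e%:C%C by exact: coef2_polyC2.
  by rewrite /dsum !big_ord1 c00 normc_real ger0_norm.
apply=> u v u1 v1; rewrite !hornerC normc_real ger0_norm //.
exact: Pe.
Qed.

(** Cauchy's estimate without an integral: by discrete Parseval a single squared coefficient is at
    most the squared bound on the torus. *)
Lemma coef_le_of_torus N c (e : R) j k :
  (forall u v : R[i], normc u = 1 -> normc v = 1 ->
     normc (dsum N (monom c u v)) <= e) ->
  (j < N)%N -> (k < N)%N -> normc (c j k) <= e.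
Proof.
move=> ce jN kN; have e0 : 0 <= e.
  by apply: le_trans (ce 1 1 _ _); rewrite ?normc_ge0 ?normc1.
have := @dsum_sq_coef2_le N (poly2 N c) e.
have h u v : normc u = 1 -> normc v = 1 -> normc (poly2 N c).[u, v] <= e.
  by move=> u1 v1; rewrite horner_poly2 ce.
move=> /(_ h); rewrite coef_poly2 => /(le_trans (dsum_ge_term _ jN kN)).
rewrite /dtrunc jN kN /= => le2; rewrite -(@ler_pXn2r _ 2) ?nnegrE ?normc_ge0 //.
by apply: le2 => *; rewrite exprn_ge0 ?normc_ge0.
Qed.

(** On the torus of radius [r] a truncation differs from 0 by at most the tail, so Cauchy's estimate
    bounds each weighted coefficient by tails that tend to 0. Any radius strictly between 0 and 1
    would serve as well as 1/2. *)
Lemma expands0 c : ac c -> expands c (fun=> 0) -> forall j k, c j k = 0.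
Proof.
move=> ca c0 j k; pose r : R := 2^-1.
have r0 : 0 < r by rewrite invr_gt0.
have r1 : r < 1 by rewrite invf_lt1 // ltr1n.
have rC : normc r%:C%C = r by rewrite normc_real gtr0_norm.
suff : normc (c j k) * r ^+ j * r ^+ k <= 0.
  rewrite pmulr_lle0 ?exprn_gt0 // pmulr_lle0 ?exprn_gt0 //.
  by rewrite le_eqVlt ltNge normc_ge0 orbF normc_eq0 => /eqP.
apply: (@cvgn_ge _ (j + k).+1) (dsum_tail_cvg ca (ltW r0) r1) => N jkN.
have -> : normc (c j k) * r ^+ j * r ^+ k = normc (monom c r%:C%C r%:C%C j k).
  by rewrite /monom !normcM !normcX rC.
apply: (@coef_le_of_torus N); last 2 first.
- by apply: leq_ltn_trans jkN; rewrite leq_addr.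
- by apply: leq_ltn_trans jkN; rewrite leq_addl.
move=> u v u1 v1.
have ru : normc (r%:C%C * u) = r by rewrite normcM u1 mulr1.
have rv : normc (r%:C%C * v) = r by rewrite normcM v1 mulr1.
have zD : bidisk (r%:C%C * u, r%:C%C * v) by apply: bidisk_pair; rewrite ?ru ?rv.
have -> : monom (monom c r%:C%C r%:C%C) u v = monom c (r%:C%C * u) (r%:C%C * v).
  by apply/funext => s; apply/funext => t; rewrite /monom !exprMn; ring.
rewrite -[X in normc X]subr0; apply: ac_tail (ltW r0) r1 _ _ _ => //.
- by rewrite ru.
- by rewrite rv.
- exact: c0 zD.
Qed.

Lemma expands_unique c d f : ac c -> ac d -> expands c f -> expands d f -> c = d.
Proof.
move=> ca da cf df; apply/funext => j; apply/funext => k; apply/eqP.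
rewrite -subr_eq0; apply/eqP; apply: (@expands0 (fun j k => c j k - d j k)).
- move=> r r0 r1; have [M cM] := ca r r0 r1; have [M' dM] := da r r0 r1.
  exists (M + M') => N; apply: le_trans (lerD (cM N) (dM N)); rewrite -dsumD.
  apply: ler_dsum => s t; rewrite /rmonom -!mulrDl !ler_wpM2r ?exprn_ge0 //.
  by rewrite (le_trans (normcD _ _)) // normc_opp.
- move=> z zD; rewrite -(subrr (f z)).
  apply: eq_cvgn (cvgB (cf z zD) (df z zD)) => N.
  rewrite -[LHS]/(dsum N _ - dsum N _) -dsumB; apply: eq_dsum => s t _ _.
  by rewrite /monom !mulrBl.
Qed.

End AbsolutelyConvergent.

(** * Products of linear factors with roots outside the open disk *)

Section FactorEstimates.
Variable R : realType.
Implicit Types (rs : seq R[i]) (s t w : {poly R[i]}).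

Definition majorant N (r : R) t : R := \sum_(n < N) normc t`_n * r ^+ n.

Lemma majorant_ge0 N r t : 0 <= r -> 0 <= majorant N r t.
Proof. by move=> r0; apply: sumr_ge0 => n _; rewrite mulr_ge0 ?exprn_ge0 ?normc_ge0. Qed.

Lemma majorant_ge_coef N r t n : 0 <= r -> (n < N)%N ->
  normc t`_n * r ^+ n <= majorant N r t.
Proof.
move=> r0 nN; rewrite /majorant (bigD1 (Ordinal nN)) //= lerDl.
by apply: sumr_ge0 => i _; rewrite mulr_ge0 ?exprn_ge0 ?normc_ge0.
Qed.

Lemma majorantMX N (r : R) t : 0 <= r -> majorant N r ('X * t) <= r * majorant N r t.
Proof.
move=> r0; case: N => [|N]; first by rewrite /majorant !big_ord0 mulr0.
rewrite /majorant big_ord_recl coefXM /= normc0 mul0r add0r.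
rewrite [X in _ <= _ * X]big_ord_recr /= mulrDr mulr_sumr.
rewrite -[leLHS]addr0 lerD ?mulr_ge0 ?exprn_ge0 ?normc_ge0 //.
by apply: ler_sum => n _; rewrite coefXM /bump add1n /= exprS mulrCA.
Qed.

(** From [rho t = X t - (X - rho) t] the factor [X - rho] shrinks the majorant at most by
    [|rho| - r], and [|rho| - r >= |rho| (1 - r)] when [|rho| >= 1]. *)
Lemma majorant_XsubC N (r : R) (rho : R[i]) t : 0 <= r -> r < 1 -> 1 <= normc rho ->
  normc rho * (1 - r) * majorant N r t <= majorant N r (('X - rho%:P) * t).
Proof.
move=> r0 r1 rho1.
have step : normc rho * majorant N r t <=
    r * majorant N r t + majorant N r (('X - rho%:P) * t).
  apply: (@le_trans _ _ (majorant N r ('X * t) + majorant N r (('X - rho%:P) * t))).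
    rewrite /majorant mulr_sumr -big_split /=; apply: ler_sum => n _.
    rewrite mulrA -mulrDl ler_wpM2r ?exprn_ge0 // -normcM.
    have -> : rho * t`_n = ('X * t)`_n - (('X - rho%:P) * t)`_n.
      by rewrite mulrBl coefB coefCM; ring.
    by rewrite (le_trans (normcD _ _)) // normc_opp.
  by rewrite lerD2r majorantMX.
rewrite -lerBlDl in step; apply: le_trans step.
rewrite mulrBr mulr1 mulrBl lerD2l lerN2 ler_wpM2r ?majorant_ge0 //.
by rewrite ler_peMl.
Qed.

(* [t] is a truncated power series inverse of a polynomial whose roots all    *)
(* lie outside the open disk.                                                  *)
Lemma majorant_inverse rs (x : R[i]) t w N (r : R) : 0 <= r -> r < 1 ->
  all (fun rho => 1 <= normc rho) rs ->
  (x *: \prod_(rho <- rs) ('X - rho%:P)) * t = 1 + 'X^N * w ->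
  normc (x *: \prod_(rho <- rs) ('X - rho%:P)).[0] * (1 - r) ^+ size rs *
    majorant N r t <= 1.
Proof.
move=> r0 r1; have r1' : 0 < 1 - r by rewrite subr_gt0.
elim: rs t => [|rho rs IH] t /=.
  move=> _; rewrite big_nil mulr1 -scalerAl mul1r => xt.
  rewrite hornerZ hornerC mulr1.
  have -> : normc x * majorant N r t = \sum_(n < N) (n == 0 :> nat)%:R.
    rewrite /majorant mulr_sumr; apply: eq_bigr => n _.
    rewrite mulrA -normcM -coefZ xt coefD coef1 coefXnM ltn_ord addr0.
    by case: (n : nat) => [|i]; rewrite /= ?normc1 ?normc0 ?mul1r ?mul0r ?expr0.
  case: (N) => [|M]; first by rewrite big_ord0 ler01.
  by rewrite big_ord_recl big1 ?addr0.
move=> /andP[rho1 rs1]; rewrite big_cons => xt.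
(* Moving the factor ['X - rho] over to [t] gives a truncated inverse for the shorter list of
   roots. *)
have := IH (('X - rho%:P) * t) rs1; rewrite -xt => /(_ ltac:(by rewrite -!scalerAl mulrCA !mulrA)).
apply: le_trans; rewrite !hornerZ hornerM hornerXsubC sub0r.
rewrite (_ : normc _ * _ * _ = normc (x * (\prod_(j <- rs) ('X - j%:P)).[0]) *
   (1 - r) ^+ size rs * (normc rho * (1 - r) * majorant N r t)).
  by rewrite ler_wpM2l ?majorant_XsubC // mulr_ge0 ?normc_ge0 ?exprn_ge0 // ltW.
by rewrite mulrCA normcM normc_opp exprS; ring.
Qed.

(** If [|rho| >= 1] then [|r - rho| >= 1 - r], hence [|1 - rho| <= (1 - r) + |r - rho| <= 2 |r -
    rho|]. Roots on the circle are allowed, and the constant depends only on the number of roots. *)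
Lemma prod_XsubC_ratio rs (x : R[i]) (r : R) : 0 <= r -> r < 1 ->
  all (fun rho => 1 <= normc rho) rs ->
  normc (x *: \prod_(rho <- rs) ('X - rho%:P)).[1] <=
  2 ^+ size rs * normc (x *: \prod_(rho <- rs) ('X - rho%:P)).[r%:C%C].
Proof.
move=> r0 r1; rewrite !hornerZ !normcM mulrCA => rs1.
apply: ler_wpM2l; first exact: normc_ge0.
elim: rs rs1 => [|rho rs IH] /= => [_|/andP[rho1 rs1]].
  by rewrite big_nil !hornerC expr0 mul1r.
rewrite !big_cons !hornerM !hornerXsubC !normcM exprS mulrACA.
rewrite ler_pM ?normc_ge0 ?IH //.
have h : 1 - r <= normc (r%:C%C - rho).
  rewrite normcBC (le_trans _ (ler_normcB _ _)) // normc_real ger0_norm //.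
  by rewrite lerD2r.
have -> : 1 - rho = (1 - r)%:C%C + (r%:C%C - rho).
  by rewrite rmorphB rmorph1; ring.
rewrite (le_trans (normcD _ _)) // normc_real ger0_norm ?subr_ge0 ?(ltW r1) //.
by rewrite mulr_natl mulr2n lerD2r.
Qed.

End FactorEstimates.

(** * Restriction of bivariate polynomials to complex lines through the origin *)

Section Slices.
Variable R : realType.
Implicit Types (P Q : {poly {poly R[i]}}) (c : nat -> nat -> R[i]) (u v : R[i]).

(** The one-variable polynomial [P(u X, v X)]. Its coefficient of degree [n] is the value at
    [(u, v)] of the homogeneous part of degree [n], so facts about roots of one-variable polynomials
    become available. *)
Definition slice u v P : {poly R[i]} :=
  (map_poly (comp_poly (v *: 'X)) P).[u *: 'X].

Lemma sliceM u v P Q : slice u v (P * Q) = slice u v P * slice u v Q.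
Proof. by rewrite /slice rmorphM hornerM. Qed.

Lemma sliceD u v P Q : slice u v (P + Q) = slice u v P + slice u v Q.
Proof. by rewrite /slice rmorphD hornerD. Qed.

Lemma slice1 u v : slice u v 1 = 1.
Proof. by rewrite /slice rmorph1 hornerC. Qed.

Lemma slice_poly2 u v N c :
  slice u v (poly2 N c) = \sum_(j < N) \sum_(k < N) monom c u v j k *: 'X^(j + k).
Proof.
rewrite /slice /poly2 poly_def rmorph_sum /= horner_sum; apply: eq_bigr => j _.
rewrite map_polyZ /= map_polyXn hornerZ hornerXn poly_def rmorph_sum /= mulr_suml.
apply: eq_bigr => k _; rewrite comp_polyZ comp_Xn_poly !exprZn.
rewrite -!scalerAl -!scalerAr !scalerA -exprD addnC.
by congr (_ *: _); rewrite /monom; ring.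
Qed.

Definition homog n c j k : R[i] := if (j + k == n)%N then c j k else 0.

Lemma coef_slice_poly2 u v N c n :
  (slice u v (poly2 N c))`_n = dsum N (monom (homog n c) u v).
Proof.
rewrite slice_poly2 coef_sum; apply: eq_bigr => j _.
rewrite coef_sum; apply: eq_bigr => k _; rewrite coefZ coefXn /monom /homog eq_sym.
by case: eqP => _; rewrite ?mulr1 ?mulr0 ?mul0r.
Qed.

Lemma horner_slice_poly2 u v N c (x : R[i]) :
  (slice u v (poly2 N c)).[x] = dsum N (monom c (x * u) (x * v)).
Proof.
rewrite slice_poly2 horner_sum; apply: eq_bigr => j _.
rewrite horner_sum; apply: eq_bigr => k _; rewrite hornerZ hornerXn /monom.
by rewrite !exprMn exprD; ring.
Qed.

Lemma poly2_wide P : exists2 N, P = poly2 N (coef2 P) & (0 < N)%N.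
Proof.
exists (size P + sizeY P).+1 => //; apply/esym/poly2_coef2.
  by rewrite leqW // leq_addr.
by rewrite leqW // leq_addl.
Qed.

Lemma horner_slice u v P (x : R[i]) : (slice u v P).[x] = P.[x * u, x * v].
Proof.
have [N -> _] := poly2_wide P.
by rewrite horner_slice_poly2 horner_poly2.
Qed.

Lemma size_slice_poly2 u v N c : (size (slice u v (poly2 N c)) <= N + N)%N.
Proof.
rewrite slice_poly2; rewrite (leq_trans (size_sum _ _ _)) //.
apply/bigmax_leqP => j _; rewrite (leq_trans (size_sum _ _ _)) //.
apply/bigmax_leqP => k _; rewrite (leq_trans (size_scale_leq _ _)) //.
by rewrite size_polyXn -addSn leq_add // ltnW.
Qed.

End Slices.

(** * The power series of [1 / p] on the bidisk *)

Section Reciprocal.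
Variable R : realType.
Implicit Types (c d : nat -> nat -> R[i]).

Definition delta j k : R[i] := ((j == 0%N) && (k == 0%N))%:R.

Lemma coef2_1 : coef2 (1 : {poly {poly R[i]}}) = delta.
Proof.
apply/funext => j; apply/funext => k; rewrite /coef2 /delta coef1.
case: (j == 0)%N; last by rewrite mulr0n coef0.
by rewrite mulr1n coef1.
Qed.

Lemma coef2B (P Q : {poly {poly R[i]}}) j k :
  coef2 (P - Q) j k = coef2 P j k - coef2 Q j k.
Proof. by rewrite /coef2 !coefB. Qed.

Lemma coef2CM (x : R[i]) (P : {poly {poly R[i]}}) j k :
  coef2 (x%:P%:P * P) j k = x * coef2 P j k.
Proof. by rewrite /coef2 !coefCM. Qed.

Lemma coef2_expr_low (e : {poly {poly R[i]}}) i j k : coef2 e 0 0 = 0 ->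
  (j + k < i)%N -> coef2 (e ^+ i) j k = 0.
Proof.
move=> e0; elim: i j k => // i IH j k jki.
rewrite exprS coef2M /conv big1 // => s _; rewrite big1 // => t _.
have sj := ltn_ord s; have tk := ltn_ord t.
have [/andP[/eqP s0 /eqP t0]|st] := boolP ((s == 0%N :> nat) && (t == 0%N :> nat)).
  by rewrite s0 t0 e0 mul0r.
by rewrite IH ?mulr0 //; lia.
Qed.

Lemma expands_coef2 (P : {poly {poly R[i]}}) :
  expands (coef2 P) (fun z => P.[z.1, z.2]).
Proof.
move=> z _; apply: cvg_near_cst; exists (size P + sizeY P)%N => // N /= sN.
by apply/esym/horner2_coef2; rewrite (leq_trans _ sN) ?leq_addr ?leq_addl.
Qed.

Lemma ac_coef2 (P : {poly {poly R[i]}}) : ac (coef2 P).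
Proof.
have [N -> _] := poly2_wide P.
apply: (@bounded_ac _ _ (dsum N (fun j k => normc (coef2 P j k)))) => j k.
rewrite coef_poly2 /dtrunc; case: ifP => [/andP[jN kN]|_].
  by apply: (@dsum_ge_term _ _ (fun j k => normc (coef2 P j k))) => //= ? ?; exact: normc_ge0.
by rewrite normc0 dsum_ge0 // => ? ?; exact: normc_ge0.
Qed.

(** Abel's lemma: boundedness at a radius [s] with [r < s < 1] gives decay like [(r / s) ^+ (j + k)]
    at radius [r]. *)
Lemma ac_bounded_rmonom c :
  (forall r : R, 0 <= r -> r < 1 -> exists B, forall j k, rmonom c r j k <= B) -> ac c.
Proof.
move=> cb r r0 r1; pose s := (1 + r) / 2.
have [s0 s1 rs] : [/\ 0 < s, s < 1 & r < s] by rewrite /s; split; lra.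
have [B cB] := cb s (ltW s0) s1.
have acm : ac (monom c s%:C%C s%:C%C).
  apply: (@bounded_ac _ _ B) => j k; apply: le_trans (cB j k).
  by apply: normc_monom_le; rewrite normc_real gtr0_norm.
have rs0 : 0 <= r / s by rewrite divr_ge0 // ltW.
have rs1 : r / s < 1 by rewrite ltr_pdivrMr // mul1r.
apply: dsummable_le (acm _ rs0 rs1) => j k.
rewrite /rmonom /monom !normcM !normcX normc_real gtr0_norm //.
rewrite ![(r / s) ^+ _]exprMn.
rewrite le_eqVlt; apply/orP; left; apply/eqP.
have sj : s ^+ j != 0 by rewrite expf_neq0 // gt_eqF.
have sk : s ^+ k != 0 by rewrite expf_neq0 // gt_eqF.
by rewrite !exprVn; field; rewrite sj sk.
Qed.

(** A real array [y] dominated by a summable [x] is the difference of the nonnegative summable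
    arrays [x + y] and [x], so monotone convergence suffices. *)
Lemma dsum_cvgc c : dsummable (fun j k => normc (c j k)) ->
  exists l : R[i], (fun N => dsum N c) @ \oo --> l.
Proof.
move=> cs; pose x j k := normc (c j k).
have x0 j k : 0 <= x j k by exact: normc_ge0.
have real_cvg (y : nat -> nat -> R) : (forall j k, `|y j k| <= x j k) ->
    exists l : R, (fun N => dsum N y) @ \oo --> l.
  move=> yx; pose w j k := x j k + y j k.
  have w0 j k : 0 <= w j k.
    by have := yx j k; rewrite ler_norml => /andP[h _]; rewrite /w -lerBlDl sub0r.
  have ws : dsummable w.
    have [M xM] := cs; exists (M + M) => N; apply: le_trans (lerD (xM N) (xM N)).
    rewrite -dsumD; apply: ler_dsum => j k; rewrite lerD2l.
    exact: le_trans (ler_norm _) (yx j k).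
  exists (dseries w - dseries x).
  apply: eq_cvgn (cvgB (dsum_cvg w0 ws) (dsum_cvg x0 cs)) => N.
  rewrite -[LHS]/(dsum N _ - dsum N _) -dsumB; apply: eq_dsum => j k _ _.
  by rewrite /w addrAC subrr add0r.
have [l1 h1] := real_cvg _ (fun j k => normc_geRe (c j k)).
have [l2 h2] := real_cvg _ (fun j k => normc_geIm (c j k)).
exists (l1 +i* l2)%C; apply: cvgc_ReIm.
  apply: eq_cvgn h1 => N; rewrite /dsum raddf_sum; apply: eq_bigr => j _.
  by rewrite raddf_sum.
apply: eq_cvgn h2 => N; rewrite /dsum raddf_sum; apply: eq_bigr => j _.
by rewrite raddf_sum.
Qed.

Lemma ac_expands c : ac c -> exists f, expands c f.
Proof.
move=> ca.
suff h (z : R[i] * R[i]) :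
    exists l : R[i], bidisk z -> (fun N => dsum N (monom c z.1 z.2)) @ \oo --> l.
  have [f fE] := choice h; exists f => z zD; exact: fE.
have [zD|nzD] := pselect (bidisk z); last by exists 0 => /nzD.
by have [l lE] := dsum_cvgc (ac_summable ca zD); exists l.
Qed.

Variable p : {poly {poly R[i]}}.
Hypothesis p_neq0 : forall z, bidisk z -> p.[z.1, z.2] != 0.

Let p0 : R[i] := coef2 p 0 0.

Lemma bidisk0 : bidisk ((0, 0) : R[i] * R[i]).
Proof. by apply: bidisk_pair; rewrite normc0 ltr01. Qed.

Lemma horner2_00 (P : {poly {poly R[i]}}) : P.[0, 0] = coef2 P 0 0.
Proof. by rewrite !horner_coef0. Qed.

Lemma coef2_p_neq0 : p0 != 0.
Proof. by rewrite /p0 -horner2_00; exact: (p_neq0 bidisk0). Qed.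

Let e : {poly {poly R[i]}} := 1 - p0^-1%:P%:P * p.

(** The Neumann series of [p0^-1 / (1 - e)]. As [e] has no constant term, powers of [e] beyond
    [j + k] do not reach the coefficient at [(j, k)], so a finite sum is exact. *)
Definition recip j k : R[i] := p0^-1 * coef2 (\sum_(i < (j + k).+1) e ^+ i) j k.

Let e00 : coef2 e 0 0 = 0.
Proof. by rewrite coef2B coef2CM coef2_1 mulVf ?coef2_p_neq0 // /delta subrr. Qed.

Let recip_wide M j k : (j + k <= M)%N ->
  recip j k = p0^-1 * coef2 (\sum_(i < M.+1) e ^+ i) j k.
Proof.
move=> jkM; rewrite /recip; congr (_ * _); rewrite /coef2.
rewrite -(big_mkord xpredT (fun i => e ^+ i)) -(big_mkord xpredT (fun i => e ^+ i)).
rewrite [in RHS](@big_cat_nat _ _ _ (j + k).+1) //= [in RHS]coefD [in RHS]coefD.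
rewrite [X in _ + X](_ : _ = 0) ?addr0 // !coef_sum big_nat_cond big1 // => i.
by rewrite andbT => /andP[jki _]; rewrite -[LHS]/(coef2 _ _ _) coef2_expr_low.
Qed.

Lemma conv_recip : conv (coef2 p) recip = delta.
Proof.
apply/funext => j; apply/funext => k; set M := (j + k)%N.
pose S := \sum_(i < M.+1) e ^+ i.
transitivity (coef2 (p * (p0^-1%:P%:P * S)) j k).
  rewrite coef2M; apply: eq_bigr => s _; apply: eq_bigr => t _; congr (_ * _).
  by rewrite coef2CM; apply: recip_wide; rewrite leq_add ?leq_subr.
have -> : p * (p0^-1%:P%:P * S) = 1 - e ^+ M.+1.
  have pe : p0^-1%:P%:P * p = 1 - e by rewrite /e subKr.
  rewrite mulrCA mulrA pe -(opprB e) mulNr.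
  by rewrite -(opprB (e ^+ M.+1)) subrX1.
by rewrite coef2B coef2_expr_low ?subr0 ?coef2_1.
Qed.

(** A root of the slice inside the disk would give a zero of [p] in the bidisk. The crude bound on
    the number of roots matters because it does not depend on [u] and [v]. *)
Lemma slice_roots u v : normc u = 1 -> normc v = 1 ->
  exists (x : R[i]) (rs : seq R[i]),
    [/\ slice u v p = x *: \prod_(rho <- rs) ('X - rho%:P),
        all (fun rho => 1 <= normc rho) rs &
        (size rs <= (size p + sizeY p).+1.*2)%N].
Proof.
move=> u1 v1; have [rs rsE] := closed_field_poly_normal (slice u v p).
exists (lead_coef (slice u v p)), rs; have s0 : (slice u v p).[0] != 0.
  by rewrite horner_slice !mul0r; exact: (p_neq0 bidisk0).
have l0 : lead_coef (slice u v p) != 0.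
  by rewrite lead_coef_eq0; apply: contraNneq s0 => ->; rewrite horner0.
split=> //.
  apply/allP => rho rrs; rewrite leNgt; apply/negP => rho1.
  have zD : bidisk (rho * u, rho * v) by apply: bidisk_pair; rewrite normcM ?u1 ?v1 mulr1.
  have := p_neq0 zD; rewrite /= -horner_slice rsE hornerZ mulf_eq0 negb_or.
  by rewrite -rootE root_prod_XsubC rrs andbF.
have := size_slice_poly2 u v (size p + sizeY p).+1 (coef2 p).
rewrite (poly2_coef2 (leqW (leq_addr _ _)) (leqW (leq_addl _ _))).
rewrite {1}rsE size_scale //.
by rewrite size_prod_XsubC addnn => /ltnW.
Qed.

(** The product of [p] with the truncated reciprocal differs from 1 only at indices with [j >= N] or
    [k >= N]; these have total degree at least [N]. *)
Lemma slice_recip u v N : exists w,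
  slice u v p * slice u v (poly2 N recip) = 1 + 'X^N * w.
Proof.
rewrite -sliceM -[p * _](subrK 1) sliceD slice1 addrC; set S := _ - 1.
have Slow j k : (j < N)%N -> (k < N)%N -> coef2 S j k = 0.
  move=> jN kN; rewrite /S coef2B coef2M coef_poly2 coef2_1 -conv_recip.
  by rewrite -(conv_dtrunc _ _ jN kN) dtrunc_id // conv_dtrunc // subrr.
exists (drop_poly N (slice u v S)); congr (_ + _).
rewrite -[LHS](poly_take_drop N) [drop_poly _ _ * _]mulrC -[RHS]add0r; congr (_ + _).
apply/polyP => n; rewrite coef_take_poly coef0; case: ltnP => // nN.
have [K -> _] := poly2_wide S; rewrite coef_slice_poly2.
rewrite /dsum big1 // => j _; rewrite big1 // => k _.
rewrite /monom /homog; case: eqP => [jkn|_]; last by rewrite !mul0r.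
by rewrite Slow ?mul0r //; lia.
Qed.

Let deg := (size p + sizeY p).+1.*2.

(** On the torus the homogeneous part of degree [j + k] is a coefficient of a truncated inverse of
    the slice, bounded through [majorant_inverse] uniformly in [u] and [v]; Cauchy's estimate then
    isolates the entry [(j, k)]. *)
Lemma rmonom_recip_le (r : R) j k : 0 <= r -> r < 1 ->
  rmonom recip r j k <= (normc p0 * (1 - r) ^+ deg)^-1.
Proof.
have := slice_roots; rewrite -/deg; move: deg => d roots.
move=> r0 r1; have r1' : 0 < 1 - r by rewrite subr_gt0.
have pr0 : 0 < normc p0 * (1 - r) ^+ d.
  by rewrite mulr_gt0 ?exprn_gt0 // normc_gt0 coef2_p_neq0.
set n := (j + k)%N; set N := n.+1.
have jN : (j < N)%N by rewrite ltnS leq_addr.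
have kN : (k < N)%N by rewrite ltnS leq_addl.
have -> : rmonom recip r j k = normc (r%:C%C ^+ n * homog n recip j k).
  rewrite /rmonom /homog eqxx [X in _ = X]normcM [normc (_ ^+ _)]normcX.
  rewrite normc_real ger0_norm // exprD.
  by ring.
apply: (@coef_le_of_torus _ N (fun j k => r%:C%C ^+ n * homog n recip j k) _ j k) => //.
move=> u v u1 v1.
have -> : dsum N (monom (fun j k => r%:C%C ^+ n * homog n recip j k) u v) =
    r%:C%C ^+ n * (slice u v (poly2 N recip))`_n.
  rewrite coef_slice_poly2 -dsumMl; apply: eq_dsum => s t _ _.
  by rewrite /monom !mulrA.
rewrite normcM normcX normc_real ger0_norm // [leLHS]mulrC.
have [x [rs [xE rs1 srs]]] := roots u v u1 v1.
have [w wE] := slice_recip u v N; rewrite xE in wE.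
have := majorant_inverse r0 r1 rs1 wE; rewrite -xE horner_slice !mul0r horner2_00.
rewrite -/p0 => mj; rewrite -[leRHS]mul1r ler_pdivlMr //.
apply: le_trans mj; rewrite [leLHS]mulrC; apply: ler_pM.
- exact: ltW.
- by rewrite mulr_ge0 ?exprn_ge0 ?normc_ge0.
- rewrite ler_wpM2l ?normc_ge0 // ler_wiXn2l ?(ltW r1') //.
  by rewrite lerBlDr lerDl.
- exact: majorant_ge_coef.
Qed.

Lemma ac_recip : ac recip.
Proof.
apply: ac_bounded_rmonom => r r0 r1.
by exists (normc p0 * (1 - r) ^+ deg)^-1 => j k; exact: rmonom_recip_le.
Qed.

Lemma expands_delta : expands delta (fun=> 1).
Proof.
rewrite -coef2_1; have := @expands_coef2 1.
by under [X in expands _ X]eq_fun do rewrite !hornerC.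
Qed.

(** Convergence to some function [f] is known beforehand; the Cauchy product with [p] then forces
    [p f = 1]. *)
Lemma expands_recip : expands recip (fun z => p.[z.1, z.2]^-1).
Proof.
have [f fE] := ac_expands ac_recip => z zD.
have pf : p.[z.1, z.2] * f z = 1.
  have := expands_conv (ac_coef2 p) ac_recip (@expands_coef2 p) fE zD.
  by rewrite conv_recip => /cvgc_unique; apply; exact: expands_delta.
suff -> : p.[z.1, z.2]^-1 = f z by exact: fE.
by apply: (mulfI (p_neq0 zD)); rewrite pf mulfV ?p_neq0.
Qed.

(** The comparison is made factor by factor, so zeros of [p] on the torus do no harm and the
    constant depends on none of [r], [u], [v]. *)
Lemma normc_stable_ratio u v (r : R) : 0 <= r -> r < 1 ->
  normc u = 1 -> normc v = 1 ->
  normc p.[u, v] <= 2 ^+ deg * normc p.[r%:C%C * u, r%:C%C * v].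
Proof.
move=> r0 r1 u1 v1; have [x [rs [xE rs1 srs]]] := slice_roots u1 v1.
have := prod_XsubC_ratio x r0 r1 rs1; rewrite -xE !horner_slice !mul1r.
move/le_trans; apply; rewrite ler_wpM2r ?normc_ge0 //.
by rewrite ler_weXn2l // ler1n.
Qed.

End Reciprocal.

(** * Square-summable arrays and their inner product *)

Section SquareSummableArrays.
Variable R : realType.
Implicit Types (c d e : nat -> nat -> R[i]).

Definition sq c j k : R := normc (c j k) ^+ 2.

Definition l2 c := dsummable (sq c).

Definition nsq c : R := dseries (sq c).

Definition lc (x : R[i]) c d j k : R[i] := x * c j k + d j k.

Definition ip c d : R[i] := limn (fun N => dsum N (fun j k => c j k * conjc (d j k))).

Lemma sq_ge0 c j k : 0 <= sq c j k.
Proof. by rewrite exprn_ge0 ?normc_ge0. Qed.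

Lemma nsq_cvg c : l2 c -> (fun N => dsum N (sq c)) @ \oo --> nsq c.
Proof. exact/dsum_cvg/sq_ge0. Qed.

Lemma nsq_ge0 c : l2 c -> 0 <= nsq c.
Proof. exact/dseries_ge0/sq_ge0. Qed.

Lemma dsum_le_nsq N c : l2 c -> dsum N (sq c) <= nsq c.
Proof. exact/dsum_le_dseries/sq_ge0. Qed.

Lemma nsq_le c M : (forall N, dsum N (sq c) <= M) -> nsq c <= M.
Proof. exact/dseries_le/sq_ge0. Qed.

Lemma l2_lc x c d : l2 c -> l2 d -> l2 (lc x c d).
Proof.
move=> [A cA] [B dB]; exists (2 * (normc x ^+ 2 * A) + 2 * B) => N.
apply: (@le_trans _ _ (dsum N (fun j k => 2 * (normc x ^+ 2 * sq c j k) + 2 * sq d j k))).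
  apply: ler_dsum => j k; rewrite /sq /lc.
  apply: (@le_trans _ _ ((normc (x * c j k) + normc (d j k)) ^+ 2)).
    by rewrite lerXn2r ?nnegrE ?addr_ge0 ?normc_ge0 ?normcD.
  rewrite normcM -exprMn; set u := _ * _; set v := normc _.
  by have := sqr_ge0 (u - v); rewrite sqrrB sqrrD; nra.
rewrite dsumD !dsumMl lerD ?ler_wpM2l // ?exprn_ge0 ?normc_ge0 //.
Qed.

Lemma sq_sum_le N c j k : (j < N)%N -> (k < N)%N -> sq c j k <= dsum N (sq c).
Proof. by move=> jN kN; apply: dsum_ge_term jN kN; exact: sq_ge0. Qed.

(** The bound comes from [s <= 1 + s ^+ 2], which avoids a square root. *)
Lemma l2_bounded c : l2 c -> forall j k, normc (c j k) <= 1 + nsq c.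
Proof.
move=> cl j k; have h : sq c j k <= nsq c.
  apply: le_trans (dsum_le_nsq (j + k).+1 cl).
  by apply: sq_sum_le; rewrite ltnS ?leq_addr ?leq_addl.
move: h; rewrite /sq; have := normc_ge0 (c j k); nra.
Qed.

Lemma l2_ac c : l2 c -> ac c.
Proof. by move=> cl; apply: bounded_ac (l2_bounded cl). Qed.

Lemma ip_cvg c d : l2 c -> l2 d ->
  (fun N => dsum N (fun j k => c j k * conjc (d j k))) @ \oo --> ip c d.
Proof.
move=> [A cA] [B dB].
have [|l lE] := @dsum_cvgc R (fun j k => c j k * conjc (d j k)).
  exists (A + B) => N; apply: le_trans (lerD (cA N) (dB N)); rewrite -dsumD.
  apply: ler_dsum => j k; rewrite normcM normc_conj /sq.
  have := sqr_ge0 (normc (c j k) - normc (d j k)).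
  have := normc_ge0 (c j k); have := normc_ge0 (d j k).
  by rewrite sqrrB; nra.
by rewrite /ip (cvg_lim (@norm_hausdorff _ _) lE).
Qed.

Lemma ip_lcl x c d e : l2 c -> l2 d -> l2 e ->
  ip (lc x c d) e = x * ip c e + ip d e.
Proof.
move=> cl dl el; apply: cvgc_unique (ip_cvg (l2_lc x cl dl) el) _.
apply: eq_cvgn (cvgD (cvgM (cvg_cst x) (ip_cvg cl el)) (ip_cvg dl el)) => N.
rewrite -[LHS]/(x * dsum N _ + dsum N _) -dsumMl -dsumD; apply: eq_dsum => j k _ _.
by rewrite /lc mulrDl mulrA.
Qed.

Lemma ip_conj c d : l2 c -> l2 d -> ip d c = conjc (ip c d).
Proof.
move=> cl dl; apply: cvgc_unique (ip_cvg dl cl) _.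
apply: eq_cvgn (cvgc_conj (ip_cvg cl dl)) => N.
rewrite rmorph_sum; apply: eq_bigr => j _; rewrite rmorph_sum; apply: eq_bigr => k _.
by rewrite rmorphM /= conjcK mulrC.
Qed.

Lemma ip_lcr x c d e : l2 c -> l2 d -> l2 e ->
  ip e (lc x c d) = conjc x * ip e c + ip e d.
Proof.
move=> cl dl el; rewrite (ip_conj (l2_lc x cl dl) el) ip_lcl // rmorphD rmorphM /=.
by rewrite -!ip_conj.
Qed.

Lemma ip_diag c : l2 c -> ip c c = (nsq c)%:C%C.
Proof.
move=> cl; apply: cvgc_unique (ip_cvg cl cl) _.
apply: eq_cvgn (cvgc_real (nsq_cvg cl)) => N.
rewrite rmorph_sum; apply: eq_bigr => j _; rewrite rmorph_sum; apply: eq_bigr => k _.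
exact: normc_sqrC.
Qed.

Lemma nsq_lc x c d : l2 c -> l2 d ->
  nsq (lc x c d) = normc x ^+ 2 * nsq c + nsq d + 2 * complex.Re (x * ip c d).
Proof.
move=> cl dl; apply: (@complexI R); rewrite -ip_diag; last exact: l2_lc.
rewrite ip_lcl ?ip_lcr //; try exact: l2_lc.
rewrite (ip_conj cl dl) !ip_diag //; have := normc_sqrC x.
have CD (a b : R) : (a + b)%:C%C = a%:C%C + b%:C%C :> R[i] := rmorphD _ a b.
have CM (a b : R) : (a * b)%:C%C = a%:C%C * b%:C%C :> R[i] := rmorphM _ a b.
move: (normc x ^+ 2) => u uE; rewrite !CD !CM uE.
have -> z : 2%:C%C * (complex.Re z)%:C%C = z + conjc z :> R[i].
  by case: z => a b; apply/eqP; rewrite eq_complex /=; apply/andP; split; apply/eqP; ring.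
by rewrite rmorphM; ring.
Qed.

Lemma sq_dtrunc N c : sq (dtrunc N c) = dtrunc N (sq c).
Proof.
apply/funext => j; apply/funext => k; rewrite /sq /dtrunc.
by case: ifP => // _; rewrite normc0 expr0n.
Qed.

Lemma l2_dtrunc N c : l2 (dtrunc N c).
Proof.
exists (dsum N (sq c)) => M.
have [NM|/ltnW MN] := leqP N M; first by rewrite (dsum_widen _ NM) sq_dtrunc.
rewrite sq_dtrunc dsum_dtrunc //; apply: dsum_le_widen => //; exact: sq_ge0.
Qed.

Lemma nsq_tail_cvg c : l2 c ->
  (fun N => nsq (lc (-1) (dtrunc N c) c)) @ \oo --> (0 : R).
Proof.
move=> cl; have h N : nsq (lc (-1) (dtrunc N c) c) <= nsq c - dsum N (sq c).
  apply: nsq_le => M; have MN := leq_addr N M; have NM := leq_addl M N.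
  apply: (@le_trans _ _ (dsum (M + N) (sq (lc (-1) (dtrunc N c) c)))).
    by apply: dsum_le_widen => //; exact: sq_ge0.
  apply: (@le_trans _ _ (dsum (M + N) (sq c) - dsum N (sq c))); last first.
    by rewrite lerD2r dsum_le_nsq.
  rewrite (dsum_widen _ NM) -dsumB; apply: ler_dsum => j k.
  rewrite /sq /lc /dtrunc; case: ifP => _.
    by rewrite mulN1r addNr normc0 expr0n /= subrr.
  by rewrite mulr0 add0r subr0.
have nt : (fun N => nsq c - dsum N (sq c)) @ \oo --> (0 : R).
  by rewrite -(subrr (nsq c)); apply: cvgB; [exact: cvg_cst|exact: nsq_cvg].
apply: (squeeze_cvgr _ (cvg_cst _) nt); apply: nearW => N; rewrite h andbT.
by apply: nsq_ge0; apply: l2_lc => //; exact: l2_dtrunc.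
Qed.

End SquareSummableArrays.

(** * Multiplication by a function bounded by 1 is a contraction *)

Section Contraction.
Variable R : realType.
Implicit Types (c d h : nat -> nat -> R[i]).

Lemma cvg_one_sub_inv : (fun n => 1 - n.+1%:R^-1 : R) @ \oo --> (1 : R).
Proof.
rewrite -[X in _ --> X]subr0; apply: cvgB; first exact: cvg_cst.
exact: cvg_harmonic.
Qed.

Lemma one_sub_inv_itv n : 0 <= 1 - n.+1%:R^-1 :> R /\ 1 - n.+1%:R^-1 < 1 :> R.
Proof.
by rewrite subr_ge0 invf_le1 ?ler1n ?ltr0n // gtrBl invr_gt0 ltr0n.
Qed.

Lemma le_of_radius_le (x y : R) n :
  (forall r : R, 0 <= r -> r < 1 -> x * r ^+ n <= y) -> x <= y.
Proof.
move=> xy; apply: (@cvgn_le _ 0 (fun k => x * (1 - k.+1%:R^-1) ^+ n)).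
  by move=> k _; have [h0 h1] := one_sub_inv_itv k; exact: xy.
rewrite -[X in _ --> X]mulr1 -[X in _ --> x * X](expr1n R n).
apply: cvgM; first exact: cvg_cst.
apply: (@cvg_comp _ _ _ _ (fun z : R => z ^+ n) _ (nbhs (1 : R))).
  exact: cvg_one_sub_inv.
exact: exprn_continuous.
Qed.

(** At radius [r < 1] the truncation of [a] at order [K] has modulus at most [1 + ep K] on the
    torus, so torus domination applies to polynomials; then [K] tends to infinity and [r] to 1.
    Below [N] the product sees only the entries of [h] below [N], hence the same [N] on both
    sides. *)
Lemma dsum_sq_conv_le a (f : R[i] * R[i] -> R[i]) h N :
  ac a -> expands a f -> (forall z, bidisk z -> normc (f z) <= 1) ->
  dsum N (sq (conv a h)) <= dsum N (sq h).
Proof.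
(* The squared weights [r ^+ (2 (j + k))] with [j, k < N] are at least [r ^+ (4 N)]. *)
move=> aa af f1; apply: (@le_of_radius_le _ _ (N + N) .*2) => r r0 r1.
have rC : normc r%:C%C = r by rewrite normc_real ger0_norm.
pose ar := monom a r%:C%C r%:C%C; pose hr := monom h r%:C%C r%:C%C.
pose ep K := dseries (rmonom a r) - dsum K (rmonom a r).
have ep0 K : 0 <= ep K.
  rewrite subr_ge0; apply: dsum_le_dseries; last exact: aa.
  by move=> j k; exact: rmonom_ge0.
have ep1 K : 0 <= 1 + ep K by exact: addr_ge0 ler01 (ep0 K).
have bound K : (N <= K)%N ->
    dsum N (sq (conv ar hr)) <= (1 + ep K) ^+ 2 * dsum N (sq hr).
  move=> NK; pose H := poly2 N hr.
  have := @dsum_le_of_torus_le R N (N.+1) (poly2 K ar * H)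
    ((1 + ep K)%:C%C%:P%:P * H).
  have szH : (size H <= N)%N by exact: size_poly.
  have szYH : (sizeY H <= N)%N by exact: sizeY_poly2.
  have cst (x : R[i]) : (size (x%:P%:P : {poly {poly R[i]}}) <= 1)%N /\
      (sizeY (x%:P%:P : {poly {poly R[i]}}) <= 1)%N.
    split; first exact: size_polyC_leq1.
    apply/bigmax_leqP => i _; rewrite coefC; case: ifP => _.
      exact: size_polyC_leq1.
    by rewrite size_poly0.
  have [c1 c2] := cst (1 + ep K)%:C%C.
  move=> /(_ (leq_trans (size_polyMleq _ _) (leq_trans (leq_pred _) (leq_add c1 szH)))).
  move=> /(_ (leq_trans (sizeYM _ _) (leq_trans (leq_pred _) (leq_add c2 szYH)))).
  have hT u v : normc u = 1 -> normc v = 1 ->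
      normc (poly2 K ar * H).[u, v] <= normc ((1 + ep K)%:C%C%:P%:P * H).[u, v].
    move=> u1 v1; rewrite !horner2M !normcM ler_wpM2r ?normc_ge0 //.
    rewrite !hornerC normc_real ger0_norm ?ep1 //.
    rewrite horner_poly2.
    have -> : dsum K (fun j k => ar j k * u ^+ j * v ^+ k) =
        dsum K (monom a (r%:C%C * u) (r%:C%C * v)).
      by apply: eq_dsum => j k _ _; rewrite /ar /monom !exprMn; ring.
    have ru : normc (r%:C%C * u) = r by rewrite normcM u1 mulr1.
    have rv : normc (r%:C%C * v) = r by rewrite normcM v1 mulr1.
    have zD : bidisk (r%:C%C * u, r%:C%C * v) by apply: bidisk_pair; rewrite ?ru ?rv.
    have := @ac_tail _ a (r%:C%C * u) (r%:C%C * v) r K _ aa r0 r1 _ _ (af _ zD).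
    rewrite ru rv lexx => /(_ isT isT) tl.
    rewrite -[X in normc X](subrK (f (r%:C%C * u, r%:C%C * v))) addrC.
    by rewrite (le_trans (normcD _ _)) // lerD // f1.
  move=> /(_ hT).
  have -> : dsum N (fun j k => normc (coef2 (poly2 K ar * H) j k) ^+ 2) =
      dsum N (sq (conv ar hr)).
    apply: eq_dsum => j k jN kN; rewrite coef2M !coef_poly2 /sq; congr (normc _ ^+ 2).
    apply: eq_conv => s t sj tk.
      by rewrite /dtrunc ifT //; apply/andP; split; lia.
    by rewrite /dtrunc ifT //; apply/andP; split; lia.
  move/le_trans; apply.
  have -> : (fun j k => normc (coef2 ((1 + ep K)%:C%C%:P%:P * H) j k) ^+ 2) =
      (fun j k => (1 + ep K) ^+ 2 * sq (dtrunc N hr) j k).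
    apply/funext => j; apply/funext => k.
    rewrite coef2CM coef_poly2 normcM exprMn normc_real ger0_norm //.
  rewrite dsumMl sq_dtrunc -dsum_widen // ler_wpM2l // exprn_ge0 //.
have lim_bound : dsum N (sq (conv ar hr)) <= dsum N (sq hr).
  apply: (@cvgn_ge _ N _ _ _ bound).
  have e1 : (fun K => 1 + ep K) @ \oo --> (1 + 0 : R).
    by apply: cvgD; [exact: cvg_cst|exact: dsum_tail_cvg].
  have e2 : (fun K => (1 + ep K) * (1 + ep K) * dsum N (sq hr)) @ \oo -->
      (1 + 0) * (1 + 0) * dsum N (sq hr).
    by apply: cvgM; [exact: cvgM|exact: cvg_cst].
  by rewrite addr0 !mul1r in e2.
apply: le_trans (le_trans _ lim_bound) _; last first.
  apply: ler_dsum => j k; rewrite /sq /hr /monom lerXn2r ?nnegrE ?normc_ge0 //.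
  rewrite !normcM !normcX rC -mulrA ler_piMr ?normc_ge0 //.
  by rewrite mulr_ile1 ?exprn_ge0 ?exprn_ile1 // ltW.
rewrite conv_monom mulrC -dsumMl; apply: ler_dsum_in => j k jN kN.
rewrite /sq /monom !normcM !normcX rC !exprMn -!exprM mulrC -mulrA.
rewrite ler_wpM2l ?exprn_ge0 ?normc_ge0 // -exprD.
rewrite ler_wiXn2l ?(ltW r1) //; lia.
Qed.

Lemma l2_conv a (f : R[i] * R[i] -> R[i]) h :
  ac a -> expands a f -> (forall z, bidisk z -> normc (f z) <= 1) ->
  l2 h -> l2 (conv a h).
Proof.
move=> aa af f1 hl; exists (nsq h) => N.
by apply: le_trans (dsum_le_nsq N hl); exact: dsum_sq_conv_le aa af f1.
Qed.

Lemma nsq_conv_le a (f : R[i] * R[i] -> R[i]) h :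
  ac a -> expands a f -> (forall z, bidisk z -> normc (f z) <= 1) ->
  l2 h -> nsq (conv a h) <= nsq h.
Proof.
move=> aa af f1 hl; apply: nsq_le => N.
by apply: le_trans (dsum_le_nsq N hl); exact: dsum_sq_conv_le aa af f1.
Qed.

End Contraction.

(** * The Taylor coefficients of [p~ / p] *)

Section ReflectedQuotient.
Variable R : realType.
Variables (m n : nat) (p : {poly {poly R[i]}}).
Hypothesis p_neq0 : forall z, bidisk z -> p.[z.1, z.2] != 0.
Hypotheses (size_p : size p = m.+1) (sizeY_p : sizeY p = n.+1).

Let pt := reflection m n p.

Definition quot := conv (coef2 pt) (recip p).

Let a := quot.

Lemma coef2_reflection j k : coef2 pt j k =
  if (j <= m)%N && (k <= n)%N then conjc (coef2 p (m - j) (n - k)) else 0.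
Proof.
rewrite /coef2 /pt /reflection coef_poly ltnS; case: leqP => //= jm; rewrite ?coef0 //.
by rewrite coef_poly ltnS.
Qed.

Lemma coef2_p_supp j k : ~~ ((j <= m)%N && (k <= n)%N) -> coef2 p j k = 0.
Proof.
rewrite /coef2 negb_and -!ltnNge => /orP[mj|nk].
  by rewrite (@nth_default _ _ _ j) ?coef0 // size_p.
by rewrite nth_default // (leq_trans (max_size_coefXY _ _)) // sizeY_p.
Qed.

Lemma normc_reflection (u v : R[i]) : normc u = 1 -> normc v = 1 ->
  normc pt.[u, v] = normc p.[u, v].
Proof.
move=> u1 v1.
have inv (w : R[i]) : normc w = 1 -> w != 0 /\ (conjc w)^-1 = w.
  move=> w1; have w0 : w != 0 by rewrite -normc_gt0 w1.
  split=> //; apply: (mulfI (_ : conjc w != 0)); first by rewrite -normc_gt0 normc_conj w1.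
  rewrite mulfV -?normc_gt0 ?normc_conj ?w1 //.
  by rewrite mulrC -normc_sqrC w1 expr1n.
have [u0 uE] := inv u u1; have [v0 vE] := inv v v1.
rewrite /pt reflectionE ?size_p ?sizeY_p // uE vE.
by rewrite !normcM !normcX u1 v1 !expr1n !mul1r normc_conj.
Qed.

Lemma ac_quot : ac a.
Proof. by apply: ac_conv; [exact: ac_coef2|exact: ac_recip]. Qed.

Lemma expands_quot : expands a (rif m n p).
Proof.
apply: expands_conv; [exact: ac_coef2|exact: ac_recip| |exact: expands_recip].
exact: expands_coef2.
Qed.

Lemma conv_p_quot : conv (coef2 p) a = coef2 pt.
Proof.
rewrite /a /quot convA [conv (coef2 p) _]convC -convA conv_recip //.
have [N -> _] := poly2_wide pt.
by rewrite -coef2_1 -coef2M mulr1.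
Qed.

Lemma sum_ord_supp (V : nmodType) (F : nat -> V) k l : (k <= l)%N ->
  (forall i, (k <= i)%N -> F i = 0) -> \sum_(i < l) F i = \sum_(i < k) F i.
Proof.
move=> kl F0; rewrite -(big_mkord xpredT F) -(big_mkord xpredT F).
rewrite (@big_cat_nat _ _ _ k) //= [X in _ + X]big_nat_cond [X in _ + X]big1 ?addr0 //.
by move=> i /andP[/andP[ki _] _]; exact: F0.
Qed.

(** The left side is the inner product of [z1^s z2^t p~] with [a]. Since [p~] has the reversed
    conjugate coefficients of [p], it is the conjugate of the coefficient of [p a = p~] at
    [(m + s, n + t)], which is 0 unless [s = t = 0]. *)
Lemma conv_p_quot_shift s t :
  \sum_(j < m.+1) \sum_(k < n.+1) coef2 pt j k * conjc (a (s + j)%N (t + k)%N) =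
  conjc (coef2 pt (m + s)%N (n + t)%N).
Proof.
rewrite -[in RHS]conv_p_quot /conv rmorph_sum /=.
rewrite (@sum_ord_supp _ (fun i => conjc (\sum_(l < (n + t).+1)
  coef2 p i l * a (m + s - i)%N (n + t - l)%N)) m.+1); last 2 first.
- by rewrite ltnS leq_addr.
- by move=> i mi; rewrite big1 ?rmorph0 // => l _; rewrite coef2_p_supp ?mul0r // leqNgt mi.
rewrite [RHS](reindex_inj rev_ord_inj); apply: eq_bigr => j _ /=.
have jm : (j <= m)%N by rewrite -ltnS.
rewrite (@sum_ord_supp _ (fun l => coef2 p (m.+1 - j.+1) l *
  a (m + s - (m.+1 - j.+1))%N (n + t - l)%N) n.+1); last 2 first.
- by rewrite ltnS leq_addr.
- by move=> l nl; rewrite coef2_p_supp ?mul0r // [X in _ && X]leqNgt nl andbF.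
rewrite rmorph_sum /= [RHS](reindex_inj rev_ord_inj); apply: eq_bigr => k _ /=.
have kn : (k <= n)%N by rewrite -ltnS.
rewrite coef2_reflection jm kn /= rmorphM !subSS; congr (_ * conjc (a _ _)); lia.
Qed.

(* On the torus [conj p~ * p~ = conj p * p], so that <p~ x, p~ / p> is the     *)
(* mean of [p x].                                                              *)
Lemma dsum_conv_reflection N x : dtrunc N x = x ->
  dsum (N + m + n).+1 (fun j k => conv (coef2 pt) x j k * conjc (a j k)) =
  x 0%N 0%N * coef2 p 0 0.
Proof.
move=> xN; set K := (N + m + n)%N.
have mK i : (i < N)%N -> (m <= K - i)%N by rewrite /K; lia.
have nK i : (i < N)%N -> (n <= K - i)%N by rewrite /K; lia.
have NK i : (i < N)%N -> (i <= K)%N by rewrite /K; lia.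
have subK2 i j : (i <= K)%N -> (j <= K - i)%N -> (K - (K - i - j) = i + j)%N by lia.
(* Reversing the conjugate of [a] makes the pairing the entry [(K, K)] of a Cauchy product, where
   associativity lets [x] be split off. *)
pose a' j k := conjc (a (K - j)%N (K - k)%N).
transitivity (conv (conv (coef2 pt) x) a' K K).
  rewrite /conv -/conv; apply: eq_bigr => j _; apply: eq_bigr => k _.
  by rewrite /a' !subKn // -ltnS.
have x0 s t : ~~ ((s < N)%N && (t < N)%N) -> x s t = 0.
  by move=> st; rewrite -xN /dtrunc (negPf st).
rewrite [conv (coef2 pt) x]convC -convA /conv -/conv.
transitivity (\sum_(s < K.+1) \sum_(t < K.+1)
    x s t * conjc (coef2 pt (m + s)%N (n + t)%N)).
  apply: eq_bigr => s _; apply: eq_bigr => t _.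
  have [/andP[sN tN]|] := boolP ((s < N)%N && (t < N)%N); last first.
    by move=> /x0 ->; rewrite !mul0r.
  congr (_ * _); rewrite -conv_p_quot_shift.
  have mKs := mK _ sN; have nKt := nK _ tN; have sK := NK _ sN; have tK := NK _ tN.
  rewrite (@sum_ord_supp _ (fun j => \sum_(k < (K - t).+1)
    coef2 pt j k * a' (K - s - j)%N (K - t - k)%N) m.+1); last 2 first.
  - by rewrite ltnS.
  - by move=> i mi; rewrite big1 // => l _; rewrite coef2_reflection leqNgt mi mul0r.
  apply: eq_bigr => j _.
  rewrite (@sum_ord_supp _ (fun k => coef2 pt j k * a' (K - s - j)%N (K - t - k)%N) n.+1);
    last 2 first.
  - by rewrite ltnS.
  - by move=> i ni; rewrite coef2_reflection [X in _ && X]leqNgt ni andbF mul0r.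
  apply: eq_bigr => k _; rewrite /a'; congr (_ * conjc (a _ _)).
    have jK : (j <= K - s)%N by apply: leq_trans mKs; rewrite -ltnS.
    exact: subK2.
  have kK : (k <= K - t)%N by apply: leq_trans nKt; rewrite -ltnS.
  exact: subK2.
rewrite big_ord_recl big_ord_recl /= !addn0 coef2_reflection !leqnn !subnn /= conjcK.
rewrite [X in _ + X + _]big1 ?[X in _ + X]big1 ?addr0 //.
  move=> s _; rewrite big1 // => t _; rewrite coef2_reflection.
  by rewrite ifF ?rmorph0 ?mulr0 // /bump; apply/negP => /andP[]; lia.
move=> t _; rewrite coef2_reflection.
by rewrite ifF ?rmorph0 ?mulr0 // /bump; apply/negP => /andP[]; lia.
Qed.

End ReflectedQuotient.

(** * Monomials as arrays, and shifts *)

Section UnitArrays.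
Variable R : realType.
Implicit Types (c : nat -> nat -> R[i]) (x : nat -> nat -> R).

Definition unit2 (s t j k : nat) : R[i] := ((j == s) && (k == t))%:R.

Lemma dsum_unit2 (V : pzRingType) N (y : nat -> nat -> V) s t :
  (s < N)%N -> (t < N)%N ->
  dsum N (fun j k => y j k * ((j == s) && (k == t))%:R) = y s t.
Proof.
move=> sN tN; rewrite /dsum (bigD1 (Ordinal sN)) //= (bigD1 (Ordinal tN)) //=.
rewrite !eqxx mulr1 [X in _ + X + _]big1 ?[X in _ + X]big1 ?addr0 //.
  move=> j; rewrite -val_eqE /= => js; rewrite big1 // => k _.
  by rewrite (negPf js) mulr0.
by move=> k; rewrite -val_eqE /= => kt; rewrite (negPf kt) /= mulr0.
Qed.

Lemma sq_unit2 s t j k : sq (unit2 s t) j k = 1 * ((j == s) && (k == t))%:R.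
Proof.
by rewrite /sq /unit2 mul1r; case: (_ && _); rewrite ?normc1 ?normc0 ?expr1n ?expr0n.
Qed.

Lemma dsum_sq_unit2 N s t : dsum N (sq (unit2 s t)) <= 1.
Proof.
apply: (@le_trans _ _ (dsum (N + (s + t).+1) (sq (unit2 s t)))).
  by apply: dsum_le_widen; [exact: sq_ge0|exact: leq_addr].
rewrite (_ : sq (unit2 s t) = fun j k => 1 * ((j == s) && (k == t))%:R); last first.
  by apply/funext => j; apply/funext => k; exact: sq_unit2.
by rewrite (@dsum_unit2 _ _ (fun _ _ => 1)) //; lia.
Qed.

Lemma l2_unit2 s t : l2 (unit2 s t).
Proof. by exists 1 => N; exact: dsum_sq_unit2. Qed.

Lemma nsq_unit2_le s t : nsq (unit2 s t) <= 1.
Proof. by apply: nsq_le => N; exact: dsum_sq_unit2. Qed.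

Lemma conv_unit2 c s t j k : conv c (unit2 s t) (s + j) (t + k) = c j k.
Proof.
rewrite convC /conv; have sj : (s < (s + j).+1)%N by rewrite ltnS leq_addr.
have tk : (t < (t + k).+1)%N by rewrite ltnS leq_addr.
rewrite (bigD1 (Ordinal sj)) //= (bigD1 (Ordinal tk)) //=.
rewrite /unit2 !eqxx mul1r !addKn [X in _ + X + _]big1 ?[X in _ + X]big1 ?addr0 //.
  move=> i; rewrite -val_eqE /= => si; rewrite big1 // => l _.
  by rewrite (negPf si) mul0r.
by move=> l; rewrite -val_eqE /= => tl; rewrite (negPf tl) /= mul0r.
Qed.

Lemma dsum_shift_le N s t x : (forall j k, 0 <= x j k) ->
  dsum N (fun j k => x (s + j)%N (t + k)%N) <= dsum (N + (s + t)) x.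
Proof.
move=> x0; have shift (y : nat -> R) i M : (forall j, 0 <= y j) -> (N + i <= M)%N ->
    \sum_(0 <= j < N) y (i + j)%N <= \sum_(0 <= j < M) y j.
  move=> y0 NM; rewrite (@big_cat_nat _ _ _ i 0 M) //=; last by lia.
  rewrite [X in _ <= _ + X](@big_cat_nat _ _ _ (N + i)) //=; last by lia.
  have -> : \sum_(i <= j < N + i) y j = \sum_(0 <= j < N) y (i + j)%N.
    rewrite -{1}(add0n i) big_addn addnK; apply: eq_bigr => j _.
    by rewrite addnC.
  by rewrite addrCA lerDl addr_ge0 // sumr_ge0.
rewrite !dsum_nat.
apply: le_trans (shift (fun j => \sum_(0 <= k < N + (s + t)) x j k) s _ _ _).
- by apply: ler_sum => j _; apply: shift => //; lia.
- by move=> j; exact: sumr_ge0.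
- by lia.
Qed.

(** Multiplication by a monomial only shifts the array, so no part of the norm is lost once the
    square is enlarged by the shift. *)
Lemma dsum_sq_conv_unit2 c N s t :
  dsum N (sq c) <= dsum (N + (s + t)) (sq (conv c (unit2 s t))).
Proof.
apply: le_trans (dsum_shift_le N s t (sq_ge0 (conv c (unit2 s t)))).
by apply: ler_dsum => j k; rewrite /sq conv_unit2.
Qed.

End UnitArrays.

(** * The coefficient array of [p~ / p] has norm 1 *)

Section UnitNorm.
Variable R : realType.
Variables (m n : nat) (p : {poly {poly R[i]}}).
Hypothesis p_neq0 : forall z, bidisk z -> p.[z.1, z.2] != 0.
Hypotheses (size_p : size p = m.+1) (sizeY_p : sizeY p = n.+1).
Hypothesis rif_le1 : forall z, bidisk z -> normc (rif m n p z) <= 1.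

Let pt := reflection m n p.
Let a := quot m n p.
Let b := recip p.

Lemma horner2_bounded (P : {poly {poly R[i]}}) : exists2 B : R, 0 <= B &
  forall u v : R[i], normc u = 1 -> normc v = 1 -> normc P.[u, v] <= B.
Proof.
have [D -> _] := poly2_wide P.
exists (dsum D (fun j k => normc (coef2 P j k))).
  by apply: dsum_ge0 => *; exact: normc_ge0.
move=> u v u1 v1; rewrite horner_poly2 (le_trans (normc_dsum _ _)) //.
by apply: ler_dsum => j k; rewrite !normcM !normcX u1 v1 !expr1n !mulr1.
Qed.

(** On the torus [|p~| = |p|], and a long truncation is close to [1 / p(r z)]. The order of the
    quantifiers matters: [K0] may depend on [r], while [C] may not. *)
Lemma quotient_approx : exists C : R, forall r : R, 0 <= r -> r < 1 ->
  exists K0, forall K, (K0 <= K)%N -> forall M,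
    dsum M (sq (conv (coef2 pt) (dtrunc K (monom b r%:C%C r%:C%C)))) <= C.
Proof.
have [d ratio] : exists d, forall (u v : R[i]) (r : R), 0 <= r -> r < 1 ->
    normc u = 1 -> normc v = 1 ->
    normc p.[u, v] <= 2 ^+ d * normc p.[r%:C%C * u, r%:C%C * v].
  by eexists => u v r r0 r1 u1 v1; exact: (normc_stable_ratio p_neq0 r0 r1 u1 v1).
have [B B0 pB] := horner2_bounded p.
(* [2 ^+ d] bounds [|p(z)| / |p(r z)|], and 1 bounds the truncation error, as [K0] is chosen to make
   [B * tl K <= 1]. *)
exists ((2 ^+ d + 1) ^+ 2) => r r0 r1.
pose tl K := dseries (rmonom b r) - dsum K (rmonom b r).
have /cvgr0_norm_le/(_ 1 ltr01)[K0 _ K0P] : (fun K => B * tl K) @ \oo --> (0 : R).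
  rewrite -(mulr0 B); apply: cvgM; first exact: cvg_cst.
  by apply: dsum_tail_cvg => //; exact: ac_recip.
exists K0 => K K0K M; rewrite -coef_poly2 -coef2M.
apply: dsum_sq_coef2_le => u v u1 v1.
rewrite horner2M normcM normc_reflection // horner_poly2.
have -> : dsum K (fun j k => monom b r%:C%C r%:C%C j k * u ^+ j * v ^+ k) =
    dsum K (monom b (r%:C%C * u) (r%:C%C * v)).
  by apply: eq_dsum => j k _ _; rewrite /monom !exprMn; ring.
have ru : normc (r%:C%C * u) = r by rewrite normcM u1 mulr1 normc_real ger0_norm.
have rv : normc (r%:C%C * v) = r by rewrite normcM v1 mulr1 normc_real ger0_norm.
have zD : bidisk (r%:C%C * u, r%:C%C * v) by apply: bidisk_pair; rewrite ?ru ?rv.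
have := @ac_tail _ b (r%:C%C * u) (r%:C%C * v) r K _ (ac_recip p_neq0) r0 r1 _ _
  (expands_recip p_neq0 zD).
rewrite ru rv lexx => /(_ isT isT) /= tlP.
set S := dsum K _ in tlP *; set q := p.[_, _] in tlP *.
have q0 : q != 0 by exact: (p_neq0 zD).
have SE : normc S <= normc q^-1 + tl K.
  by rewrite -[S in leLHS](subrK q^-1) addrC (le_trans (normcD _ _)) // lerD2l.
apply: le_trans (ler_wpM2l (normc_ge0 _) SE) _; rewrite mulrDr lerD //.
  rewrite normcV ler_pdivrMr ?normc_gt0 //; exact: ratio.
apply: le_trans (ler_norm _) (le_trans _ (K0P K K0K)).
rewrite !normrM ler_wpM2r // ger0_norm ?normc_ge0 // ger0_norm //; exact: pB.
Qed.

Let rr i : R := 1 - i.+1%:R^-1.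

Lemma cvg_conv_radius j k :
  (fun i => conv (coef2 pt) (monom b (rr i)%:C%C (rr i)%:C%C) j k) @ \oo --> a j k.
Proof.
apply: cvgc_sum => s; apply: cvgc_sum => t; apply: cvgM; first exact: cvg_cst.
have r1 : (fun i => (rr i)%:C%C) @ \oo --> (1 : R[i]).
  by rewrite -[X in _ --> X](rmorph1 (real_complex R)); apply: cvgc_real; exact: cvg_one_sub_inv.
have rX l : (fun i => (rr i)%:C%C ^+ l) @ \oo --> (1 : R[i]).
  elim: l => [|l IH]; first by under eq_fun do rewrite expr0; exact: cvg_cst.
  have h : (fun i => (rr i)%:C%C * (rr i)%:C%C ^+ l) @ \oo --> (1 * 1 : R[i]).
    exact: cvgM r1 IH.
  rewrite mulr1 in h.
  by apply: eq_cvgn h => i; rewrite exprS.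
set x := recip p _ _; have h : (fun i => x * (rr i)%:C%C ^+ (j - s) *
    (rr i)%:C%C ^+ (k - t)) @ \oo --> x * 1 * 1.
  by apply: cvgM; [apply: cvgM; [exact: cvg_cst|exact: rX]|exact: rX].
by rewrite !mulr1 in h.
Qed.

(** The contraction is applied to the constant function 1. *)
Lemma l2_quot : l2 a.
Proof.
have := l2_conv (ac_quot m n p_neq0) (expands_quot p_neq0) rif_le1 (@l2_unit2 R 0 0).
suff -> : conv (quot m n p) (unit2 R 0 0) = a by [].
by apply/funext => j; apply/funext => k; exact: conv_unit2 a 0%N 0%N j k.
Qed.

(** For the lower bound, the approximants [y = p~ x] converge to [a] only coefficientwise, with
    bounded norms. This weak convergence suffices in [<y, a> = 1]: outside the square of side [M]
    the pairing is bounded by [u v <= t u^2 + v^2 / t], and the limits are taken in the order radius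
    to 1, [M] to infinity, [t] to 0. *)
Lemma nsq_quot : nsq a = 1.
Proof.
apply/eqP; rewrite eq_le; apply/andP; split.
  have := nsq_conv_le (ac_quot m n p_neq0) (expands_quot p_neq0) rif_le1 (@l2_unit2 R 0 0).
  move/le_trans/(_ (nsq_unit2_le R 0 0)).
  suff -> : conv (quot m n p) (unit2 R 0 0) = a by [].
  by apply/funext => j; apply/funext => k; exact: conv_unit2 a 0%N 0%N j k.
have [C approx] := quotient_approx.
have al := l2_quot.
pose g M i := dsum M (fun j k =>
  conv (coef2 pt) (monom b (rr i)%:C%C (rr i)%:C%C) j k * conjc (a j k)).
have step M i (t : R) : 0 < t ->
    1 <= normc (g M i) + (t * C + (nsq a - dsum M (sq a)) / t).
  move=> t0; have [ri0 ri1] := @one_sub_inv_itv R i.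
  have [K0 K0P] := approx _ ri0 ri1.
  (* With [K] above [M] the truncation changes no coefficient of the product below [M], and it keeps
     the entry of [x0] at (0, 0) needed for [full]. *)
  set x0 := monom b (rr i)%:C%C (rr i)%:C%C; set K := maxn K0 M.+1.
  set x := dtrunc K x0; set y := conv (coef2 pt) x; set L := (K + m + n).+1.
  have KM : (M < K)%N by exact: leq_maxr.
  have ML : (M <= L)%N by rewrite /L; lia.
  have yC := K0P K (leq_maxl _ _) L.
  have full : dsum L (fun j k => y j k * conjc (a j k)) = 1.
    rewrite (dsum_conv_reflection p_neq0 size_p sizeY_p) ?dtrunc_id //.
    have p00 := coef2_p_neq0 p_neq0.
    have x00 : x0 0%N 0%N = (coef2 p 0 0)^-1.
      by rewrite /x0 /monom !expr0 !mulr1 /b /recip big_ord1 expr0 coef2_1 /delta mulr1.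
    by rewrite /x /dtrunc (leq_ltn_trans (leq0n M) KM) /= x00 mulVf.
  have gE : g M i = dsum M (fun j k => y j k * conjc (a j k)).
    apply: eq_dsum => j k jM kM; congr (_ * _); apply: eq_conv => // u v uj vk.
    by rewrite /x /dtrunc ifT //; apply/andP; split; lia.
  rewrite -{1}(normc1 R) -full gE.
  rewrite -[X in normc X <= _](subrK (dsum M (fun j k => y j k * conjc (a j k)))).
  rewrite addrC (le_trans (normcD _ _)) // lerD2l (le_trans (normc_dsum_sub _ ML)) //.
  apply: le_trans (@ler_dsum_sub _ M L _ (fun j k => t * sq y j k + t^-1 * sq a j k) _ ML) _.
    move=> j k; rewrite normcM normc_conj /sq.
    set u := normc _; set v := normc _.
    have t0' : t != 0 by rewrite gt_eqF.
    have [u0 v0] : 0 <= u /\ 0 <= v by split; exact: normc_ge0.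
    have h : 0 <= t^-1 * (t * u - v) ^+ 2 by rewrite mulr_ge0 ?sqr_ge0 // invr_ge0 ltW.
    have E : t * u ^+ 2 + t^-1 * v ^+ 2 = t^-1 * (t * u - v) ^+ 2 + 2 * (u * v) by field.
    rewrite E; apply: (@le_trans _ _ (2 * (u * v))); last by rewrite lerDr.
    by rewrite ler_peMl ?mulr_ge0 ?ler1n.
  rewrite !dsumD !dsumMl opprD addrACA -!mulrBr lerD //.
    rewrite ler_wpM2l ?(ltW t0) // (le_trans _ yC) // lerBlDr lerDl.
    by apply: dsum_ge0; exact: sq_ge0.
  by rewrite mulrC ler_wpM2r ?invr_ge0 ?(ltW t0) // lerD2r dsum_le_nsq.
have step2 M (t : R) : 0 < t ->
    1 <= dsum M (sq a) + (t * C + (nsq a - dsum M (sq a)) / t).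
  move=> t0; apply: (@cvgn_ge _ 0 _ _ _ (fun i _ => step M i t t0)).
  apply: cvgD; last exact: cvg_cst.
  have -> : dsum M (sq a) = normc (dsum M (fun j k => a j k * conjc (a j k))).
    rewrite -[LHS]ger0_norm; last by apply: dsum_ge0; exact: sq_ge0.
    rewrite -normc_real rmorph_sum; congr normc; apply: eq_bigr => j _.
    by rewrite rmorph_sum; apply: eq_bigr => k _; rewrite -normc_sqrC.
  apply: cvgc_normc; apply: cvgc_sum => j; apply: cvgc_sum => k.
  by apply: cvgM; [exact: cvg_conv_radius|exact: cvg_cst].
have step3 (t : R) : 0 < t -> 1 <= nsq a + t * C.
  move=> t0; apply: (@cvgn_ge _ 0 _ _ _ (fun M _ => step2 M t t0)).
  have h := nsq_cvg al.
  have h2 : (fun M => (nsq a - dsum M (sq a)) / t) @ \oo --> (nsq a - nsq a) / t.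
    by apply: cvgM; [apply: cvgB; [exact: cvg_cst|exact: h]|exact: cvg_cst].
  have h3 : (fun M => dsum M (sq a) + (t * C + (nsq a - dsum M (sq a)) / t)) @ \oo -->
      nsq a + (t * C + (nsq a - nsq a) / t).
    by apply: cvgD => //; apply: cvgD => //; exact: cvg_cst.
  by rewrite subrr mul0r addr0 in h3.
rewrite leNgt; apply/negP => a1; pose D := `|C| + 1.
have D0 : 0 < D by rewrite ltr_wpDl.
(* This [t] makes [t * C] smaller than the supposed gap [1 - nsq a]; [D] is a positive number above
   [C]. *)
have t0 : 0 < (1 - nsq a) / (2 * D) by rewrite divr_gt0 ?mulr_gt0 ?subr_gt0.
have CD : C < D by rewrite (le_lt_trans (ler_norm C)) // ltrDl.
have := step3 _ t0; rewrite leNgt => /negP; apply.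
rewrite -ltrBrDl mulrAC ltr_pdivrMr ?mulr_gt0 // ltr_pM2l ?subr_gt0 //.
by rewrite (lt_trans CD) // ltr_pMl // ltr1n.
Qed.

End UnitNorm.

(** * From contraction and unit norm to isometry *)

Section Isometry.
Variable R : realType.
Variables (a : nat -> nat -> R[i]) (f : R[i] * R[i] -> R[i]).
Hypotheses (aa : ac a) (af : expands a f).
Hypothesis f_le1 : forall z, bidisk z -> normc (f z) <= 1.
Hypothesis a1 : nsq a = 1.
Implicit Types (c d : nat -> nat -> R[i]).

Let Tl c : l2 c -> l2 (conv a c).
Proof. exact: l2_conv aa af f_le1. Qed.

Lemma conv_lc x c d : conv a (lc x c d) = lc x (conv a c) (conv a d).
Proof.
apply/funext => j; apply/funext => k; rewrite /conv /lc mulr_sumr -big_split.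
apply: eq_bigr => s _; rewrite mulr_sumr -big_split; apply: eq_bigr => t _ /=.
by ring.
Qed.

Definition norm_defect c : R := nsq c - nsq (conv a c).

Lemma norm_defect_ge0 c : l2 c -> 0 <= norm_defect c.
Proof. by move=> cl; rewrite subr_ge0; exact: nsq_conv_le aa af f_le1 cl. Qed.

Lemma norm_defect_lc x c d : l2 c -> l2 d ->
  norm_defect (lc x c d) = normc x ^+ 2 * norm_defect c + norm_defect d +
    2 * complex.Re (x * (ip c d - ip (conv a c) (conv a d))).
Proof.
move=> cl dl; rewrite /norm_defect conv_lc !nsq_lc //; try exact: Tl.
by rewrite [x * (_ - _)]mulrBr raddfB /=; ring.
Qed.

(** The equality case of Cauchy-Schwarz: a nonnegative quadratic form that vanishes at [c] has a
    sesquilinear form that vanishes against [c]. *)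
Lemma ip_of_null c d : l2 c -> l2 d -> norm_defect c = 0 ->
  ip (conv a c) (conv a d) = ip c d.
Proof.
move=> cl dl c0; set B := ip c d - ip (conv a c) (conv a d).
suff B0 : B = 0 by apply/esym/eqP; rewrite -subr_eq0 -/B B0.
pose v := norm_defect d; pose y := normc B ^+ 2.
have h (t : R) : 0 <= t -> t * y <= v.
  (* The coefficient [- (t / 2) conj B] turns the cross term into [- t |B|^2], which must stay above
     [- v] for every [t >= 0]. *)
  move=> t0; have := norm_defect_ge0 (l2_lc (- (t / 2)%:C%C * conjc B) cl dl).
  rewrite norm_defect_lc // c0 mulr0 add0r -/B -mulrA [conjc B * B]mulrC -normc_sqrC -/y.
  have -> : - (t / 2)%:C%C * y%:C%C = (- (t * y / 2))%:C%C :> R[i].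
    by rewrite -rmorphN -rmorphM; congr (_%:C%C); rewrite mulNr mulrAC.
  by rewrite /= -/v mulrN -mulrCA mulfV ?mulr1 ?pnatr_eq0 // subr_ge0.
have y0 : 0 <= y by rewrite exprn_ge0 ?normc_ge0.
have v0 : 0 <= v by exact: norm_defect_ge0.
apply/eqP; rewrite -normc_eq0 -sqrf_eq0 -/y; apply/eqP.
apply/eqP; rewrite eq_le y0 andbT leNgt; apply/negP => yp.
have := h ((v + 1) / y) (divr_ge0 (addr_ge0 v0 ler01) y0).
by rewrite divfK ?gt_eqF // leNgt ltrDl ltr01.
Qed.

(** The product of [a] with a monomial is a shift of [a], hence has norm at least 1, while the
    monomial has norm at most 1. *)
Lemma norm_defect_unit2 s t : norm_defect (unit2 R s t) = 0.
Proof.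
apply/eqP; rewrite eq_le norm_defect_ge0 ?andbT; last exact: l2_unit2.
rewrite subr_le0 (le_trans (nsq_unit2_le R s t)) // -a1.
apply: nsq_le => N; apply: le_trans (dsum_sq_conv_unit2 a N s t) _.
by apply: dsum_le_nsq; apply: Tl; exact: l2_unit2.
Qed.

Lemma norm_defect_null_lc x c d : l2 c -> l2 d ->
  norm_defect c = 0 -> norm_defect d = 0 -> norm_defect (lc x c d) = 0.
Proof.
move=> cl dl c0 d0; rewrite norm_defect_lc // c0 d0 (ip_of_null cl dl c0).
by rewrite subrr !mulr0 !addr0.
Qed.

Let null c := l2 c /\ norm_defect c = 0.

Let null_sum (I : Type) (r : seq I) (F : I -> nat -> nat -> R[i]) (x : I -> R[i]) :
  (forall i, null (F i)) -> null (fun j k => \sum_(i <- r) x i * F i j k).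
Proof.
move=> nF; elim: r => [|i r [IHl IH0]].
  have -> : (fun j k => \sum_(i <- [::]) x i * F i j k) = fun _ _ => 0.
    by apply/funext => j; apply/funext => k; rewrite big_nil.
  have z0 : sq (fun _ _ => 0 : R[i]) = fun _ _ => 0.
    by apply/funext => j; apply/funext => k; rewrite /sq normc0 expr0n.
  have l0 : l2 (fun _ _ => 0 : R[i]).
    by exists 0 => N; rewrite z0 /dsum big1 // => j _; rewrite big1.
  split=> //; apply/eqP; rewrite eq_le norm_defect_ge0 // andbT subr_le0.
  apply: (@le_trans _ _ 0); last by apply: nsq_ge0; exact: Tl.
  by apply: nsq_le => N; rewrite z0 /dsum big1 // => j _; rewrite big1.
have -> : (fun j k => \sum_(i <- i :: r) x i * F i j k) =
    lc (x i) (F i) (fun j k => \sum_(i <- r) x i * F i j k).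
  by apply/funext => j; apply/funext => k; rewrite big_cons.
have [Fl F0] := nF i; split; first exact: l2_lc.
exact: norm_defect_null_lc.
Qed.

Lemma norm_defect_dtrunc N c : norm_defect (dtrunc N c) = 0.
Proof.
pose r := [seq (s, t) | s <- iota 0 N, t <- iota 0 N].
have -> : dtrunc N c = fun j k => \sum_(i <- r) c i.1 i.2 * unit2 R i.1 i.2 j k.
  apply/funext => j; apply/funext => k; rewrite /r big_allpairs_dep /=.
  transitivity (dsum N (fun s t => c s t * ((s == j) && (t == k))%:R)); last first.
    rewrite dsum_nat /index_iota !subn0; apply: eq_bigr => s _; apply: eq_bigr => t _.
    by rewrite /unit2 eq_sym [k == t]eq_sym.
  rewrite /dtrunc; case: ifP => [/andP[jN kN]|jkN]; first by rewrite dsum_unit2.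
  rewrite /dsum big1 // => s _; rewrite big1 // => t _.
  case: eqP => [sj|_] /=; last by rewrite mulr0.
  case: eqP => [tk|_] /=; last by rewrite mulr0.
  by move: jkN; rewrite -sj -tk !ltn_ord.
by have [] := @null_sum _ r (fun i => unit2 R i.1 i.2) (fun i => c i.1 i.2)
  (fun i => conj (l2_unit2 R i.1 i.2) (norm_defect_unit2 i.1 i.2)).
Qed.

(** A truncation has defect 0 and pairs to 0 with everything, so [c] has the defect of its tail,
    which is at most the squared norm of the tail. *)
Lemma norm_defect0 c : l2 c -> norm_defect c = 0.
Proof.
move=> cl; apply/eqP; rewrite eq_le norm_defect_ge0 // andbT.
apply: (@cvgn_ge _ 0 _ _ _ _ (nsq_tail_cvg cl)) => N _.
set t := lc (-1) (dtrunc N c) c; have tl : l2 t by apply: l2_lc => //; exact: l2_dtrunc.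
have -> : c = lc 1 (dtrunc N c) t.
  by apply/funext => j; apply/funext => k; rewrite /t /lc mul1r mulN1r addrA addrN add0r.
have dl := l2_dtrunc N c; have d0 := norm_defect_dtrunc N c.
rewrite norm_defect_lc // d0 (ip_of_null dl tl d0) subrr !mulr0 add0r addr0.
rewrite /norm_defect gerBl; apply: nsq_ge0; exact: Tl.
Qed.

Lemma ip_conv c d : l2 c -> l2 d -> ip (conv a c) (conv a d) = ip c d.
Proof. by move=> cl dl; apply: ip_of_null => //; exact: norm_defect0. Qed.

End Isometry.

(** * Hardy space, Szego kernels and the model space *)

Section HardySpace.
Variable R : realType.
Implicit Types (a c d : nat -> nat -> R[i]) (f g h : R[i] * R[i] -> R[i]).

Lemma hardy_expansionP f c : hardy_expansion f c <-> l2 c /\ expands c f.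
Proof.
split=> -[cs cf]; split=> //; first exact: (esum_lty_dsummable (sq_ge0 c)) cs.
by rewrite /square_summable (esum_dseries (sq_ge0 c) cs) ltry.
Qed.

Lemma hardy_expansion_unique f c d :
  hardy_expansion f c -> hardy_expansion f d -> c = d.
Proof.
move=> /hardy_expansionP[cl cf] /hardy_expansionP[dl df].
exact: expands_unique (l2_ac cl) (l2_ac dl) cf df.
Qed.

(** [hardy_coef] is a choice made by [get]; uniqueness of expansions identifies it. *)
Lemma hardy_coefE f c : hardy_expansion f c -> hardy_coef f = c.
Proof.
move=> fc; apply: hardy_expansion_unique (fc).
exact: getPex (ex_intro _ c fc).
Qed.

Lemma hardy_coefP f : hardy f -> hardy_expansion f (hardy_coef f).
Proof. by move=> [c fc]; rewrite (hardy_coefE fc). Qed.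

Lemma hardy_dotE f g c d : hardy_expansion f c -> hardy_expansion g d ->
  hardy_dot f g = ip c d.
Proof. by move=> /hardy_coefE fc /hardy_coefE gd; rewrite /hardy_dot fc gd. Qed.

Lemma hardy_normsqE f c : hardy_expansion f c -> hardy_normsq f = (nsq c)%:E.
Proof.
move=> fc; rewrite /hardy_normsq (hardy_coefE fc).
have [cl _] := (hardy_expansionP f c).1 fc.
exact: (esum_dseries (sq_ge0 c)).
Qed.

Lemma expands_lc (x : R[i]) f g c d : expands c f -> expands d g ->
  expands (lc x c d) (fun z => x * f z + g z).
Proof.
move=> cf dg z zD; apply: eq_cvgn (cvgD (cvgM (cvg_cst x) (cf z zD)) (dg z zD)) => N.
rewrite -[LHS]/(x * dsum N _ + dsum N _) -dsumMl -dsumD; apply: eq_dsum => j k _ _.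
by rewrite /monom /lc; ring.
Qed.

Lemma hardy_expansion_lc (x : R[i]) f g c d :
  hardy_expansion f c -> hardy_expansion g d ->
  hardy_expansion (fun z => x * f z + g z) (lc x c d).
Proof.
move=> /hardy_expansionP[cl cf] /hardy_expansionP[dl dg]; apply/hardy_expansionP.
by split; [exact: l2_lc|exact: expands_lc].
Qed.

Definition szego_coef (w : R[i] * R[i]) j k : R[i] :=
  conjc w.1 ^+ j * conjc w.2 ^+ k.

Lemma cvg_expc (q : R[i]) : normc q < 1 -> (fun N => q ^+ N) @ \oo --> (0 : R[i]).
Proof.
move=> q1; apply: (@cvgc_dist _ _ _ (fun N => normc q ^+ N)).
  by move=> N; rewrite subr0 normcX.
by apply: cvg_expr; rewrite ger0_norm ?normc_ge0.
Qed.

Lemma cvg_geomc (q : R[i]) : normc q < 1 ->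
  (fun N => \sum_(j < N) q ^+ j) @ \oo --> (1 - q)^-1.
Proof.
move=> q1; have q1' : 1 - q != 0.
  by apply: contraTneq q1 => /eqP; rewrite subr_eq0 => /eqP <-; rewrite normc1 ltxx.
have h : (fun N => (1 - q ^+ N) * (1 - q)^-1) @ \oo --> (1 - 0) * (1 - q)^-1.
  apply: cvgM; last exact: cvg_cst.
  by apply: cvgB; [exact: cvg_cst|exact: cvg_expc].
rewrite subr0 mul1r in h; apply: eq_cvgn h => N.
by rewrite -opprB subrX1 -mulNr opprB mulrAC mulfV // mul1r.
Qed.

Lemma szego_expansion w : bidisk w -> hardy_expansion (szego w) (szego_coef w).
Proof.
move=> wD; apply/hardy_expansionP; split.
  have [r [r0 r1 w1 w2]] := bidisk_max wD.
  exists ((1 - r)^-1 ^+ 2) => N; apply: le_trans (dsum_geom_le N r0 r1).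
  apply: ler_dsum => j k; rewrite /sq /szego_coef normcM !normcX !normc_conj.
  have h (x : R) i : 0 <= x -> x <= r -> 0 <= x ^+ i <= r ^+ i /\ x ^+ i <= 1.
    move=> x0 xr; rewrite exprn_ge0 //= lerXn2r ?nnegrE //.
    by rewrite exprn_ile1 // (le_trans xr) // ltW.
  have [/andP[u0 ur] u1] := h _ j (normc_ge0 _) w1.
  have [/andP[v0 vr] v1] := h _ k (normc_ge0 _) w2.
  rewrite expr2; apply: (@le_trans _ _ (normc w.1 ^+ j * normc w.2 ^+ k * 1)).
    by rewrite ler_wpM2l ?mulr_ge0 // mulr_ile1.
  by rewrite mulr1 ler_pM.
move=> z zD; rewrite /szego.
have lt1 (x y : R[i]) : normc x < 1 -> normc y < 1 -> normc (x * conjc y) < 1.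
  by move=> x1 y1; rewrite normcM normc_conj mulr_ilt1 ?normc_ge0.
apply: eq_cvgn (cvgM (cvg_geomc (lt1 _ _ zD.1 wD.1)) (cvg_geomc (lt1 _ _ zD.2 wD.2))) => N.
rewrite -[LHS]/((\sum_(j < N) _) * (\sum_(j < N) _)) mulr_suml.
apply: eq_bigr => j _; rewrite mulr_sumr; apply: eq_bigr => k _.
by rewrite /monom /szego_coef !exprMn; ring.
Qed.

Lemma ip_szego f c w : bidisk w -> hardy_expansion f c -> ip c (szego_coef w) = f w.
Proof.
move=> wD /hardy_expansionP[cl cf].
have [sl _] := (hardy_expansionP _ _).1 (szego_expansion wD).
apply: cvgc_unique (ip_cvg cl sl) _; apply: eq_cvgn (cf w wD) => N.
apply: eq_dsum => j k _ _; rewrite /monom /szego_coef rmorphM !rmorphXn /= !conjcK.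
by rewrite mulrA.
Qed.

Variables (phi : R[i] * R[i] -> R[i]) (a : nat -> nat -> R[i]).
Hypotheses (al : l2 a) (aphi : expands a phi) (a1 : nsq a = 1).
Hypothesis phi_le1 : forall z, bidisk z -> normc (phi z) <= 1.

Let aa : ac a := l2_ac al.

Lemma phi_mul_expansion h c : hardy_expansion h c ->
  hardy_expansion (fun z => phi z * h z) (conv a c).
Proof.
move=> /hardy_expansionP[cl ch]; apply/hardy_expansionP; split.
  exact: l2_conv aa aphi phi_le1 cl.
exact: expands_conv aa (l2_ac cl) aphi ch.
Qed.

Definition kernel_coef w := lc (- conjc (phi w)) (conv a (szego_coef w)) (szego_coef w).

Lemma kernel_expansion w : bidisk w ->
  hardy_expansion (model_kernel phi w) (kernel_coef w).
Proof.
move=> wD; have sE := szego_expansion wD.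
have -> : model_kernel phi w =
    (fun z => - conjc (phi w) * (phi z * szego w z) + szego w z).
  by apply/funext => z; rewrite /model_kernel; move: (szego w z) => s; ring.
exact: hardy_expansion_lc (phi_mul_expansion sE) sE.
Qed.

(** With [k_w] the Szego kernel, [<k_w, phi h>] is the conjugate of [phi(w) h(w)], and by the
    isometry [<phi k_w, phi h> = <k_w, h>] is the conjugate of [h(w)]; the two parts of the kernel
    cancel. *)
Lemma kernel_model_space w : bidisk w -> model_space phi (model_kernel phi w).
Proof.
move=> wD; split; first by exists (kernel_coef w); exact: kernel_expansion.
move=> h /hardy_coefP hE; set c := hardy_coef h in hE.
have sE := szego_expansion wD; have phE := phi_mul_expansion hE.
rewrite (hardy_dotE (kernel_expansion wD) phE) /kernel_coef.
have [cl _] := (hardy_expansionP _ _).1 hE.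
have [sl _] := (hardy_expansionP _ _).1 sE.
have [phl _] := (hardy_expansionP _ _).1 phE.
have [psl _] := (hardy_expansionP _ _).1 (phi_mul_expansion sE).
rewrite (ip_lcl _ psl sl phl) (ip_conv aa aphi phi_le1 a1 sl cl).
rewrite (ip_conj cl sl) (ip_conj phl sl).
by rewrite (ip_szego wD hE) (ip_szego wD phE) rmorphM /= mulNr addNr.
Qed.

(** The part [phi k_w] of the kernel is orthogonal to [f], which leaves the Szego kernel. *)
Lemma model_space_reproducing f w : bidisk w -> model_space phi f ->
  hardy_dot f (model_kernel phi w) = f w.
Proof.
move=> wD [/hardy_coefP fE fK]; have sE := szego_expansion wD.
have psE := phi_mul_expansion sE.
have f0 := fK _ (ex_intro _ _ sE).
rewrite (hardy_dotE fE psE) in f0; rewrite (hardy_dotE fE (kernel_expansion wD)).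
have [fl _] := (hardy_expansionP _ _).1 fE.
have [sl _] := (hardy_expansionP _ _).1 sE.
have [psl _] := (hardy_expansionP _ _).1 psE.
by rewrite (ip_lcr _ psl sl fl) f0 mulr0 add0r (ip_szego wD fE).
Qed.

Lemma model_space_lc (x : R[i]) f g : model_space phi f -> model_space phi g ->
  model_space phi (fun z => x * f z + g z).
Proof.
move=> [fh fK] [gh gK]; have fE := hardy_coefP fh; have gE := hardy_coefP gh.
have lE := hardy_expansion_lc x fE gE; split; first by exists (lc x (hardy_coef f) (hardy_coef g)).
move=> h hh; have phE := phi_mul_expansion (hardy_coefP hh).
have := fK h hh; have := gK h hh.
rewrite (hardy_dotE fE phE) (hardy_dotE gE phE) (hardy_dotE lE phE) => g0 f0.
have [fl _] := (hardy_expansionP _ _).1 fE.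
have [gl _] := (hardy_expansionP _ _).1 gE.
have [phl _] := (hardy_expansionP _ _).1 phE.
move: (conv a (hardy_coef h)) phl f0 g0 => e el f0 g0.
move: (hardy_coef f) (hardy_coef g) fl gl f0 g0 => c d cl dl c0 d0.
by rewrite (ip_lcl x cl dl el) c0 d0 mulr0 addr0.
Qed.

Lemma hardy_normsq_lc (x : R[i]) f g : hardy f -> hardy g ->
  hardy_normsq (fun z => x * f z + g z) =
  (normc x ^+ 2 * fine (hardy_normsq f) + fine (hardy_normsq g) +
   2 * complex.Re (x * hardy_dot f g))%:E.
Proof.
move=> /hardy_coefP fE /hardy_coefP gE; have lE := hardy_expansion_lc x fE gE.
rewrite (hardy_normsqE lE) (hardy_normsqE fE) (hardy_normsqE gE) /=.
rewrite (hardy_dotE fE gE) nsq_lc //.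
  by have [] := (hardy_expansionP _ _).1 fE.
by have [] := (hardy_expansionP _ _).1 gE.
Qed.

Lemma hardy_normsq0 f : hardy f -> (forall z, bidisk z -> f z = 0) ->
  hardy_normsq f = 0%E.
Proof.
move=> /hardy_coefP fE f0; rewrite (hardy_normsqE fE).
have [fl ff] := (hardy_expansionP _ _).1 fE.
have ff0 : expands (hardy_coef f) (fun=> 0) by move=> z zD; rewrite -(f0 z zD); exact: ff.
apply/eqP; rewrite eqe eq_le nsq_ge0 // andbT; apply: nsq_le => N.
rewrite /dsum big1 // => j _; rewrite big1 // => k _.
by rewrite /sq (expands0 (l2_ac fl) ff0) normc0 expr0n.
Qed.

End HardySpace.

(** * Complex integrals of bounded functions against a finite measure *)

Section ComplexIntegral.
Context d (T : measurableType d) (R : realType).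
Variable mu : {measure set T -> \bar R}.
Hypothesis mu_fin : (mu setT < +oo)%E.
Implicit Types (g h : T -> R[i]) (u v : T -> R).

Definition cmeasurable g := measurable_fun setT (fun x => complex.Re (g x)) /\
  measurable_fun setT (fun x => complex.Im (g x)).

(* Bounded Borel functions, integrable because [mu] is finite. *)
Definition bmf g := cmeasurable g /\ exists M : R, forall x, normc (g x) <= M.

Definition cint g : R[i] :=
  ((\int[mu]_x complex.Re (g x)) +i* (\int[mu]_x complex.Im (g x)))%C.

Lemma bounded_integrable u (M : R) : measurable_fun setT u ->
  (forall x, `|u x| <= M) -> mu.-integrable setT (EFin \o u).
Proof.
move=> mu_ uM; apply: measurable_bounded_integrable => //.
exists M; split; first exact: num_real.
by move=> N MN x _ /=; rewrite (le_trans (uM x)) // ltW.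
Qed.

Lemma bmf_integrable_Re g : bmf g ->
  mu.-integrable setT (EFin \o (fun x => complex.Re (g x))).
Proof.
move=> [[mr mi] [M gM]]; apply: (@bounded_integrable _ M) => // x.
exact: le_trans (normc_geRe _) (gM x).
Qed.

Lemma bmf_integrable_Im g : bmf g ->
  mu.-integrable setT (EFin \o (fun x => complex.Im (g x))).
Proof.
move=> [[mr mi] [M gM]]; apply: (@bounded_integrable _ M) => // x.
exact: le_trans (normc_geIm _) (gM x).
Qed.

Lemma ReM (x y : R[i]) : complex.Re (x * y) =
  complex.Re x * complex.Re y - complex.Im x * complex.Im y.
Proof. by case: x => a b; case: y. Qed.

Lemma ImM (x y : R[i]) : complex.Im (x * y) =
  complex.Re x * complex.Im y + complex.Im x * complex.Re y.
Proof. by case: x => a b; case: y. Qed.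

Lemma ReD (x y : R[i]) : complex.Re (x + y) = complex.Re x + complex.Re y.
Proof. exact: raddfD. Qed.

Lemma ImD (x y : R[i]) : complex.Im (x + y) = complex.Im x + complex.Im y.
Proof. exact: raddfD. Qed.

Lemma eq_ReIm (x y : R[i]) : complex.Re x = complex.Re y ->
  complex.Im x = complex.Im y -> x = y.
Proof. by case: x => a b; case: y => a' b' /= -> ->. Qed.

Lemma bmf_cst (x : R[i]) : bmf (fun=> x).
Proof. by split; [split; exact: measurable_cst|exists (normc x)]. Qed.

Lemma bmfD g h : bmf g -> bmf h -> bmf (fun x => g x + h x).
Proof.
move=> [[gr gi] [M gM]] [[hr hi] [N hN]]; split.
  split; [apply: eq_measurable_fun (measurable_funD gr hr)|
          apply: eq_measurable_fun (measurable_funD gi hi)] => x _.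
    by rewrite ReD.
  by rewrite ImD.
by exists (M + N) => x; rewrite (le_trans (normcD _ _)) // lerD.
Qed.

Lemma bmfM g h : bmf g -> bmf h -> bmf (fun x => g x * h x).
Proof.
move=> [[gr gi] [M gM]] [[hr hi] [N hN]]; split.
  split.
    apply: eq_measurable_fun (measurable_funB (measurable_funM gr hr)
      (measurable_funM gi hi)) => x _.
    by rewrite ReM.
  apply: eq_measurable_fun (measurable_funD (measurable_funM gr hi)
      (measurable_funM gi hr)) => x _.
  by rewrite ImM.
by exists (M * N) => x; rewrite normcM ler_pM ?normc_ge0.
Qed.

Lemma bmf_conj g : bmf g -> bmf (fun x => conjc (g x)).
Proof.
move=> [[gr gi] [M gM]]; split; last by exists M => x; rewrite normc_conj.
split; first by apply: eq_measurable_fun gr => x _; case: (g x).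
apply: eq_measurable_fun (measurableT_comp (@oppr_measurable R setT) gi) => x _ /=.
by case: (g x).
Qed.

Lemma cintD g h : bmf g -> bmf h -> cint (fun x => g x + h x) = cint g + cint h.
Proof.
move=> bg bh; apply: eq_ReIm; rewrite ?ReD ?ImD /cint /=.
  rewrite -RintegralD //; try exact: bmf_integrable_Re.
  by apply: eq_Rintegral => x _; rewrite ReD.
rewrite -RintegralD //; try exact: bmf_integrable_Im.
by apply: eq_Rintegral => x _; rewrite ImD.
Qed.

Lemma cintZ (a : R[i]) g : bmf g -> cint (fun x => a * g x) = a * cint g.
Proof.
move=> bg; have ir := bmf_integrable_Re bg; have ii := bmf_integrable_Im bg.
have iZ u (r : R) : mu.-integrable setT (EFin \o u) ->
    mu.-integrable setT (EFin \o (fun x => r * u x)).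
  by move=> iu; apply: eq_integrable (integrableZl measurableT r iu) => // x _.
apply: eq_ReIm; rewrite ?ReM ?ImM /cint /=.
  rewrite -!RintegralZl // -RintegralB //; try exact: iZ.
  by apply: eq_Rintegral => x _; rewrite ReM.
rewrite -!RintegralZl // -RintegralD //; try exact: iZ.
by apply: eq_Rintegral => x _; rewrite ImM.
Qed.

Lemma eq_cint g h : (forall x, g x = h x) -> cint g = cint h.
Proof. by move=> /funext ->. Qed.

Lemma Rintegral_dominated (u_ : nat -> T -> R) u (M : R) :
  (forall n, measurable_fun setT (u_ n)) -> measurable_fun setT u ->
  (forall n x, `|u_ n x| <= M) -> (forall x, (fun n => u_ n x) @ \oo --> u x) ->
  (fun n => \int[mu]_x u_ n x) @ \oo --> \int[mu]_x u x.
Proof.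
move=> mu_ m uM cu.
have uM' x : `|u x| <= M.
  by apply: (@cvgn_le _ 0 _ _ _ (fun n _ => uM n x)); apply: cvg_norm; exact: cu.
have iu := bounded_integrable m uM'.
have iM : mu.-integrable setT (EFin \o (fun=> M : R)).
  by apply: (@bounded_integrable _ `|M|) => //; exact: measurable_cst.
have cE x : (fun n => (u_ n x)%:E) @ \oo --> (u x)%:E.
  by apply: cvg_EFin; [exact: nearW|exact: cu].
have [||_ _ h] := @dominated_convergence _ _ _ mu _ measurableT
  (fun n x => (u_ n x)%:E) (fun x => (u x)%:E) (EFin \o (fun=> M))
  (fun n => (measurable_EFinP _ _).2 (mu_ n)) ((measurable_EFinP _ _).2 m) _ iM.
- by apply: aeW => x _; exact: cE.
- by apply: aeW => x n _; rewrite abse_EFin lee_fin; exact: uM.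
have fin := integrable_fin_num measurableT iu.
by rewrite -(fineK fin) in h; exact: fine_cvg h.
Qed.

Lemma cint_dominated (g_ : nat -> T -> R[i]) g (M : R) :
  (forall n, cmeasurable (g_ n)) -> cmeasurable g ->
  (forall n x, normc (g_ n x) <= M) -> (forall x, (fun n => g_ n x) @ \oo --> g x) ->
  (fun n => cint (g_ n)) @ \oo --> cint g.
Proof.
move=> mg_ mg gM cg; apply: cvgc_ReIm; rewrite /cint /=.
  apply: (@Rintegral_dominated _ _ M); [by move=> n; case: (mg_ n)|by case: mg| |].
    by move=> n x; rewrite (le_trans (normc_geRe _)).
  by move=> x; apply: cvgc_Re.
apply: (@Rintegral_dominated _ _ M); [by move=> n; case: (mg_ n)|by case: mg| |].
  by move=> n x; rewrite (le_trans (normc_geIm _)).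
by move=> x; apply: cvgc_Im.
Qed.

Definition nrm2 g : R := \int[mu]_x (normc (g x) ^+ 2).

Lemma measurable_normc2 g : cmeasurable g ->
  measurable_fun setT (fun x => normc (g x) ^+ 2).
Proof.
move=> [gr gi]; apply: eq_measurable_fun (measurable_funD (measurable_funM gr gr)
  (measurable_funM gi gi)) => x _.
by rewrite normc_sqr !expr2.
Qed.

Lemma normc2_integrable g : bmf g ->
  mu.-integrable setT (EFin \o (fun x => normc (g x) ^+ 2)).
Proof.
move=> [gm [M gM]]; apply: (@bounded_integrable _ (M ^+ 2)).
  exact: measurable_normc2.
move=> x; rewrite ger0_norm ?exprn_ge0 ?normc_ge0 //.
by rewrite lerXn2r ?nnegrE ?normc_ge0 // (le_trans (normc_ge0 (g x))).
Qed.

Lemma nrm2_EFin g : bmf g -> (\int[mu]_x (normc (g x) ^+ 2)%:E = (nrm2 g)%:E)%E.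
Proof.
by move=> bg; rewrite fineK //; apply: integrable_fin_num => //; exact: normc2_integrable.
Qed.

Lemma nrm2_lc (a : R[i]) g h : bmf g -> bmf h ->
  nrm2 (fun x => a * g x + h x) = normc a ^+ 2 * nrm2 g + nrm2 h +
    2 * complex.Re (a * cint (fun x => g x * conjc (h x))).
Proof.
move=> bg bh; have bgh := bmfM bg (bmf_conj bh).
have ig := normc2_integrable bg; have ih := normc2_integrable bh.
have ic := bmf_integrable_Re (bmfM (bmf_cst a) bgh).
have iZ u (r : R) : mu.-integrable setT (EFin \o u) ->
    mu.-integrable setT (EFin \o (fun x => r * u x)).
  by move=> iu; apply: eq_integrable (integrableZl measurableT r iu) => // x _.
rewrite -cintZ // /cint /nrm2 /= -!RintegralZl //; try exact: iZ.
rewrite -RintegralD //; try exact: iZ.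
rewrite -RintegralD //; try exact: iZ; last first.
  by apply: eq_integrable (integrableD measurableT (iZ _ (normc a ^+ 2) ig) ih).
apply: eq_Rintegral => x _.
move: (g x) (h x) => y z; rewrite !normc_sqr ReD ImD !ReM !ImM; case: z => z1 z2 /=.
by ring.
Qed.

Lemma ae_eq_nrm2 g h : cmeasurable g -> cmeasurable h -> g = h %[ae mu] ->
  (\int[mu]_x (normc (g x) ^+ 2)%:E = \int[mu]_x (normc (h x) ^+ 2)%:E)%E.
Proof.
move=> mg mh gh; apply: ae_eq_integral => //.
- by apply/measurable_EFinP; exact: measurable_normc2.
- by apply/measurable_EFinP; exact: measurable_normc2.
by apply: filterS gh => x /= e xT; rewrite e.
Qed.

End ComplexIntegral.

(** * Kernels and indicators of lines on the torus *)

Section TorusFunctions.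
Variable R : realType.

Section Limits.
Context d (T : measurableType d).
Implicit Types g h : T -> R[i].

Lemma cmeasurable_cvg (g_ : nat -> T -> R[i]) g : (forall n, bmf (g_ n)) ->
  (forall x, (fun n => g_ n x) @ \oo --> g x) -> cmeasurable g.
Proof.
move=> bg cg; split.
  apply: (@measurable_fun_cvg _ _ _ _ (fun n x => complex.Re (g_ n x))).
    by move=> n; have [[]] := bg n.
  by move=> x _; apply: cvgc_Re; exact: cg.
apply: (@measurable_fun_cvg _ _ _ _ (fun n x => complex.Im (g_ n x))).
  by move=> n; have [[]] := bg n.
by move=> x _; apply: cvgc_Im; exact: cg.
Qed.

Lemma bmf_cvg (g_ : nat -> T -> R[i]) g (M : R) : (forall n, bmf (g_ n)) ->
  (forall x, (fun n => g_ n x) @ \oo --> g x) -> (forall x, normc (g x) <= M) -> bmf g.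
Proof. by move=> bg cg gM; split; [exact: cmeasurable_cvg cg|exists M]. Qed.

Lemma bmf_sum (g_ : nat -> T -> R[i]) N : (forall n, bmf (g_ n)) ->
  bmf (fun x => \sum_(j < N) g_ j x).
Proof.
move=> bg; elim: N => [|N IH].
  by under eq_fun do rewrite big_ord0; exact: bmf_cst.
by under eq_fun do rewrite big_ord_recr; exact: bmfD.
Qed.

Lemma bmfX g N : bmf g -> bmf (fun x => g x ^+ N).
Proof.
move=> bg; elim: N => [|N IH]; first exact: bmf_cst.
by under eq_fun do rewrite exprS; exact: bmfM.
Qed.

Lemma normc_geom_le (q : R[i]) (r : R) : r < 1 -> normc q <= r ->
  normc (1 - q)^-1 <= (1 - r)^-1.
Proof.
move=> r1 qr; rewrite normcV lef_pV2 ?posrE ?subr_gt0 //.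
  by rewrite (le_trans _ (ler_normcB _ _)) // normc1 lerD2l lerN2.
rewrite (lt_le_trans _ (ler_normcB _ _)) // normc1 subr_gt0.
exact: le_lt_trans r1.
Qed.

(** Measurability is inherited from the partial sums of the geometric series. *)
Lemma bmf_geom g (r : R) : r < 1 -> bmf g -> (forall x, normc (g x) <= r) ->
  bmf (fun x => (1 - g x)^-1).
Proof.
move=> r1 bg gr; apply: (@bmf_cvg (fun n x => \sum_(j < n) g x ^+ j) _ (1 - r)^-1).
- by move=> n; apply: (bmf_sum n (fun j => bmfX j bg)).
- by move=> x; apply: cvg_geomc; exact: le_lt_trans r1.
- by move=> x; exact: normc_geom_le.
Qed.

End Limits.

(** The flag [b] says which coordinate is frozen on the line, [true] for the first one, so that both
    forms of an exceptional value are treated at once. *)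
Definition tc (b : bool) (z : torus R) : R[i] := if b then (z.1 : R[i]) else (z.2 : R[i]).

Definition swap (b : bool) (x y : R[i]) : R[i] * R[i] := if b then (x, y) else (y, x).

(** The conjugate of a one-variable Szego kernel, hence holomorphic in [x]. *)
Definition ck b (x : R[i]) (z : torus R) : R[i] := (1 - x * conjc (tc b z))^-1.

Definition chi b (tau : R[i]) (z : torus R) : R[i] := (tc b z == tau)%:R.

Lemma normc_circle (z : circle R) : normc (z : R[i]) = 1.
Proof. exact/eqP/(svalP z). Qed.

Lemma normc_tc b z : normc (tc b z) = 1.
Proof. by case: b; exact: normc_circle. Qed.

Lemma measurable_circle_coord : measurable_fun setT (@circle_coord R).
Proof.
by move=> _ Y mY; exists Y.
Qed.

Lemma bmf_tc b : bmf (tc b).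
Proof.
split; last by exists 1 => z; rewrite normc_tc.
have mc := measurable_circle_coord.
case: b; split.
- exact: measurableT_comp measurable_fst (measurableT_comp mc measurable_fst).
- exact: measurableT_comp measurable_snd (measurableT_comp mc measurable_fst).
- exact: measurableT_comp measurable_fst (measurableT_comp mc measurable_snd).
- exact: measurableT_comp measurable_snd (measurableT_comp mc measurable_snd).
Qed.

Lemma bmf_ck b x : normc x < 1 -> bmf (ck b x).
Proof.
move=> x1; apply: (@bmf_geom _ _ (fun z => x * conjc (tc b z)) _ x1).
  exact: bmfM (bmf_cst _ x) (bmf_conj (bmf_tc b)).
move=> z.
by rewrite normcM normc_conj normc_tc mulr1.
Qed.

Lemma normc_ck_le b x z : normc x < 1 -> normc (ck b x z) <= (1 - normc x)^-1.
Proof.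
by move=> x1; apply: normc_geom_le => //; rewrite normcM normc_conj normc_tc mulr1.
Qed.

Let rr i : R := 1 - i.+1%:R^-1.

Definition radial (tau : R[i]) (n : nat) : R[i] := (rr n)%:C%C * tau.

Lemma normc_radial tau n : normc tau = 1 -> normc (radial tau n) = rr n.
Proof.
move=> t1; have [h0 h1] := @one_sub_inv_itv R n.
by rewrite normcM t1 mulr1 normc_real ger0_norm.
Qed.

Lemma normc_radial_lt1 tau n : normc tau = 1 -> normc (radial tau n) < 1.
Proof. by move=> t1; rewrite normc_radial //; have [] := @one_sub_inv_itv R n. Qed.

(** This is [1 - |radial tau n|], the weight that keeps kernels at [radial tau n] bounded. *)
Definition gap (n : nat) : R[i] := (n.+1%:R^-1)%:C%C.

Lemma gapE n : (rr n)%:C%C = 1 - gap n :> R[i].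
Proof. by rewrite /gap /rr rmorphB rmorph1. Qed.

Lemma gap_neq0 n : gap n != 0.
Proof. by rewrite -normc_gt0 normc_real normr_gt0 invr_neq0 // pnatr_eq0. Qed.

Lemma cvg_gap : gap @ \oo --> (0 : R[i]).
Proof.
rewrite -[X in _ --> X](rmorph0 (real_complex R)).
by apply: cvgc_real; exact: cvg_harmonic.
Qed.

Lemma cvg_radial tau : radial tau @ \oo --> tau.
Proof.
have h : (fun n => (1 - gap n) * tau) @ \oo --> (1 - 0) * tau.
  exact: cvgM (cvgB (cvg_cst _) cvg_gap) (cvg_cst _).
rewrite subr0 mul1r in h; apply: eq_cvgn h => n.
by rewrite /radial gapE.
Qed.

Lemma conj_mul_unit (x : R[i]) : normc x = 1 -> x * conjc x = 1.
Proof. by move=> x1; rewrite -normc_sqrC x1 expr1n. Qed.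

(** On the line the denominator of the kernel is exactly [gap n], and off the line it has a nonzero
    limit. *)
Lemma cvg_gap_ck b tau z : normc tau = 1 ->
  (fun n => gap n * ck b (radial tau n) z) @ \oo --> chi b tau z.
Proof.
move=> t1; rewrite /chi; case: eqP => [zt|zt].
  apply: cvg_near_cst; apply: nearW => n.
  rewrite /ck zt /radial -mulrA conj_mul_unit // mulr1 gapE opprB addrC subrK mulfV //.
  exact: gap_neq0.
have nz : 1 - tau * conjc (tc b z) != 0.
  apply: contra_notN zt; rewrite subr_eq0 => /eqP h.
  have tz : tc b z * conjc (tc b z) = 1 by rewrite conj_mul_unit ?normc_tc.
  have cz : conjc (tc b z) != 0 by rewrite -normc_gt0 normc_conj normc_tc.
  by apply: (mulIf cz); rewrite tz.
have h : (fun n => gap n * (1 - radial tau n * conjc (tc b z))^-1) @ \oo -->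
    0 * (1 - tau * conjc (tc b z))^-1.
  apply: cvgM; first exact: cvg_gap.
  apply: cvgV => //; apply: cvgB; first exact: cvg_cst.
  by apply: cvgM; [exact: cvg_radial|exact: cvg_cst].
by rewrite mul0r in h.
Qed.

Lemma normc_gap_ck b tau n z : normc tau = 1 ->
  normc (gap n * ck b (radial tau n) z) <= 1.
Proof.
move=> t1; have x1 := normc_radial_lt1 n t1.
rewrite normcM (le_trans (ler_wpM2l (normc_ge0 _) (normc_ck_le b z x1))) //.
rewrite normc_radial // /rr opprB addrC subrK invrK normc_real ger0_norm.
  by rewrite mulVf ?pnatr_eq0.
by rewrite invr_ge0 ler0n.
Qed.

(** The indicator is measurable as a pointwise limit of weighted kernels. *)
Lemma bmf_chi b tau : normc tau = 1 -> bmf (chi b tau).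
Proof.
move=> t1; apply: (@bmf_cvg _ _ (fun n z => gap n * ck b (radial tau n) z) _ 1).
- by move=> n; apply: bmfM; [exact: bmf_cst|exact: bmf_ck (normc_radial_lt1 n t1)].
- by move=> z; exact: cvg_gap_ck.
- by move=> z; rewrite /chi; case: eqP; rewrite ?normc1 ?normc0 ?ler01.
Qed.

Lemma conj_szego b x y (z : torus R) :
  conjc (szego (swap b x y) ((z.1 : R[i]), (z.2 : R[i]))) = ck b x z * ck (~~ b) y z.
Proof.
have h (p q : R[i]) : conjc (1 - p * conjc q)^-1 = (1 - q * conjc p)^-1.
  by rewrite fmorphV rmorphB rmorph1 rmorphM /= conjcK mulrC.
by rewrite /szego rmorphM /= !h /ck /tc; case: b => //=; rewrite mulrC.
Qed.

Lemma bidisk_swap b x y : normc x < 1 -> normc y < 1 -> bidisk (swap b x y).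
Proof. by case: b => x1 y1; split. Qed.

Lemma szego_swap b x y x' y' : szego (swap b x y) (swap b x' y') =
  (1 - x' * conjc x)^-1 * (1 - y' * conjc y)^-1.
Proof. by case: b => //; rewrite /szego /= mulrC. Qed.

Lemma swap_surj b (w : R[i] * R[i]) : exists x y, w = swap b x y.
Proof. by case: w => x y; case: b; [exists x, y|exists y, x]. Qed.

Lemma cvgc_horner (q : {poly R[i]}) (u : nat -> R[i]) (l : R[i]) :
  u @ \oo --> l -> (fun n => q.[u n]) @ \oo --> q.[l].
Proof.
move=> ul; elim/poly_ind: q => [|q c IH].
  by rewrite horner0; apply: eq_cvgn (cvg_cst 0) => n; rewrite horner0.
rewrite hornerMXaddC; apply: eq_cvgn (cvgD (cvgM IH ul) (cvg_cst c)) => n.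
by rewrite hornerMXaddC.
Qed.

End TorusFunctions.

(** * Inner products through the Clark embedding *)

Section ClarkEmbedding.
Variable R : realType.
Variables (phi : R[i] * R[i] -> R[i]) (a : nat -> nat -> R[i]).
Hypotheses (al : l2 a) (aphi : expands a phi) (a1 : nsq a = 1).
Hypothesis phi_le1 : forall z, bidisk z -> normc (phi z) <= 1.
Variables (alpha : circle R) (sigma : {measure set (torus R) -> \bar R}).
Variable J : (R[i] * R[i] -> R[i]) -> torus R -> R[i].
Hypothesis sigma_fin : (sigma setT < +oo)%E.
Hypothesis J_embedding : is_clark_embedding phi alpha sigma J.

Definition kernel_image (w : R[i] * R[i]) (z : torus R) : R[i] :=
  (1 - (alpha : R[i]) * conjc (phi w)) * szego w ((z.1 : R[i]), (z.2 : R[i])).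

Lemma bmf_kernel_image w : bidisk w -> bmf (kernel_image w).
Proof.
move=> [w1 w2]; apply: bmfM; first exact: bmf_cst.
have -> : (fun z : torus R => szego w ((z.1 : R[i]), (z.2 : R[i]))) =
    fun z => conjc (ck true w.1 z * ck false w.2 z).
  apply/funext => z; rewrite -(conj_szego true) conjcK.
  by case: w {w1 w2}.
by apply: bmf_conj; apply: bmfM; exact: bmf_ck.
Qed.

Lemma nrm2_embedding f g : model_space phi f -> J f = g %[ae sigma] -> bmf g ->
  nrm2 sigma g = fine (hardy_normsq f).
Proof.
have [JL2 _ Jiso _] := J_embedding; move=> fK fg bg.
have [mr mi _] := JL2 f fK; rewrite -(Jiso f fK) /L2norm_sq.
by rewrite (ae_eq_nrm2 (conj mr mi) bg.1 fg).
Qed.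

(** Polarization: comparing the norms of [x f + K_w] and of its image gives the real part of [x]
    times either inner product, and [x = 1] and [x = i] recover the real and imaginary parts. *)
Lemma embedding_reproducing f g w : model_space phi f -> J f = g %[ae sigma] ->
  bmf g -> bidisk w -> cint sigma (fun z => g z * conjc (kernel_image w z)) = f w.
Proof.
move=> fK fg bg wD; have [_ Jlin _ Jker] := J_embedding.
have kK := kernel_model_space al aphi a1 phi_le1 wD.
have bk := bmf_kernel_image wD.
have key (x : R[i]) : complex.Re (x * cint sigma (fun z => g z * conjc (kernel_image w z))) =
    complex.Re (x * f w).
  have lK := model_space_lc al aphi phi_le1 x fK kK.
  have lJ : J (fun z => x * f z + model_kernel phi w z) =
      (fun z => x * g z + kernel_image w z) %[ae sigma].
    have h1 := Jlin x f (model_kernel phi w) fK kK; have h2 := Jker w wD.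
    by apply: filterS3 h1 h2 fg => z e1 e2 e3 zT; rewrite e1 // e2 // e3.
  have bl : bmf (fun z => x * g z + kernel_image w z).
    by apply: bmfD => //; apply: bmfM => //; exact: bmf_cst.
  have := nrm2_embedding lK lJ bl.
  rewrite (nrm2_lc sigma_fin) // (nrm2_embedding fK fg bg).
  rewrite (nrm2_embedding kK (Jker w wD) bk).
  rewrite (hardy_normsq_lc x fK.1 kK.1) /=.
  rewrite (model_space_reproducing al aphi phi_le1 wD fK).
  move=> /addrI /(mulfI _); apply; by rewrite pnatr_eq0.
apply: eq_ReIm; first by have := key 1; rewrite !mul1r.
by have := key 'i%C; rewrite !ReM /= !mul0r !mul1r !sub0r => /oppr_inj.
Qed.

Lemma embedding_kernels v w : bidisk v -> bidisk w ->
  cint sigma (fun z => kernel_image v z * conjc (kernel_image w z)) =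
  model_kernel phi v w.
Proof.
move=> vD wD; have [_ _ _ Jker] := J_embedding.
have vK := kernel_model_space al aphi a1 phi_le1 vD.
exact: (embedding_reproducing vK (Jker v vD) (bmf_kernel_image vD) wD).
Qed.

End ClarkEmbedding.

(** The expression arises from [cint_cs] with weight [g ^+ 2], where [g] is [gap]: the kernel factor
    is [(1 - (1 - g)^2)^-1], and [1 - (1 - g)^2 = g (2 - g)]. *)
Lemma cvgc_average (R : realType) (u v g : nat -> R[i]) (l m : R[i]) :
  u @ \oo --> l -> v @ \oo --> m -> g @ \oo --> (0 : R[i]) ->
  (fun n => (u n + conjc (v n) - g n) / (2 - g n)) @ \oo --> (l + conjc m) / 2.
Proof.
move=> ul vm g0; have cv := cvgc_conj vm.
have uv : (fun n => u n + conjc (v n)) @ \oo --> l + conjc m by exact: cvgD ul cv.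
have num : (fun n => u n + conjc (v n) - g n) @ \oo --> l + conjc m - 0.
  exact: cvgB uv g0.
have two : (fun _ : nat => 2 : R[i]) @ \oo --> (2 : R[i]) by exact: cvg_cst.
have den : (fun n => 2 - g n) @ \oo --> (2 - 0 : R[i]) by exact: cvgB two g0.
rewrite !subr0 in num den.
have den0 : (2 : R[i]) != 0 by rewrite pnatr_eq0.
exact: cvgM num (cvgV den0 den).
Qed.

(** * The Clark measure on a line of the torus *)

Section ExceptionalLine.
Variable R : realType.
Variables (phi : R[i] * R[i] -> R[i]) (a : nat -> nat -> R[i]).
Hypotheses (al : l2 a) (aphi : expands a phi) (a1 : nsq a = 1).
Hypothesis phi_le1 : forall z, bidisk z -> normc (phi z) <= 1.
Variables (alpha : circle R) (sigma : {measure set (torus R) -> \bar R}).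
Variable J : (R[i] * R[i] -> R[i]) -> torus R -> R[i].
Hypothesis sigma_fin : (sigma setT < +oo)%E.
Hypothesis J_embedding : is_clark_embedding phi alpha sigma J.

Definition defect (w : R[i] * R[i]) : R[i] := 1 - conjc (alpha : R[i]) * phi w.

Hypothesis defect_neq0 : forall w, bidisk w -> defect w != 0.

Let conj_defect w : conjc (defect w) = 1 - (alpha : R[i]) * conjc (phi w).
Proof. by rewrite /defect rmorphB rmorph1 rmorphM /= conjcK. Qed.

Let alphaK : conjc (alpha : R[i]) * (alpha : R[i]) = 1.
Proof. by rewrite mulrC conj_mul_unit // normc_circle. Qed.

Variables (b : bool) (tau : R[i]).
Hypothesis tau1 : normc tau = 1.

Let cs x y (z : torus R) : R[i] := ck b x z * ck (~~ b) y z.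

Let bmf_cs x y : normc x < 1 -> normc y < 1 -> bmf (cs x y).
Proof. by move=> x1 y1; apply: bmfM; exact: bmf_ck. Qed.

Let conj_kernel_image x y z : conjc (kernel_image phi alpha (swap b x y) z) =
  defect (swap b x y) * cs x y z.
Proof. by rewrite /kernel_image rmorphM /= -conj_defect conjcK conj_szego. Qed.

(** Because [|alpha| = 1], [1 - conj(phi(v)) phi(w) = conj(A(v)) + A(w) - conj(A(v)) A(w)] with [A]
    the [defect]; dividing by [conj(A(v)) A(w)] removes the scalar factors of the kernel images. *)
Lemma cint_cs x' y' x y : normc x' < 1 -> normc y' < 1 -> normc x < 1 -> normc y < 1 ->
  cint sigma (fun z => conjc (cs x' y' z) * cs x y z) =
  ((defect (swap b x y))^-1 + conjc (defect (swap b x' y'))^-1 - 1) *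
  ((1 - x * conjc x')^-1 * (1 - y * conjc y')^-1).
Proof.
move=> x'1 y'1 x1 y1; set v := swap b x' y'; set w := swap b x y.
have vD : bidisk v by exact: bidisk_swap.
have wD : bidisk w by exact: bidisk_swap.
have := embedding_kernels al aphi a1 phi_le1 sigma_fin J_embedding vD wD.
have bc := bmfM (bmf_conj (bmf_cs x'1 y'1)) (bmf_cs x1 y1).
rewrite (_ : cint sigma _ = conjc (defect v) * defect w *
    cint sigma (fun z => conjc (cs x' y' z) * cs x y z)); last first.
  rewrite -(cintZ sigma_fin) //; apply: eq_cint => z.
  rewrite conj_kernel_image -[kernel_image _ _ v z]conjcK conj_kernel_image.
  by rewrite rmorphM /=; ring.
rewrite /model_kernel szego_swap => E.
have v0 : conjc (defect v) != 0 by rewrite -normc_gt0 normc_conj normc_gt0 defect_neq0.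
have w0 := defect_neq0 wD.
apply: (mulfI (mulf_neq0 v0 w0)); rewrite {}E fmorphV [RHS]mulrA; congr (_ * _).
have -> : conjc (defect v) * defect w * ((defect w)^-1 + (conjc (defect v))^-1 - 1) =
    conjc (defect v) + defect w - conjc (defect v) * defect w.
  by field; rewrite v0 w0.
rewrite conj_defect /defect.
have -> : conjc (phi v) * phi w =
    conjc (alpha : R[i]) * (alpha : R[i]) * (conjc (phi v) * phi w).
  by rewrite alphaK mul1r.
by ring.
Qed.

Definition line_transform y : R[i] := cint sigma (fun z => chi b tau z * ck (~~ b) y z).

Let rad := radial tau.

Let rad1 n : normc (rad n) < 1.
Proof. exact: normc_radial_lt1. Qed.

Let normc01 : normc (0 : R[i]) < 1.
Proof. by rewrite normc0 ltr01. Qed.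

Let ck0 b' z : ck b' 0 z = 1 :> R[i].
Proof. by rewrite /ck mul0r subr0 invr1. Qed.

Let bmf_chi_ck y : normc y < 1 -> bmf (fun z => chi b tau z * ck (~~ b) y z).
Proof. by move=> y1; apply: bmfM; [exact: bmf_chi|exact: bmf_ck]. Qed.

(** Placing the first kernel at the origin makes it the constant 1, and only the second one tends to
    the line. *)
Lemma cvg_gap_defect y : normc y < 1 ->
  (fun n => gap R n / defect (swap b (rad n) y)) @ \oo --> line_transform y.
Proof.
(* [C] collects the terms that do not depend on [n]; the weight [gap] sends them to 0. *)
move=> y1; pose C : R[i] := conjc (defect (swap b 0 0))^-1 - 1.
have dom : (fun n => cint sigma (fun z => gap R n * ck b (rad n) z * ck (~~ b) y z))
    @ \oo --> line_transform y.
  apply: (cint_dominated sigma_fin (M := (1 - normc y)^-1)).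
  - move=> n; have [] // : bmf (fun z => gap R n * ck b (rad n) z * ck (~~ b) y z).
    by apply: bmfM; [apply: bmfM; [exact: bmf_cst|exact: bmf_ck]|exact: bmf_ck].
  - by have [] := bmf_chi_ck y1.
  - move=> n z; rewrite normcM -[leRHS]mul1r ler_pM ?normc_ge0 //.
      exact: normc_gap_ck.
    exact: normc_ck_le.
  - by move=> z; apply: cvgM; [exact: cvg_gap_ck|exact: cvg_cst].
have h : (fun n => cint sigma (fun z => gap R n * ck b (rad n) z * ck (~~ b) y z) -
    gap R n * C) @ \oo --> line_transform y - 0 * C.
  apply: cvgB; first exact: dom.
  by apply: cvgM; [exact: cvg_gap|exact: cvg_cst].
rewrite mul0r subr0 in h; apply: eq_cvgn h => n.
have -> : cint sigma (fun z => gap R n * ck b (rad n) z * ck (~~ b) y z) =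
    gap R n * cint sigma (fun z => conjc (cs 0 0 z) * cs (rad n) y z).
  have bc := bmfM (bmf_conj (bmf_cs normc01 normc01)) (bmf_cs (rad1 n) y1).
  rewrite -(cintZ sigma_fin) //; apply: eq_cint => z.
  by rewrite {1}/cs !ck0 mulr1 rmorph1 mul1r /cs mulrA.
rewrite cint_cs // !rmorph0 !mulr0 subr0 invr1 !mulr1 /C -mulrBr.
by congr (_ * _); ring.
Qed.

Lemma chiE z : conjc (chi b tau z) * chi b tau z = chi b tau z.
Proof. by rewrite /chi rmorph_nat -natrM; case: (_ == _). Qed.

(** Both kernels tend to the line, so the integrand converges to [conj(chi) chi ck = chi ck]. On the
    other side the weight is [gap^2 / (1 - (1 - gap)^2) = gap / (2 - gap)], whence the factor 1/2,
    and the resulting equation is solved for [V(y)]. *)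
Lemma line_transform_conj y : normc y < 1 ->
  line_transform y = conjc (line_transform 0).
Proof.
move=> y1; have conj_gap n : conjc (gap R n) = gap R n by exact: conjc_real.
have conjM (x x' : R[i]) : conjc (x * x') = conjc x * conjc x' := rmorphM _ x x'.
have dom : (fun n => cint sigma (fun z => conjc (gap R n * ck b (rad n) z) *
    (gap R n * ck b (rad n) z * ck (~~ b) y z))) @ \oo --> line_transform y.
  have -> : line_transform y =
      cint sigma (fun z => conjc (chi b tau z) * (chi b tau z * ck (~~ b) y z)).
    by apply: eq_cint => z; rewrite mulrA chiE.
  have bn n : bmf (fun z => gap R n * ck b (rad n) z).
    by apply: bmfM; [exact: bmf_cst|exact: bmf_ck].
  apply: (cint_dominated sigma_fin (M := (1 - normc y)^-1)).
  - move=> n; have [] // := bmfM (bmf_conj (bn n)) (bmfM (bn n) (bmf_ck (~~ b) y1)).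
  - by have [] // := bmfM (bmf_conj (bmf_chi b tau1)) (bmf_chi_ck y1).
  - move=> n z; have := normc_gap_ck b n z tau1; rewrite -/rad.
    move: (gap R n * _) => G G1; rewrite normcM normc_conj -[leRHS]mul1r.
    apply: ler_pM; rewrite ?normc_ge0 // normcM -[leRHS]mul1r.
    by apply: ler_pM; rewrite ?normc_ge0 // normc_ck_le.
  - move=> z; apply: cvgM; first by apply: cvgc_conj; exact: cvg_gap_ck.
    by apply: cvgM; [exact: cvg_gap_ck|exact: cvg_cst].
have avg := cvgc_average (cvg_gap_defect y1) (cvg_gap_defect normc01) (@cvg_gap R).
have E : line_transform y = (line_transform y + conjc (line_transform 0)) / 2.
  apply: cvgc_unique dom _; apply: eq_cvgn avg => n.
  have bc := bmfM (bmf_conj (bmf_cs (rad1 n) normc01)) (bmf_cs (rad1 n) y1).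
  have -> : cint sigma (fun z => conjc (gap R n * ck b (rad n) z) *
      (gap R n * ck b (rad n) z * ck (~~ b) y z)) =
      gap R n * gap R n * cint sigma (fun z => conjc (cs (rad n) 0 z) * cs (rad n) y z).
    rewrite -(cintZ sigma_fin) //; apply: eq_cint => z.
    by rewrite /cs ck0 mulr1 !conjM conj_gap; ring.
  rewrite cint_cs // rmorph0 mulr0 subr0 invr1 mulr1.
  have g0 := gap_neq0 R n.
  have -> : rad n * conjc (rad n) = (1 - gap R n) ^+ 2.
    rewrite -normc_sqrC normc_radial // rmorphXn; congr (_ ^+ 2).
    exact: gapE.
  have g2 : 2 - gap R n != 0.
    rewrite subr_eq0; apply/eqP => h.
    have := congr1 (@normc R) h; rewrite normc_nat normc_real ger0_norm ?invr_ge0 ?ler0n //.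
    by move=> /eqP; rewrite gt_eqF // (@le_lt_trans _ _ 1) ?ltr1n // invf_le1 ?ler1n ?ltr0n.
  have -> : 1 - (1 - gap R n) ^+ 2 = gap R n * (2 - gap R n) by ring.
  rewrite conjM conj_gap.
  set u := (defect _)^-1; set v := conjc (defect _)^-1.
  by move: u v (gap R n) g0 g2 => u v g g0 g2; field; rewrite ?g0 ?g2.
have two0 : (2 : R[i]) != 0 by rewrite pnatr_eq0.
move/(congr1 (fun t => t * 2)): E; rewrite mulfVK // mulr_natr mulr2n.
by move/addrI.
Qed.

Lemma line_transform_const y : normc y < 1 -> line_transform y = line_transform 0.
Proof. by move=> y1; rewrite (line_transform_conj y1) -(line_transform_conj normc01). Qed.

(** For [y != 0] the integral is [(V(y) - V(0)) / y], where [V] is [line_transform]; the value at 0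
    follows by dominated convergence. *)
Lemma line_moment y : normc y < 1 ->
  cint sigma (fun z => chi b tau z * conjc (tc (~~ b) z) * ck (~~ b) y z) = 0.
Proof.
have bg y' : normc y' < 1 ->
    bmf (fun z => chi b tau z * conjc (tc (~~ b) z) * ck (~~ b) y' z).
  move=> y1; apply: bmfM (bmf_ck _ y1).
  by apply: bmfM; [exact: bmf_chi|apply: bmf_conj; exact: bmf_tc].
have nz y' : normc y' < 1 -> y' != 0 ->
    cint sigma (fun z => chi b tau z * conjc (tc (~~ b) z) * ck (~~ b) y' z) = 0.
  move=> y1 y0; apply: (mulfI y0); rewrite mulr0 -(cintZ sigma_fin); last exact: bg.
  have := line_transform_const y1; move/eqP; rewrite -subr_eq0 => /eqP <-.
  rewrite -[X in _ = _ - X]mul1r -mulNr -(cintZ sigma_fin); last exact: bmf_chi_ck.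
  rewrite -(cintD sigma_fin); last 2 first.
  - exact: bmf_chi_ck.
  - by apply: bmfM; [exact: bmf_cst|exact: bmf_chi_ck].
  apply: eq_cint => z; rewrite ck0 mulr1 mulN1r.
  have nzd : 1 - y' * conjc (tc (~~ b) z) != 0.
    apply: contraTneq y1 => /eqP; rewrite subr_eq0 => /eqP h.
    have := congr1 (@normc R) h; rewrite normcM normc_conj normc_tc mulr1 normc1 => <-.
    by rewrite ltxx.
  by rewrite /ck; field.
move=> y1; have [y0|y0] := eqVneq y 0; last exact: nz.
(* Since [gap] starts at 1, the factor 1/2 keeps these nonzero points in the disk of radius 1/2,
   where the kernels are uniformly bounded. *)
pose h n : R[i] := 2^-1 * gap R n.
have h1 n : normc (h n) <= 2^-1.
  rewrite normcM normcV normc_nat normc_real ger0_norm ?invr_ge0 ?ler0n //.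
  by rewrite ler_piMr ?invr_ge0 // invf_le1 ?ltr0n // ler1n.
have half1 : 2^-1 < 1 :> R by rewrite invf_lt1 // ltr1n.
have hlt n : normc (h n) < 1 by apply: le_lt_trans half1.
have h0 : h @ \oo --> (0 : R[i]).
  by rewrite -(mulr0 2^-1); apply: cvgM; [exact: cvg_cst|exact: cvg_gap].
apply: (@cvgc_unique _ (fun n => cint sigma
  (fun z => chi b tau z * conjc (tc (~~ b) z) * ck (~~ b) (h n) z))).
  apply: (cint_dominated sigma_fin (M := (1 - 2^-1)^-1)).
  - by move=> n; have [] := bg _ (hlt n).
  - by have [] := bg _ y1.
  - move=> n z; rewrite !normcM normc_conj normc_tc mulr1 -[leRHS]mul1r.
    rewrite ler_pM ?normc_ge0 //; first by rewrite /chi; case: eqP; rewrite ?normc1 ?normc0 ?ler01.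
    by apply: normc_geom_le => //; rewrite normcM normc_conj normc_tc mulr1.
  - move=> z; apply: cvgM; first exact: cvg_cst.
    rewrite y0 /ck; apply: cvgV; first by rewrite mul0r subr0 oner_eq0.
    by apply: cvgB; [exact: cvg_cst|apply: cvgM; [exact: h0|exact: cvg_cst]].
apply: cvg_near_cst; apply: nearW => n; rewrite nz //.
by rewrite mulf_neq0 ?gap_neq0 // invr_eq0 pnatr_eq0.
Qed.

Definition line_function (z : torus R) : R[i] := chi b tau z * conjc (tc (~~ b) z).

Lemma bmf_line_function : bmf line_function.
Proof. by apply: bmfM; [exact: bmf_chi|apply: bmf_conj; exact: bmf_tc]. Qed.

Lemma preimage_line_function f w : model_space phi f ->
  J f = line_function %[ae sigma] -> bidisk w -> f w = 0.
Proof.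
move=> fK fg wD; have [x [y wE]] := swap_surj b w.
have [x1 y1] : normc x < 1 /\ normc y < 1 by move: wD; rewrite wE /bidisk /swap; case: b => -[].
rewrite -(embedding_reproducing al aphi a1 phi_le1 sigma_fin J_embedding fK fg
  bmf_line_function wD).
have bg : bmf (fun z => chi b tau z * conjc (tc (~~ b) z) * ck (~~ b) y z).
  by apply: bmfM; [exact: bmf_line_function|exact: bmf_ck].
rewrite (_ : cint sigma _ = defect w * (1 - x * conjc tau)^-1 *
    cint sigma (fun z => chi b tau z * conjc (tc (~~ b) z) * ck (~~ b) y z)).
  by rewrite line_moment ?mulr0.
rewrite -(cintZ sigma_fin) //; apply: eq_cint => z.
rewrite wE conj_kernel_image /line_function /cs.
have -> : chi b tau z * conjc (tc (~~ b) z) * (defect (swap b x y) * (ck b x z * ck (~~ b) y z)) =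
    defect (swap b x y) * (chi b tau z * ck b x z) * conjc (tc (~~ b) z) * ck (~~ b) y z by ring.
have -> : chi b tau z * ck b x z = chi b tau z * (1 - x * conjc tau)^-1.
  by rewrite /chi /ck; case: eqP => [->//|_]; rewrite !mul0r.
by ring.
Qed.

(* If [defect] has a zero at [tau] along the line, its order there must be 1, *)
(* since [gap / defect] has a finite limit.                                    *)
Lemma line_transform_neq0 (q N : {poly R[i]}) :
  (forall x, normc x < 1 -> defect (swap b x 0) * q.[x] = N.[x]) ->
  N.[tau] = 0 -> q.[tau] != 0 -> line_transform 0 != 0.
Proof.
move=> qN Nt qt; have /factor_theorem[N1 N1E] : root N tau by rewrite rootE Nt.
(* As [rad n - tau = - gap n * tau], this second factor turns [gap / defect] into [q.[rad n]]. *)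
have lhs : (fun n => gap R n / defect (swap b (rad n) 0) * (- tau * N1.[rad n])) @ \oo -->
    line_transform 0 * (- tau * N1.[tau]).
  apply: cvgM; first exact: cvg_gap_defect.
  by apply: cvgM; [exact: cvg_cst|apply: cvgc_horner; exact: cvg_radial].
have E : line_transform 0 * (- tau * N1.[tau]) = q.[tau].
  apply: cvgc_unique lhs _.
  have qr : (fun n => q.[rad n]) @ \oo --> q.[tau].
    by apply: cvgc_horner; exact: cvg_radial.
  apply: eq_cvgn qr => n.
  have rD : bidisk (swap b (rad n) 0) by exact: bidisk_swap.
  have d0 := defect_neq0 rD; have g0 := gap_neq0 R n.
  apply: (mulfI d0); rewrite (qN _ (rad1 n)) N1E hornerM hornerXsubC.
  have -> : radial tau n - tau = - (gap R n * tau) by rewrite /radial gapE; ring.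
  by move: (defect _) d0 (gap R n) (N1.[_]) => D d0 g t; field.
by apply: contraNneq qt => V0; rewrite -E V0 mul0r.
Qed.

Lemma not_unitary_of_line : line_transform 0 != 0 ->
  ~ unitary (model_space phi) sigma J.
Proof.
move=> V0 [_ surj]; have bg := bmf_line_function.
have gL2 : L2 sigma line_function.
  by split; [exact: bg.1.1|exact: bg.1.2|rewrite /L2norm_sq (nrm2_EFin sigma_fin) // ltry].
have [f fK fg] := surj _ gL2.
have f0 := preimage_line_function fK fg.
have := nrm2_embedding J_embedding fK fg bg; rewrite (hardy_normsq0 fK.1 f0) /= => n0.
(* The squared modulus of [line_function] is the indicator of the line, so its norm gives the real
   part of [line_transform 0]; the imaginary part is 0 since this number equals its conjugate. *)
move/negP: V0; apply; apply/eqP; apply: eq_ReIm; last first.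
  have := congr1 (@complex.Im R) (line_transform_conj normc01).
  by case: (line_transform 0) => r s /=; lra.
rewrite /line_transform /cint /= -n0; apply: eq_Rintegral => z _.
rewrite /line_function normcM normc_conj normc_tc mulr1 ck0 mulr1 /chi.
by case: (_ == _); rewrite ?normc1 ?normc0 ?expr1n ?expr0n.
Qed.

End ExceptionalLine.

(** * Bounds read off the Poisson integral of the Clark measure *)

Section ClarkMeasure.
Variable R : realType.
Variables (phi : R[i] * R[i] -> R[i]) (alpha : circle R).
Variable sigma : {measure set (torus R) -> \bar R}.
Hypothesis sigma_clark : clark_measure phi alpha sigma.

(** A Poisson integral of a positive measure is nonnegative, hence so is [1 - |phi(z)|^2]. If
    [phi z = alpha], where the quotient is 0 by convention, the modulus is 1 anyway. *)
Lemma clark_normc_le1 z : bidisk z -> normc (phi z) <= 1.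
Proof.
move=> zD; rewrite leNgt; apply/negP => phi1.
have pos : 0 < normc ((alpha : R[i]) - phi z).
  rewrite normc_gt0 subr_eq0; apply: contraTneq phi1 => <-.
  by rewrite normc_circle ltxx.
have : (0 <= ((1 - normc (phi z) ^+ 2) / normc ((alpha : R[i]) - phi z) ^+ 2)%:E)%E.
  rewrite (sigma_clark zD); apply: integral_ge0 => zeta _; rewrite lee_fin /poisson.
  have [z1 z2] := zD.
  by rewrite mulr_ge0 // divr_ge0 ?exprn_ge0 ?normc_ge0 // subr_ge0 exprn_ile1 ?normc_ge0 // ltW.
rewrite lee_fin pmulr_lge0 ?invr_gt0 ?exprn_gt0 // subr_ge0 leNgt.
by rewrite exprn_egt1.
Qed.

(** At the origin the Poisson kernel is 1, so the integral is the total mass. *)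
Lemma clark_finite : (sigma setT < +oo)%E.
Proof.
have := sigma_clark (bidisk0 R).
have -> : (fun zeta => (poisson ((0, 0) : R[i] * R[i]) zeta)%:E) = (fun=> 1%E).
  apply/funext => zeta; rewrite /poisson /= !subr0 !normc_circle normc0.
  by rewrite expr0n /= subr0 expr1n divr1 mulr1.
by rewrite integral_cst // mul1e => <-; rewrite ltry.
Qed.

End ClarkMeasure.

(** * A rational inner function of positive degree is not constant *)

Section Nonconstant.
Variable R : realType.
Variables (m n : nat) (p : {poly {poly R[i]}}).
Hypothesis p_den : rif_denominator m n p.
Hypothesis m_gt0 : (0 < m)%N.

(** If [phi] were a constant [c], then [p~ = c p] and [p] itself would be a common factor, which is
    not a unit because [m > 0]. *)
Lemma rif_not_constant (c : R[i]) : ~ (forall z, bidisk z -> rif m n p z = c).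
Proof.
have [p_neq0 size_p sizeY_p coprime_p] := p_den; move=> phic.
set pt := reflection m n p.
have ptE : pt = p * c%:P%:P.
  have E : coef2 pt = coef2 (c%:P%:P * p).
    apply: (@expands_unique _ _ _ (fun z => pt.[z.1, z.2])).
    - exact: ac_coef2.
    - exact: ac_coef2.
    - exact: expands_coef2.
    - move=> z zD; have := @expands_coef2 R (c%:P%:P * p) z zD; rewrite /= horner2M !hornerC.
      by rewrite -(phic z zD) /rif divfK // p_neq0.
  apply/polyP => j; apply/polyP => k; rewrite mulrC.
  by have := congr1 (fun f => f j k) E.
have := coprime_p p 1 c%:P%:P (esym (mulr1 p)) ptE.
by rewrite poly_unitE size_p; case: m m_gt0.
Qed.

End Nonconstant.

Theorem theorem4p3 (R : realType) (m n : nat) (p : {poly {poly R[i]}})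
    (alpha : circle R) (sigma : {measure set (torus R) -> \bar R})
    (J : (R[i] * R[i] -> R[i]) -> torus R -> R[i]) :
  (0 < m)%N -> (0 < n)%N ->
  rif_denominator m n p ->
  inner_function (rif m n p) ->
  exceptional (rif m n p) alpha ->
  clark_measure (rif m n p) alpha sigma ->
  is_clark_embedding (rif m n p) alpha sigma J ->
  ~ unitary (model_space (rif m n p)) sigma J.
Proof.
move=> m_gt0 n_gt0 p_den _ exc sigma_clark J_emb.
have [p_neq0 size_p sizeY_p _] := p_den.
set phi := rif m n p in exc sigma_clark J_emb *.
have phi_le1 := clark_normc_le1 sigma_clark.
have sigma_fin := clark_finite sigma_clark.
have al := l2_quot p_neq0 phi_le1.
have a1 := nsq_quot p_neq0 size_p sizeY_p phi_le1.
have aphi : expands (quot m n p) phi := expands_quot p_neq0.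
have alpha0 : (alpha : R[i]) != 0 by rewrite -normc_gt0 normc_circle ltr01.
have alphaK : (alpha : R[i]) * conjc (alpha : R[i]) = 1.
  by rewrite conj_mul_unit // normc_circle.
(* A zero [v] makes the kernel image at [v] vanish, so [K_v(w) = 0] for all [w]; the Szego factor is
   not 0, and therefore [phi(w) = alpha] throughout the bidisk. *)
have defect0 v : bidisk v -> defect phi alpha v != 0.
  move=> vD; apply/eqP => dv0.
  apply: (rif_not_constant p_den m_gt0 (c := (alpha : R[i]))) => w wD.
  have := embedding_kernels al aphi a1 phi_le1 sigma_fin J_emb vD wD.
  have phiv : conjc (alpha : R[i]) * phi v = 1.
    by apply/esym/eqP; rewrite -subr_eq0 -/(defect phi alpha v) dv0.
  have phiv' : phi v = alpha by rewrite -[LHS]mul1r -alphaK -mulrA phiv mulr1.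
  have k0 z : kernel_image phi alpha v z * conjc (kernel_image phi alpha w z) = 0 * 0 :> R[i].
    by rewrite /kernel_image phiv' alphaK subrr !mul0r.
  rewrite (eq_cint _ k0) (cintZ sigma_fin) ?mul0r; last exact: bmf_cst.
  move/esym/eqP; rewrite /model_kernel mulf_eq0 => /orP[|].
    rewrite subr_eq0 phiv' => /eqP E.
    by rewrite -[LHS]mul1r -alphaK -mulrA -E mulr1.
  have nz (x y : R[i]) : normc x < 1 -> normc y < 1 -> (1 - x * conjc y)^-1 != 0.
    move=> x1 y1; rewrite invr_eq0 subr_eq0; apply/eqP => h.
    have := congr1 (@normc R) h; rewrite normc1 normcM normc_conj => h1.
    have := mulr_ilt1 (normc_ge0 x) (normc_ge0 y) x1 y1.
    by rewrite -h1 ltxx.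
  by rewrite /szego mulf_eq0 (negPf (nz _ _ wD.1 vD.1)) (negPf (nz _ _ wD.2 vD.2)).
have [tau [b phi_tau]] : exists tau : circle R, exists b, forall w : R[i],
    normc w < 1 -> phi (swap b (tau : R[i]) w) = alpha.
  by case: exc => tau [h|h]; exists tau; [exists true|exists false] => w w1; exact: h.
have restrict (P : {poly {poly R[i]}}) : exists q : {poly R[i]}, forall x,
    q.[x] = P.[(swap b x 0).1, (swap b x 0).2].
  by exists (if b then slice 1 0 P else slice 0 1 P) => x; case: b {phi_tau};
    rewrite horner_slice mulr1 mulr0.
have [q qE] := restrict p; have [qt qtE] := restrict (reflection m n p).
have n01 : normc (0 : R[i]) < 1 by rewrite normc0 ltr01.
have tauE : qt.[tau] / q.[tau] = alpha by rewrite qE qtE -(phi_tau 0 n01).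
(* Division by zero gives 0, so a zero of [q] at [tau] would contradict [alpha != 0]. *)
have q_tau : q.[tau] != 0.
  by apply: contra_neq alpha0 => q0; rewrite -tauE q0 invr0 mulr0.
apply: (not_unitary_of_line al aphi a1 phi_le1 sigma_fin J_emb defect0
  (b := b) (normc_circle tau)).
(* On this slice [defect] is the quotient of [q - conj(alpha) qt] by [q], and the numerator vanishes
   at [tau] because [phi] takes the value [alpha] there. *)
apply: (line_transform_neq0 al aphi a1 phi_le1 sigma_fin J_emb defect0 (normc_circle tau)
  (q := q) (N := q - (conjc (alpha : R[i]))%:P * qt)) => //.
- move=> x x1; have xD : bidisk (swap b x 0) by exact: bidisk_swap.
  rewrite hornerD hornerN hornerM hornerC /defect mulrBl mul1r -mulrA; congr (_ - _ * _).
  by rewrite qE qtE /phi /rif divfK // p_neq0.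
- rewrite hornerD hornerN hornerM hornerC.
  have -> : qt.[tau] = (alpha : R[i]) * q.[tau] by rewrite -tauE divfK.
  by rewrite mulrA [conjc _ * _]mulrC alphaK mul1r subrr.
Qed.
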